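(* Suppose that $\lim_{m\to\infty} \ell_m/m=\mu$ for some $\mu\in(0,\theta_\infty)$. Then the maximum likelihood estimator $\widehat{\beta}(X^m(\ell_m))$ of the true parameter $\beta^{(0)}$ satisfies $$\sqrt{m}\,\bigl(\widehat{\beta}(X^{m}(\ell_m))-\beta^{(0)}\bigr)\to \mathcal{N}\Bigl(0,\bigl(J^{(0)}(\mu)\bigr)^{-1}\Bigr)$$ in distribution under $\mathsf{P}^{(0)}_m$ as $m\to\infty$, where $\mathcal{N}\bigl(0,(J^{(0)}(\mu))^{-1}\bigr)$ is the Gaussian vector in $\mathbb{R}^N$ with zero mean and covariance matrix $(J^{(0)}(\mu))^{-1}$.
   Context: **Model (cooperative sequential adsorption, CSA).** Fix a dimension $d\ge 1$, a known interaction radius $R>0$, and an integer $N\ge1$. Let $\beta_0=1$, $\beta_1,\dots,\beta_N>0$ and $\beta_k=0$ for $k\ge N+1$; write $\beta=(\beta_1,\dots,\beta_N)$. For $x\in\mathbb{R}^d$ and a finite sequence $\mathbf{y}=(y_1,\dots,y_n)$ in $\mathbb{R}^d$, let $\nu(x,\mathbf{y})$ be the number of indices $i$ with $|x-y_i|\le R$, and $\nu(x,\emptyset)=0$. For $m\in\{1,2,\dots\}$ let $D_m=m^{1/d}D_1$, where $D_1\subset\mathbb{R}^d$ is the unit cube centred at the origin. The CSA in $D_m$ with parameter $\beta$ produces points $X^m_1,X^m_2,\dots\in D_m$ sequentially: with $X^m(k)=(X^m_1,\dots,X^m_k)$, $X^m(0)=\emptyset$, the conditional density of $X^m_{k+1}$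 given $X^m(k)$ is $$x\mapsto \frac{\beta_{\nu(x,X^m(k))}}{\int_{D_m}\beta_{\nu(y,X^m(k))}\,dy},\qquad x\in D_m,$$ as long as the denominator is positive. The process jams (stops) at the first $k=K_m$ for which the denominator vanishes. The jamming density $\theta_\infty(\beta)\in(0,\infty)$ is the limit in probability of $K_m/m$ as $m\to\infty$ (known to exist). The law of the CSA in $D_m$ with parameter $\beta$ is $\mathsf{P}_{m,\beta}$. The parameter set is an open set $\mathcal{B}\subset\mathbb{R}^N$ contained in the positive orthant; $\beta^{(0)}=(\beta^{(0)}_1,\dots,\beta^{(0)}_N)\in\mathcal{B}$ is the fixed true parameter, $\mathsf{P}^{(0)}_m=\mathsf{P}_{m,\beta^{(0)}}$, and $\theta_\infty=\theta_\infty(\beta^{(0)})$. A monotonically increasing sequence of positive integers $\ell_m$ is fixed; $\ell_m$ is the number of observed points in $D_m$, and $X^m(\ell_m)$ is the observation. **Statistics and likelihood.** For $0\le j\le N$ let $t_j(X^m(\ell_m))=\sum_{i=1}^{\ell_m}\mathbf{1}\{\nu(X^m_i,X^m(i-1))=j\}$ and $\Gamma^m_{j,k}=\int_{D_m}\mathbf{1}\{\nu(u,X^m(k))=j\}\,du$. The log likelihood is $$L_m(X^m(\ell_m),\beta)=\sum_{k=1}^N t_k(X^m(\ell_m))\log\beta_k-\sum_{k=1}^{\ell_m}\log\Bigl(\Gamma^m_{0,k-1}+\sum_{j=1}^N\beta_j\Gamma^m_{j,k-1}\Bigr).$$ The maximum likelihood estimator $\widehat\beta(X^m(\ell_m))=(\widehat\beta_{1,m},\dots,\widehat\beta_{N,m})$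 is the maximizer of $\beta\mapsto L_m(X^m(\ell_m),\beta)$, found as the positive solution of $\partial L_m(X^m(\ell_m),\beta)/\partial\beta_j=0$, $j=1,\dots,N$. It is known that if $\ell_m/m\to\mu\in(0,\theta_\infty)$ then, with $\mathsf{P}^{(0)}_m$-probability tending to $1$, a unique positive solution exists; on the complementary event (including the event $K_m<\ell_m$, whose probability tends to $0$) the estimator is defined arbitrarily. **Limit matrix.** For $\lambda\in(0,\theta_\infty)$ and $0\le j\le N$, let $\gamma^{(0)}_j(\lambda)$ be the limit in $\mathsf{P}^{(0)}_m$-probability of $\Gamma^m_{j,k_m}/m$ as $m\to\infty$ for integers $k_m$ with $k_m/m\to\lambda$ (these limits are known to exist, and to be strictly positive and continuous in $\lambda$). Put $Z(\lambda)=\gamma^{(0)}_0(\lambda)+\sum_{i=1}^N\beta^{(0)}_i\gamma^{(0)}_i(\lambda)$ and $$Q^{(0)}_{ij}(\lambda)=\frac{\gamma^{(0)}_i(\lambda)}{\beta^{(0)}_iZ(\lambda)}\delta_{ij}-\frac{\gamma^{(0)}_i(\lambda)\gamma^{(0)}_j(\lambda)}{Z(\lambda)^2},\quad 1\le i,j\le N,\qquad J^{(0)}(\mu)=\int_0^\mu Q^{(0)}(\lambda)\,d\lambda .$$ Equivalently, $J^{(0)}(\mu)$ is the limit in $\mathsf{P}^{(0)}_m$-probability of $-\frac1m\bigl(\partial^2L_m(X^m(\ell_m),\beta)/\partial\beta_i\partial\beta_j\bigr)_{i,j=1}^N$ at $\beta=\beta^{(0)}$ when $\ell_m/m\to\mu$.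 The matrix $J^{(0)}(\mu)$ is known to be positive definite. *)

(* Defs.v *)
From HB Require Import structures.
From mathcomp Require Import all_boot all_order all_algebra.
From mathcomp Require Import all_classical all_reals all_analysis.
From mathcomp Require Import measurable_realfun.

Set Implicit Arguments.
Unset Strict Implicit.
Unset Printing Implicit Defensive.

Import Order.TTheory GRing.Theory Num.Theory.
Import numFieldNormedType.Exports.

Local Open Scope classical_set_scope.
Local Open Scope ring_scope.

Definition rV_display : measure_display.
Proof. exact: (measure_tuple_display default_measure_display). Qed.

(* R^n is 'rV[R]_n, with the sigma-algebra generated by the coordinates, that
   is, the Borel sigma-algebra. *)
Section measurable_rV.
Context {R : realType} {n : nat}.

Let coord : 'I_n -> 'rV[R]_n -> R := fun i x => x ord0 i.

Let rV_set0 : g_sigma_preimage coord set0.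
Proof. exact: sigma_algebra0. Qed.

Let rV_setC A : g_sigma_preimage coord A -> g_sigma_preimage coord (~` A).
Proof. exact: sigma_algebraC. Qed.

Let rV_bigcup (F : (set 'rV[R]_n)^nat) : (forall i, g_sigma_preimage coord (F i)) ->
  g_sigma_preimage coord (\bigcup_i (F i)).
Proof. exact: sigma_algebra_bigcup. Qed.

HB.instance Definition _ := @isMeasurable.Build rV_display
  'rV[R]_n (g_sigma_preimage coord) rV_set0 rV_setC rV_bigcup.

End measurable_rV.

Lemma measurable_rV_coord {R : realType} n (i : 'I_n) :
  measurable_fun [set: 'rV[R]_n] (fun x => x ord0 i).
Proof.
move=> _ Y mY; rewrite setTI; apply: sub_sigma_algebra => /=.
rewrite -bigcup_seq/=; exists i => /=; first by rewrite mem_index_enum.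
by exists Y => //; rewrite setTI.
Qed.

Lemma measurable_fun_rVP {R : realType} {disp} {T : measurableType disp} n
    (f : T -> 'rV[R]_n) :
  measurable_fun setT f <->
  forall i, measurable_fun setT (fun t => f t ord0 i).
Proof.
split=> [mf i|mf].
  apply: (@measurableT_comp _ _ _ _ _ _ (fun x : 'rV[R]_n => x ord0 i)) => //.
  exact: measurable_rV_coord.
move=> _ A mA; rewrite setTI.
suff : @measurable _ 'rV[R]_n `<=` [set A | measurable (f @^-1` A)] by exact.
apply: smallest_sub.
  split=> /=.
  - by rewrite preimage_set0.
  - by move=> C mC; rewrite setTD preimage_setC; exact: measurableC.
  - by move=> F mF; rewrite preimage_bigcup; exact: bigcup_measurable.
rewrite -bigcup_seq; apply: bigcup_sub => i _ _ [C mC <-] /=.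
rewrite setTI -comp_preimage -[X in measurable X]setTI.
exact: mf.
Qed.

(* Lebesgue measure on R^n, by induction on n. *)
Section lebesgue_rV.
Context {R : realType}.

Definition rV_cons n (p : R * 'rV[R]_n) : 'rV[R]_n.+1 :=
  \row_(i < n.+1) (if unlift ord0 i is Some j then p.2 ord0 j else p.1).

Lemma measurable_rV_cons n : measurable_fun setT (@rV_cons n).
Proof.
apply/measurable_fun_rVP => i; case: (unliftP ord0 i) => [j ->|->].
  rewrite (_ : (fun t => _) = (fun x : 'rV[R]_n => x ord0 j) \o snd).
    by apply: measurableT_comp => //; exact: measurable_rV_coord.
  by apply/funext => p; rewrite mxE liftK.
rewrite (_ : (fun t => _) = fst) //.
by apply/funext => p; rewrite mxE unlift_none.
Qed.

Definition leb_cons n (mu : {sigma_finite_measure set 'rV[R]_n -> \bar R}) :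
    set 'rV[R]_n.+1 -> \bar R :=
  pushforward (@lebesgue_measure R \x mu)%E (@rV_cons n).

Section leb_cons_measure.
Variables (n : nat) (mu : {sigma_finite_measure set 'rV[R]_n -> \bar R}).

Let leb_cons0 : leb_cons mu set0 = 0%E.
Proof. by rewrite /leb_cons /pushforward preimage_set0 measure0. Qed.

Let leb_cons_ge0 A : (0 <= leb_cons mu A)%E.
Proof. by rewrite /leb_cons /pushforward measure_ge0. Qed.

Let leb_cons_sigma_additive : semi_sigma_additive (leb_cons mu).
Proof.
move=> F mF tF mUF; rewrite /leb_cons /pushforward preimage_bigcup.
apply: measure_semi_sigma_additive.
- by move=> k; rewrite -[X in measurable X]setTI; exact: measurable_rV_cons.
- apply/trivIsetP => /= i j _ _ ij; rewrite -preimage_setI.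
  by move/trivIsetP : tF => /(_ _ _ _ _ ij) ->//; rewrite preimage_set0.
- rewrite -preimage_bigcup -[X in measurable X]setTI.
  exact: measurable_rV_cons.
Qed.

HB.instance Definition _ := isMeasure.Build _ _ _ (leb_cons mu)
  leb_cons0 leb_cons_ge0 leb_cons_sigma_additive.

Let rV_uncons (x : 'rV[R]_n.+1) : R * 'rV[R]_n :=
  (x ord0 ord0, \row_j x ord0 (lift ord0 j)).

Let rV_consK : cancel (@rV_cons n) rV_uncons.
Proof.
move=> [a x]; congr pair; first by rewrite mxE unlift_none.
by apply/rowP => j; rewrite !mxE liftK.
Qed.

Let measurable_rV_uncons : measurable_fun setT rV_uncons.
Proof.
apply/measurable_fun_pairP; split; first exact: measurable_rV_coord.
apply/measurable_fun_rVP => i.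
rewrite (_ : (fun t => _) = fun x : 'rV[R]_n.+1 => x ord0 (lift ord0 i)).
  exact: measurable_rV_coord.
by apply/funext => x; rewrite mxE.
Qed.

Let leb_cons_sigma_finite : sigma_finite setT (leb_cons mu).
Proof.
have /sigma_finiteP[F [TF ndF Foo]] := sigma_finiteT (@lebesgue_measure R).
have /sigma_finiteP[G [TG ndG Goo]] := sigma_finiteT mu.
exists (fun i => rV_uncons @^-1` (F i `*` G i)).
  rewrite -preimage_bigcup (_ : \bigcup_i _ = setT) ?preimage_setT//.
  rewrite -setXTT TF TG predeqE => -[x y]; split.
    by move=> [n' _ []/= ? ?]; split; exists n'.
  move=> [/= [i _ Fix] [k _ Gky]]; exists (maxn i k) => //; split.
  - by move: x Fix; exact/subsetPset/ndF/leq_maxl.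
  - by move: y Gky; exact/subsetPset/ndG/leq_maxr.
move=> i; have [mFi Fioo] := Foo i; have [mGi Gioo] := Goo i; split.
  rewrite -[X in measurable X]setTI; apply: measurable_rV_uncons => //.
  exact: measurableX.
rewrite /leb_cons /pushforward -comp_preimage.
rewrite (_ : rV_uncons \o _ = id) ?preimage_id.
  by rewrite product_measure1E// lte_mul_pinfty// ge0_fin_numE.
by apply/funext => p /=; rewrite rV_consK.
Qed.

HB.instance Definition _ := Measure_isSigmaFinite.Build _ _ _ (leb_cons mu)
  leb_cons_sigma_finite.

End leb_cons_measure.

Fixpoint lebesgue_rV n : {sigma_finite_measure set 'rV[R]_n -> \bar R} :=
  match n with
  | 0 => dirac (0 : 'rV[R]_0)
  | n'.+1 => leb_cons (lebesgue_rV n')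
  end.

End lebesgue_rV.

Section gaussian.
Context {R : realType} {n : nat}.
Implicit Type Sigma : 'M[R]_n.

Definition gaussian_pdf Sigma (x : 'rV[R]_n) : R :=
  expR (- (x *m invmx Sigma *m x^T) ord0 ord0 / 2) /
  Num.sqrt ((2 * pi) ^+ n * \det Sigma).

(* The centred Gaussian law on R^n with positive definite covariance matrix
   Sigma; it has no meaning when Sigma is not positive definite. *)
Definition gaussian Sigma : set 'rV[R]_n -> \bar R := fun A =>
  (\int[lebesgue_rV n]_(x in A) (gaussian_pdf Sigma x)%:E)%E.

Lemma gaussian_pdf_ge0 Sigma x : 0 <= gaussian_pdf Sigma x.
Proof. by rewrite divr_ge0 ?expR_ge0 ?sqrtr_ge0. Qed.

Lemma measurable_gaussian_pdf Sigma : measurable_fun setT (gaussian_pdf Sigma).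
Proof.
apply: measurable_funM => //; apply: measurableT_comp => //.
apply: measurable_funM => //; apply: measurableT_comp => //.
under eq_fun do rewrite mxE.
apply: measurable_sum => i; apply: measurable_funM.
  under eq_fun do rewrite mxE.
  apply: measurable_sum => j; apply: measurable_funM => //.
  exact: measurable_rV_coord.
under eq_fun do rewrite mxE.
exact: measurable_rV_coord.
Qed.

Section gaussian_measure.
Variable Sigma : 'M[R]_n.

Let gaussian0 : gaussian Sigma set0 = 0%E.
Proof. by rewrite /gaussian integral_set0. Qed.

Let gaussian_ge0 A : (0 <= gaussian Sigma A)%E.
Proof. by apply: integral_ge0 => x _; rewrite lee_fin gaussian_pdf_ge0. Qed.

Let gaussian_sigma_additive : semi_sigma_additive (gaussian Sigma).
Proof.
move=> F mF tF mUF; rewrite /gaussian ge0_integral_bigcup//=.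
- apply: is_cvg_ereal_nneg_natsum_cond => k _ _.
  by apply: integral_ge0 => x _; rewrite lee_fin gaussian_pdf_ge0.
- apply/measurable_EFinP; apply: measurable_funTS.
  exact: measurable_gaussian_pdf.
- by move=> x _; rewrite lee_fin gaussian_pdf_ge0.
Qed.

HB.instance Definition _ := isMeasure.Build _ _ _ (gaussian Sigma)
  gaussian0 gaussian_ge0 gaussian_sigma_additive.

End gaussian_measure.
End gaussian.

Section convergence_of_random_variables.
Context {R : realType} {disp : nat -> measure_display}
  {Omega : forall m, measurableType (disp m)}
  (P : forall m, probability (Omega m) R).

Definition cvg_in_probability (Y : forall m, Omega m -> \bar R) (c : R) :=
  forall e : R, 0 < e ->
    P m [set w | (e%:E <= `|Y m w - c%:E|)%E] @[m --> \oo] --> 0%E.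

Definition cvg_in_distribution n (Y : forall m, Omega m -> 'rV[R]_n)
    (mu : {measure set 'rV[R]_n -> \bar R}) :=
  forall f : 'rV[R]_n -> R, continuous f -> (exists M, forall x, `|f x| <= M) ->
    (\int[P m]_w (f (Y m w))%:E)%E @[m --> \oo] --> (\int[mu]_x (f x)%:E)%E.

End convergence_of_random_variables.

Section csa.
Context {R : realType} (d N : nat) (r : R).
Local Notation point := 'rV[R]_d.
Local Notation param := 'rV[R]_N.
Implicit Types (m k j : nat) (beta : param) (y : seq point).

(* The library norm on 'rV[R]_d is the sup norm. *)
Definition euclidean_dist (u v : point) : R :=
  Num.sqrt (\sum_(i < d) (u ord0 i - v ord0 i) ^+ 2).

Definition nu (u : point) y : nat := count (fun v => euclidean_dist u v <= r) y.

(* beta_0 = 1 and beta_k = 0 for k > N; the coordinate beta_(i+1) is stored at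
   index i : 'I_N. *)
Definition rate beta k : R :=
  if k is k'.+1 then oapp (fun i : 'I_N => beta ord0 i) 0 (insub k') else 1.

Definition cube m : set point :=
  [set u | forall i, `|u ord0 i| <= (m%:R `^ d%:R^-1) / 2].

Definition total_rate m beta y : R :=
  \int[lebesgue_rV d]_(u in cube m) rate beta (nu u y).

Definition first_points disp (Omega : measurableType disp)
    (P : probability Omega R) (X : nat -> {RV P >-> point}) k (w : Omega) :
    k.-tuple point :=
  [tuple X i w | i < k].

(* X is the CSA in the cube of volume m. The random variable X k is the
   (k+1)-st point; after jamming its value is unconstrained. *)
Definition is_csa m beta disp (Omega : measurableType disp)
    (P : probability Omega R) (X : nat -> {RV P >-> point}) : Prop :=
  forall k (B : set (k.-tuple point)) (A : set point),
    measurable B -> measurable A ->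
    let H := [set w | B (first_points X k w) /\
                      0 < total_rate m beta (first_points X k w)] in
    P (H `&` X k @^-1` A) =
    (\int[P]_(w in H) \int[lebesgue_rV d]_(u in cube m `&` A)
       (rate beta (nu u (first_points X k w)) /
        total_rate m beta (first_points X k w))%:E)%E.

(* K_m, equal to +oo on the (negligible) event that the process never jams. *)
Definition jamming_time m beta disp (Omega : measurableType disp)
    (P : probability Omega R) (X : nat -> {RV P >-> point}) (w : Omega) :
    \bar R :=
  ereal_inf [set k%:R%:E | k in
    [set k | total_rate m beta (first_points X k w) = 0]].

Definition t_stat j y : nat :=
  \sum_(i < size y) (nu (nth 0%R y i) (take i y) == j).

Definition Gamma m j y : R :=
  \int[lebesgue_rV d]_(u in cube m) (nu u y == j)%:R.

Definition loglik m y beta : R :=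
  \sum_(i < N) (t_stat i.+1 y)%:R * ln (beta ord0 i) -
  \sum_(k < size y) ln (Gamma m 0 (take k y) +
    \sum_(i < N) beta ord0 i * Gamma m i.+1 (take k y)).

Definition positive beta : Prop := forall i, 0 < beta ord0 i.

Definition score_zero m y beta : Prop :=
  forall i, is_derive beta (delta_mx ord0 i) (loglik m y) 0.

Definition is_mle m y beta : Prop :=
  [/\ positive beta, score_zero m y beta &
      forall beta', positive beta' -> loglik m y beta' <= loglik m y beta].

Definition Z (gamma : nat -> R -> R) beta lambda : R :=
  gamma 0 lambda + \sum_(i < N) beta ord0 i * gamma i.+1 lambda.

Definition Q (gamma : nat -> R -> R) beta lambda : 'M[R]_N :=
  \matrix_(i, j)
    (gamma i.+1 lambda / (beta ord0 i * Z gamma beta lambda) * (i == j)%:R -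
     gamma i.+1 lambda * gamma j.+1 lambda / Z gamma beta lambda ^+ 2).

Definition J (gamma : nat -> R -> R) beta mu : 'M[R]_N :=
  \matrix_(i, j)
    \int[lebesgue_measure]_(lambda in `]0, mu[) Q gamma beta lambda i j.

End csa.

(* Main.v *)
(** Fix a direction v. At the true parameter, the derivative of the log likelihood in
    direction v is a sum over the observed points of
    sum_j c_j (1{the point has j neighbours} - p_j), where c_(i+1) = v_i / beta0_i,
    c_0 = 0, and p_j = beta_j Gamma_j / sum_i beta_i Gamma_i is the conditional
    probability of having j neighbours. These are bounded martingale differences with
    conditional variances v Q_k v, and (1/m) sum_k Q_k -> J by a law of large numbers
    along Gamma / m. Compensating the characteristic function by
    exp (sum of the conditional variances / 2) and using Levy's theorem, the score
    divided by sqrt m, called W, converges in law to N(0, J).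

    On the event that W is bounded and (1/m) sum_k Q_k is close to J, the maximum of the
    likelihood on a small box round beta0 is attained at an interior critical point b.
    There the likelihood equations read W = sqrt m (b - beta0) J_m + O(sqrt m |b - beta0|^2),
    and b is the only positive critical point because symmetrised Kullback-Leibler
    divergences are nonnegative. Hence sqrt m (beta_hat - beta0) - W J^-1 -> 0 in
    probability, and Slutsky's lemma concludes. *)
From HB Require Import structures.
From mathcomp Require Import all_boot all_order all_algebra.
From mathcomp Require Import all_classical all_reals all_analysis.
From mathcomp Require Import measurable_realfun ring lra.
Require Import Defs.
Set Implicit Arguments.
Unset Strict Implicit.
Unset Printing Implicit Defensive.
Import Order.TTheory GRing.Theory Num.Theory.
Import numFieldNormedType.Exports.
Local Open Scope classical_set_scope.
Local Open Scope ring_scope.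

(** * Bounded measurable functions and their expectations *)

Section bounded_measurable.
Context {d} {T : measurableType d} {R : realType}.
Implicit Types f g : T -> R.

(** Three obstacles shape the argument. The estimator is tied to the likelihood only where a unique
    positive critical point exists, so existence and uniqueness have to be established. That part is
    deterministic, for arbitrary areas and counts and with thresholds uniform in them, so that it
    applies to each trajectory outside a small event. The conditional variances are random and
    converge only in mean. The characteristic function is therefore compensated by a factor that is
    known one step ahead, and this factor is replaced by its limit at the end. The areas converge
    along deterministic sequences only. A sum over the steps is treated as an integral over a level
    l, with step floor (l m), and convergence holds at each fixed level. All random variables whose
    expectation is taken are bounded, which [bdm] records: integrability is then automatic, and
    conditional expectations are expressed by testing against bounded functions of the past. *)

Definition bdm f := measurable_fun setT f /\ exists M, forall x, `|f x| <= M.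

Lemma bdm_cst (c : R) : bdm (fun=> c).
Proof. by split=> //; exists `|c|. Qed.

Lemma bdmD f g : bdm f -> bdm g -> bdm (fun x => f x + g x).
Proof.
move=> [mf [M fM]] [mg [M' gM]]; split; first exact: measurable_funD.
by exists (M + M') => x; rewrite (le_trans (ler_normD _ _))// lerD.
Qed.

Lemma bdmM f g : bdm f -> bdm g -> bdm (fun x => f x * g x).
Proof.
move=> [mf [M fM]] [mg [M' gM]]; split; first exact: measurable_funM.
by exists (M * M') => x; rewrite normrM ler_pM.
Qed.

Lemma bdmN f : bdm f -> bdm (fun x => - f x).
Proof.
move=> [mf [M fM]]; split; first exact: measurable_funN.
by exists M => x; rewrite normrN.
Qed.

Lemma bdmB f g : bdm f -> bdm g -> bdm (fun x => f x - g x).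
Proof. by move=> bf bg; apply: bdmD => //; exact: bdmN. Qed.

Lemma bdm_norm f : bdm f -> bdm (fun x => `|f x|).
Proof.
move=> [mf [M fM]]; split; first exact: measurableT_comp.
by exists M => x; rewrite normr_id.
Qed.

Lemma bdm_sum I (s : seq I) (p : pred I) (F : I -> T -> R) :
  (forall i, p i -> bdm (F i)) -> bdm (fun x => \sum_(i <- s | p i) F i x).
Proof.
move=> bF; elim: s => [|i s IH].
  by under eq_fun do rewrite big_nil; exact: bdm_cst.
under eq_fun do rewrite big_cons.
by case: (boolP (p i)) => pi //; apply: bdmD => //; exact: bF.
Qed.

Lemma bdmX f n : bdm f -> bdm (fun x => f x ^+ n).
Proof.
move=> bf; elim: n => [|n IH]; first exact: bdm_cst.
by under eq_fun do rewrite exprS; exact: bdmM.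
Qed.

Lemma bdm_indic (A : set T) : measurable A -> bdm (\1_A : T -> R).
Proof.
move=> mA; split; first exact: measurable_indic.
exists 1 => x; rewrite indicE; case: (x \in A); by rewrite ?normr1 ?normr0.
Qed.

Lemma bdm_comp f (h : R -> R) : bdm f -> measurable_fun setT h ->
  (forall M, exists K, forall y, `|y| <= M -> `|h y| <= K) ->
  bdm (fun x => h (f x)).
Proof.
move=> [mf [M fM]] mh /(_ M)[K hK]; split; first exact: measurableT_comp.
by exists K => x; exact: hK.
Qed.

Lemma bdm_expR f : bdm f -> bdm (fun x => expR (f x)).
Proof.
move=> bf; apply: bdm_comp => // M; exists (expR M) => y yM.
by rewrite ger0_norm ?expR_ge0// ler_expR (le_trans (ler_norm _)).
Qed.

Lemma bdm_cos f : measurable_fun setT f -> bdm (fun x => cos (f x)).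
Proof.
move=> mf; split.
  by apply: measurableT_comp => //; apply: continuous_measurable_fun; exact: continuous_cos.
by exists 1 => x; rewrite ler_norml cos_geN1 cos_le1.
Qed.

Lemma bdm_sin f : measurable_fun setT f -> bdm (fun x => sin (f x)).
Proof.
move=> mf; split.
  by apply: measurableT_comp => //; apply: continuous_measurable_fun; exact: continuous_sin.
by exists 1 => x; rewrite ler_norml sin_geN1 sin_le1.
Qed.

End bounded_measurable.

Lemma bdm_integrable_fin {d} {T : measurableType d} {R : realType}
  (mu : {measure set T -> \bar R}) (f : T -> R) : (mu setT < +oo)%E ->
  bdm f -> mu.-integrable setT (EFin \o f).
Proof.
move=> muoo [mf [M fM]]; apply/integrableP; split; first exact/measurable_EFinP.
have M0 : 0 <= `|M| by [].
apply: (@le_lt_trans _ _ (\int[mu]_(x in setT) (cst `|M|%:E) x)%E).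
  apply: ge0_le_integral => //.
  - by apply: measurableT_comp => //; exact/measurable_EFinP.
  - by move=> x _ /=; rewrite lee_fin (le_trans (fM x))// ler_norm.
by rewrite (integral_cst mu measurableT) lte_mul_pinfty.
Qed.

Section expectation.
Context {d} {T : measurableType d} {R : realType}.
(** A measure of mass one instead of a [probability]: the same rules then serve the laws of the
    model and [gaussian], whose mass is known only from [gaussianT]. *)
Variables (mu : {measure set T -> \bar R}) (mu1 : mu setT = 1%E).
Implicit Types f g : T -> R.

Lemma bdm_integrable f : bdm f -> mu.-integrable setT (EFin \o f).
Proof. by apply: bdm_integrable_fin; rewrite mu1 ltry. Qed.

Lemma EFin_Rintegral f : bdm f -> (\int[mu]_x f x)%:E = (\int[mu]_x (f x)%:E)%E.
Proof.
move=> bf; rewrite /Rintegral fineK//; apply: integrable_fin_num => //.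
exact: bdm_integrable.
Qed.

Lemma Ex_cst (c : R) : \int[mu]_x c = c.
Proof. by rewrite Rintegral_cst// mu1 mulr1. Qed.

Lemma ExD f g : bdm f -> bdm g ->
  \int[mu]_x (f x + g x) = \int[mu]_x f x + \int[mu]_x g x.
Proof. by move=> bf bg; apply: RintegralD => //; exact: bdm_integrable. Qed.

Lemma ExB f g : bdm f -> bdm g ->
  \int[mu]_x (f x - g x) = \int[mu]_x f x - \int[mu]_x g x.
Proof. by move=> bf bg; apply: RintegralB => //; exact: bdm_integrable. Qed.

Lemma ExZ c f : bdm f -> \int[mu]_x (c * f x) = c * \int[mu]_x f x.
Proof. by move=> bf; apply: RintegralZl => //; exact: bdm_integrable. Qed.

Lemma Ex_sum I (s : seq I) (p : pred I) (F : I -> T -> R) :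
  (forall i, p i -> bdm (F i)) ->
  \int[mu]_x (\sum_(i <- s | p i) F i x) = \sum_(i <- s | p i) \int[mu]_x F i x.
Proof.
move=> bF; elim: s => [|i s IH].
  by under eq_Rintegral do rewrite big_nil; rewrite big_nil Ex_cst.
under eq_Rintegral do rewrite big_cons.
rewrite big_cons; case: (boolP (p i)) => pi //.
by rewrite ExD ?IH//; [exact: bF|exact: bdm_sum].
Qed.

Lemma le_Ex f g : bdm f -> bdm g -> (forall x, f x <= g x) ->
  \int[mu]_x f x <= \int[mu]_x g x.
Proof. by move=> bf bg fg; apply: le_Rintegral => //; exact: bdm_integrable. Qed.

Lemma normr_Ex f : bdm f -> `|\int[mu]_x f x| <= \int[mu]_x `|f x|.
Proof. by move=> bf; apply: le_normr_Rintegral => //; exact: bdm_integrable. Qed.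

Lemma normr_Ex_le f g : bdm f -> bdm g -> (forall x, `|f x| <= g x) ->
  `|\int[mu]_x f x| <= \int[mu]_x g x.
Proof.
move=> bf bg fg; apply: (le_trans (normr_Ex bf)); apply: le_Ex => //.
exact: bdm_norm.
Qed.

Lemma Ex_indic (A : set T) : measurable A -> \int[mu]_x \1_A x = fine (mu A).
Proof. by move=> mA; rewrite /Rintegral integral_indic// setIT. Qed.

Lemma markov_bdm (A : set T) f (c : R) : measurable A -> bdm f -> 0 < c ->
  (forall x, 0 <= f x) -> (forall x, A x -> c <= f x) ->
  fine (mu A) <= (\int[mu]_x f x) / c.
Proof.
move=> mA bf c0 f0 fA; rewrite ler_pdivlMr// mulrC -Ex_indic//.
rewrite -ExZ; last exact: bdm_indic.
apply: le_Ex => //; first exact: bdmM (bdm_cst _) (bdm_indic _).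
move=> x; rewrite indicE; case: (boolP (x \in A)) => [/set_mem /fA|_]; rewrite ?mulr1 ?mulr0//.
Qed.

End expectation.

(** * Gaussian integrals *)

Section integrable_EFin.
Context {d} {T : measurableType d} {R : realType}.
Variable mu : {measure set T -> \bar R}.

Lemma integrable_EFinZ (c : R) (f : T -> R) : mu.-integrable setT (EFin \o f) ->
  mu.-integrable setT (EFin \o (fun x => c * f x)).
Proof.
move=> intf; rewrite (_ : EFin \o _ = (fun x => c%:E * (EFin \o f) x)%E).
  exact: integrableZl.
by apply/funext => x /=; rewrite EFinM.
Qed.

Lemma integrable_EFinD (f g : T -> R) : mu.-integrable setT (EFin \o f) ->
  mu.-integrable setT (EFin \o g) ->
  mu.-integrable setT (EFin \o (fun x => f x + g x)).
Proof.
move=> intf intg; rewrite (_ : EFin \o _ = ((EFin \o f) \+ (EFin \o g))%E).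
  exact: integrableD.
by apply/funext => x /=; rewrite EFinD.
Qed.

Lemma integrable_EFinB (f g : T -> R) : mu.-integrable setT (EFin \o f) ->
  mu.-integrable setT (EFin \o g) ->
  mu.-integrable setT (EFin \o (fun x => f x - g x)).
Proof.
move=> intf intg; rewrite (_ : EFin \o _ = ((EFin \o f) \- (EFin \o g))%E).
  exact: integrableB.
by apply/funext => x /=; rewrite EFinB.
Qed.

Lemma integrable_mono (f g : T -> R) : mu.-integrable setT (EFin \o g) ->
  measurable_fun setT f -> (forall x, `|f x| <= g x) ->
  mu.-integrable setT (EFin \o f).
Proof.
move=> ig mf fg; apply: (le_integrable measurableT _ _ ig).
  exact/measurable_EFinP.
by move=> x _ /=; rewrite lee_fin (le_trans (fg x))// ler_norm.
Qed.

End integrable_EFin.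

Section gaussian_integral_1d.
Context {R : realType}.
Notation mu := (@lebesgue_measure R).

(** The normalisation of the normal density with mean [m]; the parameter [s] is the inverse
    variance, the one-dimensional case of an inverse covariance matrix. *)
Lemma integral_gaussian_1d (s m : R) : 0 < s ->
  (\int[mu]_x (expR (- (s * (x - m) ^+ 2) / 2))%:E =
   (Num.sqrt (2 * pi / s))%:E)%E.
Proof.
move=> s0; pose sg := (Num.sqrt s)^-1.
have sg0 : sg != 0 by rewrite gt_eqF// invr_gt0 sqrtr_gt0.
have sg2 : sg ^+ 2 = s^-1 by rewrite exprVn sqr_sqrtr// ltW.
have pk0 := normal_peak_gt0 sg0.
have := integral_normal_pdf m sg; rewrite (normal_pdfE _ sg0) => h.
transitivity ((normal_peak sg)^-1%:E * 1)%E; last first.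
  rewrite mule1 /normal_peak invrK sg2 -mulr_natl; congr (Num.sqrt _)%:E.
  by rewrite [s^-1 * _]mulrC mulrA.
rewrite -h -ge0_integralZl//; first last.
- by rewrite lee_fin invr_ge0 ltW.
- by move=> x _; rewrite lee_fin mulr_ge0 ?expR_ge0// ltW.
- apply/measurable_EFinP; apply: measurable_funM => //.
  exact: measurable_normal_fun.
apply: eq_integral => x _; rewrite -EFinM mulKf ?gt_eqF//.
rewrite /normal_fun sg2 -mulr_natl; congr (expR _)%:E.
by field; rewrite gt_eqF.
Qed.

Lemma integrable_gaussian_1d (s m : R) : 0 < s ->
  mu.-integrable setT (EFin \o (fun x => expR (- (s * (x - m) ^+ 2) / 2))).
Proof.
move=> s0; apply/integrableP; split.
  apply/measurable_EFinP/measurableT_comp => //; apply: measurable_funM => //.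
  apply/measurableT_comp => //; apply: measurable_funM => //.
  by apply: measurable_funX; exact: measurable_funB.
under eq_integral do rewrite /= ger0_norm ?expR_ge0//.
by rewrite integral_gaussian_1d// ltry.
Qed.

(** Fundamental theorem of calculus on [-n, n] and dominated convergence. Applied to a product, this
    is integration by parts without boundary terms. *)
Lemma Rintegral_derive_eq0 (F f : R -> R) :
  (forall x, is_derive x (1 : R) F (f x)) -> continuous f ->
  mu.-integrable setT (EFin \o f) ->
  F n%:R @[n --> \oo] --> 0 -> F (- n%:R) @[n --> \oo] --> 0 ->
  \int[mu]_x f x = 0.
Proof.
move=> dF cf intf F0 FN0.
have mf : measurable_fun setT f by apply: continuous_measurable_fun.
have cF : continuous F.
  by move=> x; apply: differentiable_continuous; exact/derivable1_diffP.
pose fn (n : nat) := f \_ `[- n%:R, n%:R].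
have [] := @dominated_convergence _ _ R mu setT measurableT
  (fun n => EFin \o fn n) (EFin \o f) (EFin \o (fun x => `|f x|)).
- move=> n; apply/measurable_EFinP.
  by apply/(measurable_restrictT _ _).1 => //; exact: measurable_funTS.
- exact/measurable_EFinP.
- apply: aeW => x _; apply: cvg_near_cst; near=> n.
  rewrite /= /fn patchE ifT// inE/= in_itv/= -ler_norml.
  by near: n; exact: nbhs_infty_ger.
- exact: integrable_abse intf.
- apply: aeW => x n _ /=; rewrite lee_fin /fn patchE.
  by case: ifPn => // _; rewrite normr0.
move=> _ _ h; rewrite /Rintegral.
suff -> : (\int[mu]_x (f x)%:E = 0)%E by [].
apply: (@cvg_unique _ (@ereal_hausdorff R) _ _ _ _ h).
rewrite (_ : 0%E = (0 - 0)%:E); last by rewrite subr0.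
apply: (@cvg_trans _ ((F n%:R - F (- n%:R))%:E @[n --> \oo])); last first.
  by apply: cvg_EFin; [exact: nearW|exact: cvgB].
apply: near_eq_cvg; near=> n.
have n0 : (0 < n)%N by near: n; exact: nbhs_infty_gt.
have nn : (- n%:R < n%:R :> R) by rewrite gtrN ?ltr0n.
rewrite /= EFinB -(@continuous_FTC2 _ f F _ _ nn); first last.
- by move=> x _; rewrite derive1E; apply: derive_val.
- split => [x _|| ].
  + exact: ex_derive.
  + exact/cvg_at_right_filter/cF.
  + exact/cvg_at_left_filter/cF.
- exact: continuous_subspaceT.
by rewrite [LHS]integral_mkcond; apply: eq_integral => x _; rewrite restrict_EFin.
Unshelve. all: end_near. Qed.

(** * Characteristic function of the one-dimensional Gaussian *)

Section characteristic.
Variables (s m : R) (s0 : 0 < s).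
Let g (x : R) : R := expR (- (s * (x - m) ^+ 2) / 2).

Let g_derive (x : R) : is_derive x (1 : R) g (- s * (x - m) * g x).
Proof.
by apply: is_derive_eq; rewrite /g /GRing.scale /=; field.
Qed.

(** Completing a square bounds the values at [e n] by a geometric sequence of ratio [expR (- s)].
    The sign [e] treats both ends of the line at once. *)
Let g_lim (e : R) : `|e| = 1 -> g (e * n%:R) @[n --> \oo] --> 0.
Proof.
move=> e1.
apply: (@squeeze_cvgr _ _ _ _ (cst 0) (fun n => expR (s * (`|m| *+ 2 + 1) / 2) * (expR (- s)) ^+ n)).
- apply: nearW => n; rewrite expR_ge0/= -expRM_natl -expRD ler_expR.
  have h : e * m <= `|m| by rewrite (le_trans (ler_norm _))// normrM e1 mul1r.
  have e2 : e ^+ 2 = 1 by rewrite -real_normK ?num_real// e1 expr1n.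
  have : 0 <= s * ((e * (e * n%:R - m) - 1) ^+ 2 + 2 * (`|m| - e * m)).
    rewrite mulr_ge0 ?(ltW s0)// addr_ge0 ?sqr_ge0// mulr_ge0// subr_ge0//.
  rewrite -(subr_ge0 (- _ / 2)).
  suff -> : s * (`|m| *+ 2 + 1) / 2 + n%:R * - s - - (s * (e * n%:R - m) ^+ 2) / 2 =
    s * ((e * (e * n%:R - m) - 1) ^+ 2 + 2 * (`|m| - e * m)) / 2.
    by move=> ?; rewrite divr_ge0.
  apply/eqP; rewrite -subr_eq0; apply/eqP.
  transitivity (s * (1 - e ^+ 2) * ((e * n%:R - m) ^+ 2 - 2 * n%:R) / 2);
    last by rewrite e2 subrr mulr0 !mul0r.
  by field.
- exact: cvg_cst.
- rewrite -(mulr0 (expR (s * (`|m| *+ 2 + 1) / 2))); apply: cvgMr.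
  by apply: cvg_expr; rewrite ger0_norm ?expR_ge0// expR_lt1 oppr_lt0.
Qed.

(** Half of the Gaussian exponent pays for the factor |y|, y = x - m: 1 + y^2 <= K (1 + s y^2 / 4)
    <= K exp (s y^2 / 4). The remaining half keeps [dom] integrable. *)
Let K := 1 + 4 / s.
Let dom (x : R) := K * expR (- (s / 2 * (x - m) ^+ 2) / 2).

Let g_dom (x : R) : `|(x - m) * g x| <= dom x.
Proof.
rewrite normrM (ger0_norm (expR_ge0 _)) /g /dom.
rewrite (_ : - (s * (x - m) ^+ 2) / 2 =
  - (s / 2 * (x - m) ^+ 2) / 2 + - (s / 2 * (x - m) ^+ 2) / 2); last by field.
rewrite expRD mulrA ler_wpM2r ?expR_ge0//.
rewrite mulNr expRN ler_pdivrMr ?expR_gt0//.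
set y := x - m.
have h := expR_ge1Dx (s / 2 * y ^+ 2 / 2).
have y1 : `|y| <= 1 + y ^+ 2.
  rewrite ler_norml; apply/andP; split; rewrite -subr_ge0.
    have := sqr_ge0 (y + 1/2); lra.
  have := sqr_ge0 (y - 1/2); lra.
apply: (le_trans y1); apply: (le_trans _ (ler_wpM2l _ h)); last first.
  by rewrite addr_ge0// divr_ge0// ltW.
rewrite /K -subr_ge0.
rewrite (_ : _ - _ = 4 / s + s / 4 * y ^+ 2); last by field; rewrite gt_eqF.
have s1 := ltW s0; apply: addr_ge0; first exact: divr_ge0.
by apply: mulr_ge0; [exact: divr_ge0|exact: sqr_ge0].
Qed.

Let int_dom : mu.-integrable setT (EFin \o dom).
Proof.
by apply: integrable_EFinZ; apply: integrable_gaussian_1d; rewrite divr_gt0.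
Qed.

(** The phase [b] lets real cosines replace the complex exponential: b = 0 and b = - pi / 2 give its
    real and imaginary parts. *)
Let F b (t : R) := \int[mu]_x (cos (t * (x - m) + b) * g x).

Let cont_g : continuous g.
Proof.
by move=> x; apply: differentiable_continuous; exact/derivable1_diffP.
Qed.

Let mg : measurable_fun setT g.
Proof. by apply: continuous_measurable_fun. Qed.

Let cont_lin (t b : R) : continuous (fun x : R => t * (x - m) + b).
Proof.
by move=> x; apply: differentiable_continuous; exact/derivable1_diffP.
Qed.

Let int_cos b t : mu.-integrable setT (EFin \o (fun x => cos (t * (x - m) + b) * g x)).
Proof.
apply: (integrable_mono (integrable_gaussian_1d m s0)).
  apply: measurable_funM => //; apply: continuous_measurable_fun => x.
  by apply: continuous_comp; [exact: cont_lin|exact: continuous_cos].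
move=> x; rewrite normrM (ger0_norm (expR_ge0 _)) ler_piMl ?expR_ge0//.
by rewrite ler_norml cos_geN1 cos_le1.
Qed.

Let int_ysin b t : mu.-integrable setT
  (EFin \o (fun x => (x - m) * sin (t * (x - m) + b) * g x)).
Proof.
apply: (integrable_mono int_dom).
  apply: measurable_funM => //; apply: measurable_funM.
    exact: measurable_funB.
  apply: continuous_measurable_fun => x.
  by apply: continuous_comp; [exact: cont_lin|exact: continuous_sin].
move=> x; apply: le_trans (g_dom x); rewrite mulrAC normrM.
by rewrite ler_piMr// ler_norml sin_geN1 sin_le1.
Qed.

(** Integration by parts with the primitive sin (t (x - m) + b) g x, whose derivative is the
    difference of the two integrands. *)
Let parts b t :
  t * F b t = s * \int[mu]_x ((x - m) * sin (t * (x - m) + b) * g x).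
Proof.
rewrite /F -!RintegralZl//; apply/eqP; rewrite -subr_eq0; apply/eqP.
rewrite -RintegralB//; first last.
- exact: integrable_EFinZ.
- exact: integrable_EFinZ.
apply: (@Rintegral_derive_eq0 (fun x => sin (t * (x - m) + b) * g x)).
- move=> x; have gd := g_derive x; apply: is_derive_eq.
  by rewrite /GRing.scale/=; ring.
- move=> x; apply: cvgB; (apply: cvgM; first exact: cvg_cst); apply: cvgM.
  + by apply: continuous_comp; [exact: cont_lin|exact: continuous_cos].
  + exact: cont_g.
  + apply: cvgM; first by apply: cvgB; [exact: cvg_id|exact: cvg_cst].
    by apply: continuous_comp; [exact: cont_lin|exact: continuous_sin].
  + exact: cont_g.
- by apply: integrable_EFinB; exact: integrable_EFinZ.
- apply/norm_cvg0P; apply: (@squeeze_cvgr _ _ _ _ (cst 0) (fun n => g (1 * n%:R))).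
  + apply: nearW => n; rewrite normr_ge0 mul1r normrM (ger0_norm (expR_ge0 _)).
    by rewrite ler_piMl ?expR_ge0// ler_norml sin_geN1 sin_le1.
  + exact: cvg_cst.
  + by apply: g_lim; rewrite normr1.
- apply/norm_cvg0P; apply: (@squeeze_cvgr _ _ _ _ (cst 0) (fun n => g (-1 * n%:R))).
  + apply: nearW => n; rewrite normr_ge0 mulN1r normrM (ger0_norm (expR_ge0 _)).
    by rewrite ler_piMl ?expR_ge0// ler_norml sin_geN1 sin_le1.
  + exact: cvg_cst.
  + by apply: g_lim; rewrite normrN1.
Qed.

(** Differentiating under the integral, dominated by [dom], and then applying [parts] yields the
    linear equation F' = - (t / s) F. *)
Let F_derive b (t : R) : is_derive t (1 : R) (F b) (- (t / s) * F b t).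
Proof.
pose f (t x : R) := cos (t * (x - m) + b) * g x.
have d1 (t' y : R) : is_derive t' (1 : R) (f ^~ y) (- ((y - m) * sin (t' * (y - m) + b) * g y)).
  apply: is_derive_eq; rewrite /GRing.scale/=; ring.
have tI : `]t - 1, t + 1[%classic t by rewrite /= in_itv/=; apply/andP; split; lra.
have p1 t' y : partial1of2 f t' y = - ((y - m) * sin (t' * (y - m) + b) * g y).
  by rewrite partial1of2E; exact: derive_val.
have dom0 y : 0 <= dom y.
  by rewrite mulr_ge0 ?expR_ge0// addr_ge0// divr_ge0// ltW.
have h := @derivable_under_integral R _ _ mu f setT measurableT t (t - 1) (t + 1) tI
  (fun x _ => int_cos b x) (fun x y _ _ => @ex_derive _ _ _ _ _ _ _ (d1 x y)) dom dom0 int_dom.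
have h' := @differentiation_under_integral R _ _ mu f setT measurableT t (t - 1) (t + 1) tI
  (fun x _ => int_cos b x) (fun x y _ _ => @ex_derive _ _ _ _ _ _ _ (d1 x y)) dom dom0 int_dom.
have bd : forall x y, `]t - 1, t + 1[%classic x -> setT y -> `|partial1of2 f x y| <= dom y.
  move=> x y _ _; rewrite p1 normrN; apply: le_trans (g_dom y); rewrite mulrAC normrM.
  by rewrite ler_piMr// ler_norml sin_geN1 sin_le1.
apply: DeriveDef; first exact: h.
rewrite -derive1E h'//; under eq_Rintegral do rewrite p1 -mulN1r.
rewrite RintegralZl// mulN1r mulNr; congr (- _).
by rewrite mulrAC parts mulrAC divff ?mul1r// gt_eqF.
Qed.

Lemma integrable_gaussian_cos b t : mu.-integrable setT (EFin \o
  (fun x => cos (t * (x - m) + b) * expR (- (s * (x - m) ^+ 2) / 2))).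
Proof. exact: int_cos. Qed.

Lemma gaussian_1d_cos (b t : R) :
  \int[mu]_x (cos (t * (x - m) + b) * expR (- (s * (x - m) ^+ 2) / 2)) =
  Num.sqrt (2 * pi / s) * expR (- (t ^+ 2 / s) / 2) * cos b.
Proof.
rewrite -/(F b t).
(* Integrating factor for the equation of [F_derive]; the constant is read off at frequency 0, where
   the cosine does not depend on x. *)
have H (u : R) : is_derive u (1 : R) (fun u => F b u * expR (u ^+ 2 / s / 2)) 0.
  have Fd := F_derive b u.
  apply: is_derive_eq; rewrite /GRing.scale/=; field; by rewrite gt_eqF.
have := is_derive_0_is_cst t 0 H.
rewrite expr0n/= !mul0r expR0 mulr1 => h.
have -> : F b t = F b 0 * expR (- (t ^+ 2 / s) / 2).
  by rewrite -h -mulrA -expRD mulNr subrr expR0 mulr1.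
rewrite [RHS]mulrAC; congr (_ * _); rewrite /F.
under eq_Rintegral do rewrite mul0r add0r.
rewrite RintegralZl//; last exact: integrable_gaussian_1d.
by rewrite mulrC {1}/Rintegral integral_gaussian_1d.
Qed.

End characteristic.

End gaussian_integral_1d.

(** * Positive definite quadratic forms and Schur complements *)

Section quadratic_form.
Context {R : realType}.

Definition bilin n (S : 'M[R]_n) (x y : 'rV[R]_n) : R := (x *m S *m y^T) ord0 ord0.

Definition posdef n (S : 'M[R]_n) : Prop :=
  S^T = S /\ forall x, x != 0 -> 0 < bilin S x x.

Definition dot n (x y : 'rV[R]_n) : R := \sum_i x ord0 i * y ord0 i.

Lemma dotE n (x y : 'rV[R]_n) : dot x y = (x *m y^T) ord0 ord0.
Proof. by rewrite mxE; apply: eq_bigr => i _; rewrite mxE. Qed.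

Lemma bilinE n (S : 'M[R]_n) x y : bilin S x y = dot (x *m S) y.
Proof. by rewrite dotE. Qed.

Lemma dotC n (x y : 'rV[R]_n) : dot x y = dot y x.
Proof. by apply: eq_bigr => i _; rewrite mulrC. Qed.

Section schur.
Variables (n : nat) (S : 'M[R]_(1 + n)) (symS : S^T = S).
Let s := S ord0 ord0.
Let r : 'rV[R]_n := ursubmx S.

(** The Schur complement of the top left entry: what is left of the form after completing the square
    in the first coordinate. *)
Definition schur : 'M[R]_n := drsubmx S - s^-1 *: (r^T *m r).

Lemma rV_consE a (x : 'rV[R]_n) : rV_cons (a, x) = row_mx a%:M x :> 'rV[R]_(1 + n).
Proof.
apply/rowP => i; rewrite mxE; case: (split_ordP i) => j ->.
  by rewrite row_mxEl ord1 mxE eqxx (_ : lshift n ord0 = ord0) ?unlift_none//; exact: val_inj.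
by rewrite row_mxEr (_ : rshift 1 j = lift ord0 j) ?liftK//; exact: val_inj.
Qed.

Let SE : S = block_mx s%:M r r^T (drsubmx S).
Proof.
rewrite -[LHS]submxK; congr block_mx.
  rewrite [LHS]mx11_scalar; congr (_%:M); rewrite !mxE; congr (S _ _); exact: val_inj.
by rewrite /r trmx_ursub symS.
Qed.

Lemma bilin_schur a c (x y : 'rV[R]_n) : s != 0 ->
  bilin S (rV_cons (a, x)) (rV_cons (c, y)) =
  s * (a + dot r x / s) * (c + dot r y / s) + bilin schur x y.
Proof.
move=> s0; rewrite /bilin !rV_consE {1}SE mul_row_block tr_row_mx mul_row_col.
rewrite tr_scalar_mx /schur mulmxBr mulmxBl -scalemxAr -scalemxAl.
have dot1 z : z *m r^T = (dot r z)%:M.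
  by rewrite [LHS]mx11_scalar dotC dotE.
have dot2 z : r *m z^T = (dot r z)%:M by rewrite [LHS]mx11_scalar dotE.
rewrite (mulmxA x) dot1 !mul_scalar_mx !mulmxDl -!scalemxAl dot2.
move: (x *m drsubmx S *m y^T) => W.
rewrite !mul_mx_scalar !mxE /= !mulr1n; field.
by rewrite s0.
Qed.

(** Row elimination: the unipotent matrix [L] makes S block upper triangular. *)
Lemma det_schur : s != 0 -> \det S = s * \det schur.
Proof.
move=> s0; pose L : 'M[R]_(1 + n) := block_mx 1%:M 0 (- s^-1 *: r^T) 1%:M.
have dL : \det L = 1 by rewrite det_lblock !det1 mulr1.
rewrite -[LHS]mul1r -dL -det_mulmx {1}SE mulmx_block.
rewrite !mul1mx !mul0mx !addr0 mul_mx_scalar scalerA mulrN mulfV// scaleN1r.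
rewrite addNr det_ublock det_scalar expr1; congr (_ * \det _).
by rewrite /schur addrC -scalemxAl scaleNr.
Qed.

End schur.

Lemma rV_cons_surj n (x : 'rV[R]_n.+1) :
  exists a y, x = rV_cons (a, y).
Proof.
exists (x ord0 ord0), (\row_j x ord0 (lift ord0 j)).
by apply/rowP => i; rewrite mxE; case: unliftP => [j ->|->] //=; rewrite mxE.
Qed.

Lemma rV_cons_eq0 n a (x : 'rV[R]_n) : (rV_cons (a, x) == 0) = (a == 0) && (x == 0).
Proof.
apply/eqP/andP => [h|[/eqP-> /eqP->]]; last first.
  by apply/rowP => i; rewrite !mxE; case: unliftP => //= j _; rewrite mxE.
split; apply/eqP.
  by have /rowP/(_ ord0) := h; rewrite !mxE unlift_none.
by apply/rowP => i; have /rowP/(_ (lift ord0 i)) := h; rewrite !mxE liftK.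
Qed.

Lemma dot0r n (x : 'rV[R]_n) : dot x 0 = 0.
Proof. by rewrite /dot big1// => i _; rewrite mxE mulr0. Qed.

(** The first basis vector gives the corner entry; for the complement, the first coordinate - r x /
    s makes the completed square vanish. *)
Lemma posdef_schur n (S : 'M[R]_(1 + n)) : posdef S ->
  0 < S ord0 ord0 /\ posdef (schur S).
Proof.
move=> [symS pS].
have s0 : 0 < S ord0 ord0.
  have := pS (rV_cons (1, 0)); rewrite rV_cons_eq0 oner_eq0 => /(_ isT).
  rewrite /bilin rV_consE; congr (0 < _).
  rewrite -[S in LHS]submxK mul_row_block tr_row_mx mul_row_col trmx0 mulmx0 addr0.
  rewrite mul0mx addr0 tr_scalar_mx mul1mx mulmx1 !mxE; congr (S _ _); exact: val_inj.
split=> //; split.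
  rewrite /schur linearB/= linearZ/= trmx_mul trmxK; congr (_ - _).
  by rewrite trmx_drsub symS.
move=> x x0; have := pS (rV_cons (- (dot (ursubmx S) x / S ord0 ord0), x)).
rewrite rV_cons_eq0 (negbTE x0) andbF => /(_ isT).
by rewrite bilin_schur ?gt_eqF// addNr mulr0 add0r.
Qed.

Lemma posdef_det_gt0 n (S : 'M[R]_n) : posdef S -> 0 < \det S.
Proof.
elim: n S => [|n IH] S pS; first by rewrite det_mx00.
have [s0 pS'] := posdef_schur pS.
rewrite (det_schur pS.1) ?gt_eqF// mulr_gt0//; exact: IH.
Qed.

Lemma bilin_sum n (S : 'M[R]_n) x y : bilin S x y = \sum_i \sum_j x ord0 i * S i j * y ord0 j.
Proof.
rewrite /bilin mxE exchange_big/=; apply: eq_bigr => j _.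
by rewrite mxE mulr_suml; apply: eq_bigr => i _; rewrite mxE.
Qed.

Lemma measurable_dot n (x : 'rV[R]_n) : measurable_fun setT (dot x).
Proof.
apply: measurable_sum => i; apply: measurable_funM => //.
exact: measurable_rV_coord.
Qed.

Lemma measurable_bilinl n (S : 'M[R]_n) v : measurable_fun setT (bilin S v).
Proof.
rewrite (_ : bilin S v = dot (v *m S)); first exact: measurable_dot.
by apply/funext => x; rewrite bilinE.
Qed.

Lemma measurable_bilin n (S : 'M[R]_n) : measurable_fun setT (fun x => bilin S x x).
Proof.
under eq_fun do rewrite bilin_sum.
apply: measurable_sum => i; apply: measurable_sum => j.
by apply: measurable_funM; [apply: measurable_funM => //|]; exact: measurable_rV_coord.
Qed.

End quadratic_form.

(** * Fourier transform of the Gaussian weight in dimension n *)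

Section gaussian_characteristic.
Context {R : realType}.

(** Tonelli's theorem for the recursive definition of the measure; the first coordinate is
    integrated innermost, where the one-dimensional formulas apply. *)
Lemma integral_lebesgue_rVS n (f : 'rV[R]_n.+1 -> \bar R) :
  measurable_fun setT f -> (forall x, 0 <= f x)%E ->
  (\int[lebesgue_rV n.+1]_x f x =
   \int[lebesgue_rV n]_x \int[lebesgue_measure]_a f (rV_cons (a, x)))%E.
Proof.
move=> mf f0.
transitivity (\int[pushforward (@lebesgue_measure R \x lebesgue_rV n)%E (@rV_cons R n)]_x f x)%E => //.
rewrite ge0_integral_pushforward//; last exact: measurable_rV_cons.
rewrite preimage_setT fubini_tonelli2//=.
by apply: measurableT_comp => //; exact: measurable_rV_cons.
Qed.

(** The frequency is written as [v S], so that one completion of the square, [bilin_schur], splits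
    both the phase and the exponent. *)
Let wave n (S : 'M[R]_n) (v : 'rV[R]_n) (b c : R) (x : 'rV[R]_n) : R :=
  (1 + c * cos (bilin S v x + b)) * expR (- bilin S x x / 2).

Let wave_ge0 n S v b c x : `|c| <= 1 -> 0 <= @wave n S v b c x.
Proof.
move=> c1; rewrite mulr_ge0 ?expR_ge0//.
have : `|c * cos (bilin S v x + b)| <= 1.
  by rewrite normrM mulr_ile1// ler_norml cos_geN1 cos_le1.
rewrite ler_norml => /andP[]; lra.
Qed.

Let measurable_wave n S v b c : measurable_fun setT (@wave n S v b c).
Proof.
apply: measurable_funM.
  apply: measurable_funD => //; apply: measurable_funM => //.
  apply: (proj1 (bdm_cos _)).
  by apply: measurable_funD => //; exact: measurable_bilinl.
apply: measurableT_comp => //; apply: measurable_funM => //.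
by apply: measurableT_comp => //; exact: measurable_bilin.
Qed.

(* The weight 1 + c cos keeps the integrand nonnegative, so that Tonelli's theorem
   gives the total mass and the characteristic function in a single induction. *)
Let integral_wave n (S : 'M[R]_n) (v : 'rV[R]_n) (b c : R) : posdef S -> `|c| <= 1 ->
  (\int[lebesgue_rV n]_x (wave S v b c x)%:E =
   (Num.sqrt ((2 * pi) ^+ n / \det S) * (1 + c * expR (- bilin S v v / 2) * cos b))%:E)%E.
Proof.
elim: n S v b c => [|n IH] S v b c pS c1.
  rewrite integral_dirac//=; last by apply/measurable_EFinP; exact: measurable_wave.
  rewrite ?diracT ?mul1e /wave det_mx00 expr0 divr1 sqrtr1 mul1r.
  have q0 u w : bilin S u w = 0 by rewrite /bilin flatmx0 mxE big_ord0.
  by rewrite !q0 oppr0 mul0r expR0 !mulr1 add0r.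
have [s0 pS'] := posdef_schur pS.
set s := S ord0 ord0 in s0; set r := @ursubmx _ 1 n 1 n S.
rewrite integral_lebesgue_rVS; first last.
- by move=> x; rewrite lee_fin wave_ge0.
- by apply/measurable_EFinP; exact: measurable_wave.
have [v1 [v' vE]] := rV_cons_surj v.
pose t := s * (v1 + dot r v' / s).
have bvx a x : bilin S v (rV_cons (a, x)) = t * (a - - (dot r x / s)) + bilin (schur S) v' x.
  by rewrite vE bilin_schur ?gt_eqF//; [rewrite opprK|exact: pS.1].
have bxx a x : bilin S (rV_cons (a, x)) (rV_cons (a, x)) =
    s * (a - - (dot r x / s)) ^+ 2 + bilin (schur S) x x.
  by rewrite bilin_schur ?gt_eqF//; [rewrite opprK expr2 mulrA|exact: pS.1].
pose k := Num.sqrt (2 * pi / s); pose e := expR (- (t ^+ 2 / s) / 2).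
(* Integrating out the first coordinate gives the same kind of weight for the Schur complement, with
   amplitude [c * e] in place of [c]; since 0 <= e <= 1, the induction hypothesis covers it. *)
transitivity (\int[lebesgue_rV n]_x (k * wave (schur S) v' b (c * e) x)%:E)%E.
  apply: eq_integral => x _.
  have kE : (\int[lebesgue_measure]_a (wave S v b c (rV_cons (a, x)))%:E =
    (\int[lebesgue_measure]_a wave S v b c (rV_cons (a, x)))%:E)%E.
    rewrite /Rintegral fineK//; apply: integrable_fin_num => //.
    suff : lebesgue_measure.-integrable setT
      (EFin \o (fun a : R => wave S v b c (rV_cons (a, x)))) by [].
    apply: (@integrable_mono _ _ R lebesgue_measure _
      (fun a => (2 * expR (- bilin (schur S) x x / 2)) *
        expR (- (s * (a - - (dot r x / s)) ^+ 2) / 2))).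
    - by apply: integrable_EFinZ; exact: integrable_gaussian_1d.
    - apply: (measurableT_comp (measurable_wave S v b c)).
      apply: (measurableT_comp (@measurable_rV_cons R n)); exact: measurable_fun_pair.
    - move=> a; rewrite ger0_norm ?wave_ge0// /wave bxx.
      move: (s * _ ^+ 2) (bilin (schur S) x x) => A D.
      rewrite (_ : - (A + D) / 2 = - D / 2 + - A / 2); last by field.
      rewrite expRD -mulrA ler_wpM2r ?mulr_ge0 ?expR_ge0//.
      have : `|c * cos (bilin S v (rV_cons (a, x)) + b)| <= 1.
        by rewrite normrM mulr_ile1// ler_norml cos_geN1 cos_le1.
      by rewrite ler_norml => /andP[]; lra.
  rewrite kE; congr (_%:E).
  pose m := - (dot r x / s).
  have wE a : wave S v b c (rV_cons (a, x)) = expR (- bilin (schur S) x x / 2) *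
      (expR (- (s * (a - m) ^+ 2) / 2) +
       c * (cos (t * (a - m) + (bilin (schur S) v' x + b)) * expR (- (s * (a - m) ^+ 2) / 2))).
    rewrite /wave bvx bxx addrA -/m.
    rewrite (_ : - (_ + bilin (schur S) x x) / 2 =
      - (s * (a - m) ^+ 2) / 2 + - bilin (schur S) x x / 2); last by field.
    rewrite expRD; ring.
  under eq_Rintegral do rewrite wE.
  have i1 := integrable_gaussian_1d m s0.
  have i2 : lebesgue_measure.-integrable setT (EFin \o (fun a =>
      cos (t * (a - m) + (bilin (schur S) v' x + b)) * expR (- (s * (a - m) ^+ 2) / 2))).
    exact: integrable_gaussian_cos.
  rewrite RintegralZl//; last first.
    by apply: integrable_EFinD => //; exact: integrable_EFinZ.
  rewrite RintegralD//; last exact: integrable_EFinZ.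
  rewrite RintegralZl// gaussian_1d_cos// {1}/Rintegral integral_gaussian_1d//= /wave -/k -/e.
  by ring.
have e01 : 0 <= e <= 1.
  by rewrite expR_ge0 -expR0 ler_expR mulNr oppr_le0 !divr_ge0// ?sqr_ge0// ltW.
under eq_integral do rewrite EFinM.
have ce1 : `|c * e| <= 1.
  by rewrite normrM mulr_ile1// ger0_norm; case/andP: e01.
rewrite ge0_integralZl//; first last.
- by rewrite lee_fin sqrtr_ge0.
- by move=> x _; rewrite lee_fin wave_ge0.
- by apply/measurable_EFinP; exact: measurable_wave.
rewrite IH// -EFinM; congr _%:E.
have dS := posdef_det_gt0 pS'.
rewrite mulrA -sqrtrM ?divr_ge0 ?mulr_ge0 ?pi_ge0 ?(ltW s0)//.
congr (Num.sqrt _ * (1 + _)).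
  rewrite (det_schur pS.1) ?gt_eqF// exprS -/s.
  move: ((2 * pi) ^+ n) (\det (schur S)) dS => X D D0; field.
  by rewrite !gt_eqF.
(* The exponents t^2 / s and [bilin (schur S) v' v'] add up to [bilin S v v], again by
   [bilin_schur]. *)
congr (_ * _); rewrite -mulrA -expRD; congr (_ * expR _).
rewrite [in RHS]vE bilin_schur ?gt_eqF//; last exact: pS.1.
by rewrite -/s -/r /t; field; rewrite gt_eqF.
Qed.

Lemma gaussian_weight_mass n (S : 'M[R]_n) : posdef S ->
  (\int[lebesgue_rV n]_x (expR (- bilin S x x / 2))%:E =
   (Num.sqrt ((2 * pi) ^+ n / \det S))%:E)%E.
Proof.
move=> pS; have := @integral_wave n S 0 0 0 pS; rewrite normr0 => /(_ ler01).
rewrite !mul0r addr0 mulr1 => <-; apply: eq_integral => x _.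
by rewrite /wave mul0r addr0 mul1r.
Qed.

Lemma integrable_gaussian_weight n (S : 'M[R]_n) : posdef S ->
  (lebesgue_rV n).-integrable setT (EFin \o (fun x => expR (- bilin S x x / 2))).
Proof.
move=> pS; apply/integrableP; split.
  apply/measurable_EFinP/measurableT_comp => //; apply: measurable_funM => //.
  by apply: measurableT_comp => //; exact: measurable_bilin.
under eq_integral do rewrite /= ger0_norm ?expR_ge0//.
by rewrite gaussian_weight_mass// ltry.
Qed.

(** The case c = 1 of [integral_wave], from which the total mass is subtracted. *)
Lemma gaussian_weight_cos n (S : 'M[R]_n) v b : posdef S ->
  \int[lebesgue_rV n]_x (cos (bilin S v x + b) * expR (- bilin S x x / 2)) =
  Num.sqrt ((2 * pi) ^+ n / \det S) * (expR (- bilin S v v / 2) * cos b).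
Proof.
move=> pS; have i1 := integrable_gaussian_weight pS.
have m0 := gaussian_weight_mass pS.
have := @integral_wave n S v b 1 pS; rewrite normr1 => /(_ (lexx _)) h.
have i2 : (lebesgue_rV n).-integrable setT
    (EFin \o (fun x => cos (bilin S v x + b) * expR (- bilin S x x / 2))).
  apply: (integrable_mono i1) => [|x].
    apply: measurable_funM; last first.
      apply/measurableT_comp => //; apply: measurable_funM => //.
      by apply: measurableT_comp => //; exact: measurable_bilin.
    apply: (proj1 (bdm_cos _)).
    by apply: measurable_funD => //; exact: measurable_bilinl.
  by rewrite normrM (ger0_norm (expR_ge0 _)) ler_piMl ?expR_ge0// ler_norml cos_geN1 cos_le1.
have : \int[lebesgue_rV n]_x (expR (- bilin S x x / 2) +
    cos (bilin S v x + b) * expR (- bilin S x x / 2)) =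
  Num.sqrt ((2 * pi) ^+ n / \det S) * (1 + expR (- bilin S v v / 2) * cos b).
  rewrite -[in RHS](mul1r (expR _)) /Rintegral -[RHS]/(fine _%:E) -h; congr fine.
  by apply: eq_integral => x _; rewrite /wave mul1r mulrDl mul1r.
rewrite RintegralD// {1}/Rintegral m0/=; lra.
Qed.

End gaussian_characteristic.

(** * Integration against a measure with a density *)

Section density.
Local Open Scope ereal_scope.
Context {d} {T : measurableType d} {R : realType}.
Variables (mu nu : {measure set T -> \bar R}) (h : T -> R).
Hypotheses (mh : measurable_fun setT h) (h0 : forall x, (0 <= h x)%R).
Hypothesis nuE : forall A, measurable A -> nu A = \int[mu]_(x in A) (h x)%:E.

Import HBNNSimple.

Let meh : measurable_fun setT (EFin \o h). Proof. exact/measurable_EFinP. Qed.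

(** Monotone approximation by simple functions reduces this to indicators, which is [nuE]. A real
    density between arbitrary measures covers the Gaussian law, the uniform law and the law of the
    past weighted by a conditional probability. *)
Lemma ge0_integral_density (f : T -> \bar R) : (forall x, 0 <= f x) ->
  measurable_fun setT f -> \int[nu]_x f x = \int[mu]_x (f x * (h x)%:E).
Proof.
move=> f0 mf; pose g := nnsfun_approx measurableT mf.
have fE x : f x = lim ((EFin \o g n) x @[n --> \oo]).
  by apply/esym/cvg_lim => //; exact: cvg_nnsfun_approx.
transitivity (lim (\int[nu]_x (EFin \o g n) x @[n --> \oo])).
  under eq_integral => x _ do rewrite fE.
  apply: monotone_convergence => //.
  - by move=> n; exact/measurable_EFinP.
  - by move=> n x _; rewrite lee_fin.
  - by move=> x _ a b ab; rewrite lee_fin; exact/lefP/nd_nnsfun_approx.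
transitivity (lim (\int[mu]_x ((EFin \o g n) x * (h x)%:E) @[n --> \oo])); last first.
  have fg x : f x * (h x)%:E = lim (((EFin \o g n) x * (h x)%:E) @[n --> \oo]).
    by apply/esym/cvg_lim => //; apply: cvgeZr => //; exact: cvg_nnsfun_approx.
  under [RHS]eq_integral => x _ do rewrite fg.
  apply/esym/monotone_convergence => //.
  - by move=> n; apply: emeasurable_funM => //; exact/measurable_EFinP.
  - by move=> n x _; rewrite mule_ge0 ?lee_fin.
  - by move=> x _ a b ab; rewrite lee_wpmul2r ?lee_fin//; exact/lefP/nd_nnsfun_approx.
congr (limn _); apply/funext => n.
have indich r : measurable_fun setT (fun x => (r * \1_(g n @^-1` [set r]) x)%:E).
  by apply: (measurable_comp measurableT) => //; exact: measurable_funM.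
transitivity (\int[nu]_x
   (\sum_(y \in range (g n)) (y * \1_(g n @^-1` [set y]) x)%:E)).
  by apply: eq_integral => t tE; rewrite /= fimfunE -fsumEFin.
rewrite ge0_integral_fsum//; last by move=> m y Ey; exact: nnfun_muleindic_ge0.
transitivity (\int[mu]_x (\sum_(y \in range (g n))
    (y * \1_(g n @^-1` [set y]) x)%:E * (h x)%:E)); last first.
  apply: eq_integral => x _.
  rewrite -ge0_mule_fsuml => [|y]; last exact: nnfun_muleindic_ge0.
  by rewrite fsumEFin // -(fimfunE _ x).
rewrite ge0_integral_fsum//; last 2 first.
  - by move=> y; apply: emeasurable_funM.
  - by move=> m y Ey; apply: mule_ge0; [exact: nnfun_muleindic_ge0|rewrite lee_fin].
apply: eq_fsbigr => r rhn.
under [LHS]eq_integral do rewrite EFinM.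
rewrite integralZl_indic_nnsfun => //.
under [RHS]eq_integral do rewrite EFinM -muleA.
have [r0|r0] := ltP r 0%R.
  rewrite preimage_nnfun0// integral_indic// set0I measure0 mule0.
  by under eq_integral do rewrite indicE in_set0 mul0e mule0; rewrite integral0_eq.
rewrite ge0_integralZl//; first last.
- by move=> x _; rewrite mule_ge0 ?lee_fin.
- by apply: emeasurable_funM => //; exact/measurable_EFinP.
congr (_ * _); rewrite integral_indic// setIT nuE//.
rewrite integral_mkcond; apply: eq_integral => x _.
by rewrite patchE indicE; case: ifPn => _; rewrite ?mul1e ?mul0e.
Qed.

Lemma integrable_density (f : T -> R) : measurable_fun setT f ->
  nu.-integrable setT (EFin \o f) -> mu.-integrable setT (EFin \o (fun x => f x * h x)%R).
Proof.
move=> mf /integrableP[_ fi]; apply/integrableP; split.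
  exact/measurable_EFinP/measurable_funM.
move: fi; rewrite ge0_integral_density//; last first.
  by apply: measurableT_comp => //; exact/measurable_EFinP.
by under eq_integral => x _ do rewrite -[X in _ * X]gee0_abs ?lee_fin// -abseM -EFinM.
Qed.

Lemma Rintegral_density (f : T -> R) : measurable_fun setT f ->
  nu.-integrable setT (EFin \o f) -> (\int[nu]_x f x = \int[mu]_x (f x * h x))%R.
Proof.
move=> mf fi; have fhi := integrable_density mf fi.
rewrite /Rintegral integralE [in RHS]integralE; congr (fine (_ - _)).
  rewrite ge0_integral_density//; last exact/measurable_funepos/measurable_EFinP.
  apply: eq_integral => x _.
  by rewrite !funeposE -!EFin_max -EFinM maxr_pMl// mul0r.
rewrite ge0_integral_density//; last exact/measurable_funeneg/measurable_EFinP.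
apply: eq_integral => x _.
by rewrite !funenegE -!EFinN -!EFin_max -EFinM maxr_pMl// mul0r mulNr.
Qed.

End density.

(** * The Gaussian law with a given inverse covariance *)

Section gaussian_law.
Context {R : realType} {n : nat}.
(** [S] is the inverse of the covariance: this is how the information matrix enters the limit
    law. *)
Variable S : 'M[R]_n.
Hypothesis pS : posdef S.

Lemma posdef_unitmx : S \in unitmx.
Proof. by rewrite unitmxE unitfE gt_eqF// posdef_det_gt0. Qed.

Lemma gaussian_pdfE (x : 'rV[R]_n) : gaussian_pdf (invmx S) x =
  (Num.sqrt ((2 * pi) ^+ n / \det S))^-1 * expR (- bilin S x x / 2).
Proof.
by rewrite /gaussian_pdf invmxK det_inv mulrC /bilin.
Qed.

Let K0 : 0 < Num.sqrt ((2 * pi) ^+ n / \det S).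
Proof.
by rewrite sqrtr_gt0 divr_gt0 ?posdef_det_gt0// exprn_gt0// mulr_gt0// pi_gt0.
Qed.

Lemma gaussianT : gaussian (invmx S) setT = 1%E.
Proof.
rewrite /gaussian; under eq_integral do rewrite gaussian_pdfE EFinM.
rewrite ge0_integralZl//; last exact: measurable_int (integrable_gaussian_weight pS).
by rewrite gaussian_weight_mass// -EFinM mulVf// gt_eqF.
Qed.

Lemma gaussian_cos u b : \int[gaussian (invmx S)]_x cos (dot u x + b) =
  expR (- bilin (invmx S) u u / 2) * cos b.
Proof.
have bc : bdm (fun x : 'rV[R]_n => cos (dot u x + b)).
  by apply: bdm_cos; apply: measurable_funD => //; exact: measurable_dot.
rewrite (@Rintegral_density _ _ _ (lebesgue_rV n) _ (gaussian_pdf (invmx S)))//; first last.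
- apply: (@bdm_integrable _ _ _ (gaussian (invmx S))) => //; exact: gaussianT.
- by case: bc.
- exact: gaussian_pdf_ge0.
- exact: measurable_gaussian_pdf.
(* The frequency u is [v S], the form that [gaussian_weight_cos] expects. *)
pose v := u *m invmx S.
have uE x : dot u x = bilin S v x.
  by rewrite bilinE /v mulmxKV// posdef_unitmx.
under eq_Rintegral do rewrite gaussian_pdfE mulrCA uE.
rewrite RintegralZl//.
  rewrite gaussian_weight_cos// mulKf ?gt_eqF// /v /bilin.
  rewrite mulmxKV ?posdef_unitmx// trmx_mul trmx_inv pS.1 mulmxA.
  by [].
apply: (integrable_mono (integrable_gaussian_weight pS)) => [|x].
  apply: measurable_funM; last first.
    by have /measurable_int/measurable_EFinP := integrable_gaussian_weight pS.
  by apply: (proj1 (bdm_cos _)); apply: measurable_funD => //; exact: measurable_bilinl.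
by rewrite normrM (ger0_norm (expR_ge0 _)) ler_piMl ?expR_ge0// ler_norml cos_geN1 cos_le1.
Qed.

End gaussian_law.

(** * Convergence in distribution *)

Section trigonometric_polynomials.
Context {R : realType} {n : nat}.
Implicit Types (f g : 'rV[R]_n -> R) (u x y z : 'rV[R]_n).

(** Real trigonometric polynomials with arbitrary real frequencies, as the span of phase-shifted
    cosines; the phases account for the sines. *)
Inductive trig : ('rV[R]_n -> R) -> Prop :=
| trig_cos u b c : trig (fun x => c * cos (dot u x + b))
| trigD f g : trig f -> trig g -> trig (fun x => f x + g x).

Lemma dotDl u u' x : dot (u + u') x = dot u x + dot u' x.
Proof. by rewrite /dot -big_split; apply: eq_bigr => i _; rewrite mxE mulrDl. Qed.

Lemma dotNl u x : dot (- u) x = - dot u x.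
Proof. by rewrite /dot -sumrN; apply: eq_bigr => i _; rewrite mxE mulNr. Qed.

Lemma dot0l x : dot 0 x = 0.
Proof. by rewrite dotC dot0r. Qed.

Lemma dot_delta (a : R) (i : 'I_n) x : dot (a *: delta_mx ord0 i) x = a * x ord0 i.
Proof.
rewrite /dot (bigD1 i)//= big1 ?addr0 => [|j ji]; rewrite !mxE ?eqxx ?mulr1//.
by rewrite (negbTE ji) andbF mulr0 mul0r.
Qed.

Lemma eq_trig f g : f =1 g -> trig f -> trig g.
Proof. by move=> /funext ->. Qed.

Lemma trig_cst (a : R) : trig (fun=> a).
Proof.
by apply: (eq_trig _ (trig_cos 0 0 a)) => x; rewrite dot0l addr0 cos0 mulr1.
Qed.

Lemma trigZ (a : R) f : trig f -> trig (fun x => a * f x).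
Proof.
elim=> [u b c|{}f g _ tf _ tg].
  by apply: (eq_trig _ (trig_cos u b (a * c))) => x; rewrite mulrA.
by apply: (eq_trig _ (trigD tf tg)) => x; rewrite mulrDr.
Qed.

(** Product-to-sum formula. It lets [bern], a polynomial in its weights, be evaluated at
    trigonometric coordinates. *)
Lemma trigM f g : trig f -> trig g -> trig (fun x => f x * g x).
Proof.
move=> tf tg; elim: tf => [u b c|{}f f' _ tf _ tf']; last first.
  by apply: (eq_trig _ (trigD tf tf')) => x; rewrite mulrDl.
elim: tg => [u' b' c'|{}g g' _ tg _ tg']; last first.
  by apply: (eq_trig _ (trigD tg tg')) => x; rewrite mulrDr.
apply: (eq_trig _ (trigD (trig_cos (u + u') (b + b') (c * c' / 2))
                         (trig_cos (u - u') (b - b') (c * c' / 2)))) => x.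
rewrite !dotDl dotNl.
rewrite (_ : _ + _ + (b + b') = (dot u x + b) + (dot u' x + b')); last by ring.
rewrite (_ : _ + _ + (b - b') = (dot u x + b) - (dot u' x + b')); last by ring.
by rewrite cosD cosB; field.
Qed.

Lemma bdm_trig f : trig f -> bdm f.
Proof.
elim=> [u b c|{}f g _ bf _ bg]; last exact: bdmD.
apply: bdmM (bdm_cst _) (bdm_cos _).
by apply: measurable_funD => //; exact: measurable_dot.
Qed.

(* The position z of a random walk started at z that moves by h e_j with
   probability y_j, for j running through s: bern s h phi y z is the expectation of
   phi at the final position. Taking s with every index repeated N times and h = 1/N
   gives the multivariate Bernstein polynomial. *)
Fixpoint bern (s : seq 'I_n) (h : R) (phi : 'rV[R]_n -> R) (y z : 'rV[R]_n) : R :=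
  if s is j :: s' then
    (1 - y ord0 j) * bern s' h phi y z + y ord0 j * bern s' h phi y (z + h *: delta_mx ord0 j)
  else phi z.

Let unit_cube (y : 'rV[R]_n) := forall j : 'I_n, 0 <= y ord0 j <= 1.

(** [bern] averages with weights that are nonnegative on the unit cube and sum to one, so the
    distance to a constant is at most the average distance. *)
Lemma bern_dist s h phi psi c y z : unit_cube y ->
  (forall w, `|phi w - c| <= psi w) -> `|bern s h phi y z - c| <= bern s h psi y z.
Proof.
move=> y01 pp; elim: s z => [|j s IH] z //=.
have /andP[y0 y1] := y01 j.
rewrite (_ : _ - c = (1 - y ord0 j) * (bern s h phi y z - c) +
  y ord0 j * (bern s h phi y (z + h *: delta_mx ord0 j) - c)); last by ring.
rewrite (le_trans (ler_normD _ _))// lerD// normrM.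
  by rewrite ger0_norm ?subr_ge0// ler_wpM2l ?subr_ge0.
by rewrite ger0_norm// ler_wpM2l.
Qed.

Lemma bern_affine s h (a K : R) (phi : 'I_n -> 'rV[R]_n -> R) y z :
  bern s h (fun w => a + K * \sum_j phi j w) y z = a + K * \sum_j bern s h (phi j) y z.
Proof.
elim: s z => [|j s IH] z //=; rewrite !IH big_split/= -!mulr_sumr; ring.
Qed.

(** Variance plus squared bias of the i-th coordinate of the walk, which has one independent chance
    to move for each occurrence of i in [s]. *)
Lemma bern_sq s h (y z : 'rV[R]_n) (i : 'I_n) :
  bern s h (fun w => (w ord0 i - y ord0 i) ^+ 2) y z =
  h ^+ 2 * (count_mem i s)%:R * (y ord0 i * (1 - y ord0 i)) +
  (z ord0 i + h * (count_mem i s)%:R * y ord0 i - y ord0 i) ^+ 2.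
Proof.
elim: s z => [|j s IH] z /=; first by rewrite !mulr0 !mul0r addr0 add0r.
rewrite !IH !mxE eqxx /= natrD [i == j]eq_sym.
by have [->|ji] := eqVneq j i; rewrite ?mulr1n ?mulr0n; ring.
Qed.

Lemma bern_trig s h phi (Y : 'rV[R]_n -> 'rV[R]_n) z :
  (forall j, trig (fun x => Y x ord0 j)) -> trig (fun x => bern s h phi (Y x) z).
Proof.
move=> tY; elim: s z => [|j s IH] z /=; first exact: trig_cst.
apply: trigD; apply: trigM => //.
by apply: (eq_trig _ (trigD (trig_cst 1) (trigZ (-1) (tY j)))) => x; rewrite mulN1r.
Qed.

(** Heine's theorem in a one-sided form: only [x] must lie in the cube. This matters when [y] is a
    value about which nothing is known but its closeness to [x]. *)
Lemma unif_continuous_cube f (M e : R) : continuous f -> 0 < e ->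
  exists2 del : R, 0 < del & forall x y, (forall i, `|x ord0 i| <= M) ->
    (forall i, `|x ord0 i - y ord0 i| < del) -> `|f x - f y| < e.
Proof.
move=> cf e0.
have cK : compact [set x : 'rV[R]_n | forall i, `[- M, M]%classic (x ord0 i)].
  by apply: (@rV_compact _ _ (fun=> `[- M, M]%classic)) => i; exact: segment_compact.
have /compact_near_coveringP/(_ R (at_right 0)
  (fun del x => forall y, ball x del y -> `|f x - f y| < e) _) hK := cK.
have : \forall del \near (0 : R)^'+, [set x : 'rV[R]_n | forall i, `[- M, M]%classic (x ord0 i)] `<=`
   (fun x => forall y, ball x del y -> `|f x - f y| < e).
  apply: hK => x _; have e20 : 0 < e / 2 by rewrite divr_gt0.
  have /cvgrPdist_lt/(_ _ e20) := cf x.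
  move=> /nbhs_ballP[r /= r0 hr].
  have r20 : 0 < r / 2 by rewrite divr_gt0.
  exists (ball x (r / 2), [set d | 0 < d < r / 2]) => /=.
    split; first exact: nbhsx_ballx.
    near=> d; apply/andP; split; near: d; [exact: nbhs_right_gt|exact: nbhs_right_lt].
  move=> [x' d] /= [xx' /andP[d0 dr]] y x'y.
  have h1 : `|f x - f x'| < e / 2.
    by apply: hr; apply: le_ball xx'; rewrite ler_pdivrMr// ler_pMr// ler1n.
  have h2 : `|f x - f y| < e / 2.
    apply: hr; rewrite [r]splitr; apply: ball_triangle xx' _.
    by apply: le_ball x'y; exact: ltW.
  rewrite [e]splitr (_ : f x' - f y = - (f x - f x') + (f x - f y)); last by ring.
  by rewrite (le_lt_trans (ler_normD _ _))// normrN ltrD.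
move=> h; have [d [dP d0]] := filter_ex (filterI h (nbhs_right_gt (0 : R))).
exists d => // x y xM xy; apply: dP => /=.
  by move=> i; rewrite in_itv/= -ler_norml.
by split=> // i j; rewrite [i]ord1; exact: xy.
Unshelve. all: end_near. Qed.

(* The coordinates are rescaled to (1 + sin (x_i / M)) / 2, which is bi-Lipschitz on
   [- M, M] because cos >= cos 1 > 0 on [-1, 1]. *)
Lemma trig_approx f (M B e : R) : continuous f -> 0 < M -> 0 < e ->
  (forall x, `|f x| <= B) ->
  exists2 T, trig T & (forall x, `|T x| <= B) /\
    forall x, (forall i, `|x ord0 i| <= M) -> `|f x - T x| <= e.
Proof.
move=> cf M0 e0 fB; pose k : R := cos 1.
have k0 : 0 < k := cos1_gt0 R.
have sin_lip (a b : R) : `|a| <= 1 -> `|b| <= 1 -> k * `|a - b| <= `|sin a - sin b|.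
  wlog ab : a b / a <= b => [hw|] a1 b1.
    have [/hw h|/ltW/hw h] := leP a b; first exact: h.
    by rewrite distrC [X in _ <= X]distrC; exact: h.
  have [c cab sE] : exists2 c, c \in `[a, b] & sin b - sin a = cos c * (b - a).
    apply: (@MVT_segment R sin cos a b ab).
    exact/continuous_subspaceT/continuous_sin.
  move: cab; rewrite in_itv/= => /andP[ac cb].
  rewrite distrC [X in _ <= X]distrC sE normrM ler_wpM2r//.
  have c1 : `|c| <= 1.
    by move: a1 b1; rewrite !ler_norml => /andP[? ?] /andP[? ?]; apply/andP; split; lra.
  rewrite (le_trans _ (ler_norm _))// (_ : cos c = cos `|c|); last first.
    by case: (ger0P c) => _ //; rewrite cosN.
  have p2 := @pihalf_ge1 R; have p0 := @pi_gt0 R.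
  by rewrite leNgt ltr_cos -?leNgt// in_itv/= ?normr_ge0 ?ler01/=; lra.
have sin_mono (a b : R) : `|a| <= 1 -> `|b| <= 1 -> a <= b -> sin a <= sin b.
  rewrite !ler_norml => /andP[a1 a2] /andP[b1 b2] ab; have p1 := @pihalf_ge1 R.
  rewrite leNgt ltr_sin -?leNgt// in_itv/=; lra.
have n1 : `|1 : R| <= 1 by rewrite normr1.
have nN1 : `|- 1 : R| <= 1 by rewrite normrN1.
have s1 : sin (- 1) <= sin 1 :> R by apply: sin_mono => //; lra.
(* The values 2 z - 1 of the walk may leave [sin (-1), sin 1]; projecting onto that interval does
   not increase the distance to its points. *)
pose clamp (v : R) := Num.max (sin (- 1)) (Num.min (sin 1) v).
have clamp_lip a v : `|a| <= 1 -> `|clamp v - sin a| <= `|v - sin a|.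
  move=> a1; have := a1; rewrite ler_norml => /andP[aN1 a1'].
  have lo := sin_mono _ _ nN1 a1 aN1; have hi := sin_mono _ _ a1 n1 a1'.
  rewrite /clamp; have [v1|v1] := leP (sin 1) v.
    by rewrite max_r// !ger0_norm ?subr_ge0//; lra.
  have [v2|v2] := leP (sin (- 1)) v; first by [].
  by rewrite !ler0_norm ?subr_le0//; lra.
(* An inverse of the sine with values in [-1, 1], made total by the projection. *)
have [iv ivP] : exists iv : R -> R, forall v, `|iv v| <= 1 /\ sin (iv v) = clamp v.
  suff /choice[iv ivP] : forall v : R, exists a, `|a| <= 1 /\ sin a = clamp v by exists iv.
  move=> v; have N11 : (- 1 <= 1 :> R) by lra.
  have [||a] := @IVT R sin (- 1) 1 (clamp v) N11.
  - exact/continuous_subspaceT/continuous_sin.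
  - rewrite min_l// max_r// /clamp le_max lexx/= ge_max s1/= ge_min lexx//.
  - by rewrite in_itv/= -ler_norml => ? ?; exists a.
(* On the cube [Xr] undoes the change of coordinates [Y]; [XYlip] quantifies this. *)
pose Xr (z : 'rV[R]_n) : 'rV[R]_n := \row_j (M * iv (2 * z ord0 j - 1)).
pose Y (x : 'rV[R]_n) : 'rV[R]_n := \row_j ((1 + sin (x ord0 j / M)) / 2).
have Y01 x : unit_cube (Y x).
  move=> j; rewrite mxE; have := sin_geN1 (x ord0 j / M); have := sin_le1 (x ord0 j / M).
  by move=> *; apply/andP; split; lra.
have XYlip (x z : 'rV[R]_n) j : (forall i, `|x ord0 i| <= M) ->
    `|x ord0 j - Xr z ord0 j| <= 2 * M / k * `|z ord0 j - Y x ord0 j|.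
  move=> xM; have [i1 i2] := ivP (2 * z ord0 j - 1).
  have a1 : `|x ord0 j / M| <= 1.
    by rewrite normrM [X in _ * X]ger0_norm ?invr_ge0 ?(ltW M0)// ler_pdivrMr// mul1r.
  have := sin_lip _ _ i1 a1; rewrite i2 => h1.
  have h2 := le_trans h1 (clamp_lip _ (2 * z ord0 j - 1) a1).
  rewrite !mxE; set w := iv _ in h2 *.
  rewrite (_ : x ord0 j - M * w = - M * (w - x ord0 j / M)); last by field; rewrite gt_eqF.
  rewrite normrM normrN (gtr0_norm M0).
  rewrite (_ : z ord0 j - _ = (2 * z ord0 j - 1 - sin (x ord0 j / M)) / 2); last by field.
  rewrite normrM [X in _ * (_ * X)]ger0_norm//.
  rewrite (_ : _ * _ / k * _ = M / k * `|2 * z ord0 j - 1 - sin (x ord0 j / M)|); last by field; rewrite gt_eqF.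
  by rewrite -[X in _ <= X]mulrA ler_wpM2l ?(ltW M0)// [X in _ <= X]mulrC ler_pdivlMr// mulrC.
have B0 : 0 <= B by rewrite (le_trans _ (fB 0)).
have e20 : 0 < e / 2 by rewrite divr_gt0.
have [del del0 fdel] := unif_continuous_cube M cf e20.
(* Chebyshev's constant: where some coordinate of [Xr z] is at distance [del] or more from that of
   x, the quadratic term alone reaches the trivial bound 2 B. *)
pose K := 2 * B / del ^+ 2 * (2 * M / k) ^+ 2.
have K0 : 0 <= K by rewrite mulr_ge0 ?sqr_ge0// divr_ge0 ?sqr_ge0// mulr_ge0.
have modulus (x z : 'rV[R]_n) : (forall i, `|x ord0 i| <= M) ->
    `|f (Xr z) - f x| <= e / 2 + K * \sum_j (z ord0 j - Y x ord0 j) ^+ 2.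
  move=> xM; have [/forallP h|] := boolP [forall i, `|x ord0 i - Xr z ord0 i| < del].
    rewrite distrC (le_trans (ltW (fdel _ _ xM h)))// lerDl mulr_ge0//.
    by apply: sumr_ge0 => j _; exact: sqr_ge0.
  rewrite negb_forall => /existsP[j]; rewrite -leNgt => dj.
  rewrite (bigD1 j)//= mulrDr.
  have h1 : 2 * B <= K * (z ord0 j - Y x ord0 j) ^+ 2.
    have -> : K * (z ord0 j - Y x ord0 j) ^+ 2 =
        2 * B * (2 * M / k * `|z ord0 j - Y x ord0 j| / del) ^+ 2.
      rewrite /K -[in LHS](real_normK (num_real (z ord0 j - Y x ord0 j))).
      by field; rewrite !gt_eqF.
    rewrite ler_peMr ?mulr_ge0// exprn_ege1// ler_pdivlMr// mul1r.
    by rewrite (le_trans dj)// XYlip.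
  have h2 : 0 <= K * \sum_(i < n | i != j) (z ord0 i - Y x ord0 i) ^+ 2.
    by rewrite mulr_ge0// sumr_ge0// => i _; exact: sqr_ge0.
  have h3 : `|f (Xr z) - f x| <= 2 * B.
    by rewrite (le_trans (ler_normB _ _))// mulr_natl mulr2n lerD.
  by rewrite (le_trans h3)// (le_trans h1)// addrCA lerDl addr_ge0// ltW.
have [N' hN'] : exists N' : nat, (0 < N')%N /\ K * n%:R / N'%:R <= e / 2.
  pose m := Num.bound (K * n%:R / (e / 2)).
  have hm : K * n%:R / (e / 2) < m.+1%:R.
    rewrite (lt_le_trans (archi_boundP _)) ?ler_nat//.
    by rewrite divr_ge0 ?(ltW e20)// mulr_ge0.
  exists m.+1; split => //.
  by rewrite ler_pdivrMr ?ltr0n// [X in _ <= X]mulrC -ler_pdivrMr// ltW.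
have {hN'} [N'0 hN'] := hN'.
pose s := flatten [seq nseq N' j | j <- enum 'I_n].
have sE i : count_mem i s = N'.
  rewrite count_flatten -map_comp sumnE big_map big_enum/= (bigD1 i)//=.
  rewrite count_nseq/= eqxx mul1n big1 ?addn0// => j ji.
  by rewrite count_nseq /= (negbTE ji).
(* Being an average of values of f, this polynomial is bounded by [B] on the whole space and not
   only on the cube; the tails are then controlled by probabilities alone. *)
exists (fun x => bern s N'%:R^-1 (f \o Xr) (Y x) 0).
  apply: bern_trig => j; apply: (eq_trig _ (trigD (trig_cst (1 / 2))
    (trig_cos (M^-1 *: delta_mx ord0 j) (- (pi / 2)) (1 / 2)))) => x.
  by rewrite dot_delta mxE cosB cos_pihalf sin_pihalf mulr0 add0r mulr1 [_^-1 * _]mulrC; field.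
split=> [x|x xM].
  have := @bern_dist s N'%:R^-1 (f \o Xr) (fun w => B + 0 * \sum_(j < n) (fun _ _ => 0) j w) 0 (Y x) 0 (Y01 x).
  rewrite bern_affine !mul0r !addr0 subr0; apply => w.
  by rewrite subr0; exact: fB.
rewrite distrC; apply: le_trans (@bern_dist _ _ _ _ _ _ _ (Y01 x) (fun w => modulus x w xM)) _.
rewrite bern_affine [leRHS]splitr lerD2l (le_trans _ hN')//.
rewrite -mulrA ler_wpM2l//.
rewrite (_ : n%:R / _ = \sum_(j < n) N'%:R^-1); last first.
  by rewrite sumr_const card_ord mulrC mulr_natr.
apply: ler_sum => j _; rewrite bern_sq sE [(0 : 'rV[R]_n) _ _]mxE add0r.
have N0 : N'%:R != 0 :> R by rewrite pnatr_eq0 -lt0n.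
rewrite mulVf// mul1r subrr expr0n/= addr0.
rewrite (_ : N'%:R^-1 ^+ 2 * N'%:R = N'%:R^-1); last by field.
have /andP[y0 y1] := Y01 x j.
by rewrite ler_piMr ?invr_ge0// mulr_ile1// ?subr_ge0// lerBlDl lerDr.
Qed.

(* A continuous function is the pointwise limit of trigonometric polynomials, hence
   measurable for the sigma-algebra generated by the coordinates. *)
Lemma continuous_bounded_bdm f (B : R) : continuous f -> (forall x, `|f x| <= B) -> bdm f.
Proof.
move=> cf fB; split; last by exists B.
have /choice[T TP] : forall k : nat, exists T, trig T /\
    forall x, (forall i, `|x ord0 i| <= k.+1%:R) -> `|f x - T x| <= k.+1%:R^-1.
  move=> k; have k0 : 0 < k.+1%:R^-1 :> R by rewrite invr_gt0.
  have [T tT [_ fT]] := trig_approx cf (ltr0Sn R k) k0 fB.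
  by exists T.
apply: (@measurable_fun_cvg _ _ _ _ T) => [k|x _].
  by have [/bdm_trig[]] := TP k.
apply/cvgrPdist_le => e e0; near=> k.
rewrite (le_trans ((TP k).2 x _))//.
  move=> i; apply: (@le_trans _ _ (\sum_i `|x ord0 i|)).
    by rewrite (bigD1 i)//= lerDl sumr_ge0.
  rewrite (@le_trans _ _ k%:R)// ?ler_nat//.
  by near: k; exact: nbhs_infty_ger.
rewrite -[leRHS]invrK lef_pV2 ?posrE ?invr_gt0// (@le_trans _ _ k%:R)// ?ler_nat//.
by near: k; exact: nbhs_infty_ger.
Unshelve. all: end_near. Qed.

End trigonometric_polynomials.

(** * Levy's theorem together with Slutsky's lemma *)

Section levy_slutsky.
Context {R : realType} {n : nat} {disp : nat -> measure_display}
  {Omega : forall m, measurableType (disp m)}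
  (P : forall m, probability (Omega m) R).
Variable mu : {measure set 'rV[R]_n -> \bar R}.
Hypothesis mu1 : mu setT = 1%E.
Variables Y V : forall m, Omega m -> 'rV[R]_n.
Arguments Y {m}.
Arguments V {m}.
Hypothesis bY : forall m i, bdm (fun w : Omega m => Y w ord0 i).
Hypothesis mV : forall m, measurable_fun setT (@V m).
Hypothesis cvg_char : forall u b,
  \int[P m]_w cos (dot u (Y w) + b) @[m --> \oo] --> \int[mu]_x cos (dot u x + b).
Variable C : R.
Hypothesis tightY : \forall m \near \oo, \int[P m]_w (\sum_i Y w ord0 i ^+ 2) <= C.
Hypothesis VY : forall e del : R, 0 < e -> 0 < del -> \forall m \near \oo,
  exists A, [/\ measurable A, fine (P m A) <= e &
    forall w, ~ A w -> forall i, `|Y w ord0 i - V w ord0 i| < del].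

Let mY m : measurable_fun setT (@Y m).
Proof. by apply/measurable_fun_rVP => i; have [] := bY m i. Qed.

Let bdm_Y m (f : 'rV[R]_n -> R) : bdm f -> bdm (fun w : Omega m => f (Y w)).
Proof.
move=> [mf [M fM]]; split; first exact: measurableT_comp.
by exists M.
Qed.

Let bdm_V m (f : 'rV[R]_n -> R) : bdm f -> bdm (fun w : Omega m => f (V w)).
Proof.
move=> [mf [M fM]]; split; first exact: measurableT_comp.
by exists M.
Qed.

Let cvg_trig T : trig T -> \int[P m]_w T (Y w) @[m --> \oo] --> \int[mu]_x T x.
Proof.
elim=> [u b c|f g tf IHf tg IHg].
  have bc (x : 'rV[R]_n) : bdm (fun x : 'rV[R]_n => cos (dot u x + b)).
    by apply: bdm_cos; apply: measurable_funD => //; exact: measurable_dot.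
  rewrite (ExZ mu1)//; last exact: (bc 0).
  rewrite (_ : (fun m => _) = (fun m => c * \int[P m]_w cos (dot u (Y w) + b))).
    by apply: cvgMr; exact: cvg_char.
  apply/funext => m; rewrite (ExZ (probability_setT _))//; exact: bdm_Y (bc 0).
rewrite (ExD mu1); [|exact: bdm_trig..].
rewrite (_ : (fun m => _) = (fun m => \int[P m]_w f (Y w) + \int[P m]_w g (Y w))).
  exact: cvgD.
by apply/funext => m; rewrite (ExD (probability_setT _))//; apply: bdm_Y; exact: bdm_trig.
Qed.

Let bdm_sq m : bdm (fun w : Omega m => \sum_i Y w ord0 i ^+ 2).
Proof. by apply: bdm_sum => i _; exact: bdmX. Qed.

Let cubeM (M : R) := [set x : 'rV[R]_n | forall i, `|x ord0 i| <= M].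

Let mcube M : measurable (cubeM M).
Proof.
rewrite (_ : cubeM M = \bigcap_(i in [set: 'I_n]) [set x | `|x ord0 i| <= M]); last first.
  by apply/seteqP; split => x /= h; [move=> i _; exact: h|move=> i; exact: h].
apply: fin_bigcap_measurable => //= i _.
have mn : measurable_fun setT (fun x : 'rV[R]_n => `|x ord0 i|).
  by apply: measurableT_comp => //; exact: measurable_rV_coord.
have := mn measurableT _ (measurable_itv `]-oo, M]); rewrite setTI.
by congr measurable; apply/seteqP; split => x /=; rewrite in_itv.
Qed.

Let mu_cube e : 0 < e -> exists k : nat, 1 - e < fine (mu (cubeM k%:R)).
Proof.
move=> e0.
have : mu \o (fun k : nat => cubeM k%:R) @ \oo --> mu (\bigcup_k cubeM k%:R).
  apply: nondecreasing_cvg_mu => //; first exact: bigcup_measurable.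
  move=> a b ab; apply/subsetPset => x ax i.
  by rewrite (le_trans (ax i))// ler_nat.
have -> : \bigcup_k cubeM k%:R = setT.
  apply/seteqP; split => // x _.
  exists (Num.bound (\sum_i `|x ord0 i|)) => // i.
  apply: ltW; apply: (@le_lt_trans _ _ (\sum_i `|x ord0 i|)).
    by rewrite (bigD1 i)//= lerDl sumr_ge0.
  by rewrite archi_boundP// sumr_ge0.
rewrite mu1 => /fine_cvg/cvgrPdist_lt/(_ _ e0)[k _ /(_ k (leqnn _))] /= h.
exists k; move: h; rewrite ltr_norml /= => /andP[_]; lra.
Qed.

Let Y_out m (M : R) w : 0 < M -> ~ cubeM M (Y w) -> 1 <= (\sum_i @Y m w ord0 i ^+ 2) / M ^+ 2.
Proof.
move=> M0 /existsNP[i /negP]; rewrite -ltNge => Mi.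
rewrite ler_pdivlMr ?exprn_gt0// mul1r (bigD1 i)//= -[X in X + _]real_normK ?num_real//.
rewrite (@le_trans _ _ (`|Y w ord0 i| ^+ 2))// ?ler_sqr ?nnegrE ?(ltW M0) ?(ltW Mi)//.
by rewrite lerDl sumr_ge0// => j _; exact: sqr_ge0.
Qed.

(** [Y] carries the analytic information, characteristic functions and second moments; [V] is
    measurable and close to [Y] off a small event. Treating both steps at once keeps moments of [V]
    out of the argument. *)
Lemma levy_slutsky : cvg_in_distribution P (@V) mu.
Proof.
move=> f cf [B fB]; have bf := continuous_bounded_bdm cf fB.
have B0 : 0 <= B by rewrite (le_trans _ (fB 0)).
rewrite -(EFin_Rintegral mu1 bf).
rewrite (_ : (fun m => _) = (fun m => (\int[P m]_w f (V w))%:E)); last first.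
  by apply/funext => m; rewrite (EFin_Rintegral (probability_setT _) (bdm_V _ bf)).
apply: cvg_EFin; first exact: nearW.
have C0 : 0 <= C.
  have [m] := filter_ex tightY; apply: le_trans.
  by apply: Rintegral_ge0 => w _; apply: sumr_ge0 => i _; exact: sqr_ge0.
apply/cvgrPdist_le => e0 e0_gt0.
(* The four errors, f to T under [mu], T from [mu] to [P m], T back to f, and f at Y to f at V, sum
   to (4 + 8 B) e. *)
pose e := e0 / (4 + 8 * B).
have e_gt0 : 0 < e by rewrite divr_gt0// ltr_pwDl// mulr_ge0.
(* One cube for both laws: continuity from below serves [mu], and Chebyshev with the second moment
   bound [C] serves [P m]. *)
have [M [M1 MC Mmu]] : exists M : R, [/\ 0 < M, C / M ^+ 2 <= e & 1 - e <= fine (mu (cubeM M))].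
  have [k hk] := mu_cube e_gt0.
  pose M : R := 1 + k%:R + C / e.
  have Ce0 : 0 <= C / e by rewrite divr_ge0// ltW.
  have M1 : 1 <= M by rewrite /M -addrA lerDl addr_ge0.
  exists M; split.
  - exact: lt_le_trans M1.
  - rewrite ler_pdivrMr ?exprn_gt0 ?(lt_le_trans _ M1)// mulrC -ler_pdivrMr//.
    rewrite (@le_trans _ _ M)//; first by rewrite /M lerDr addr_ge0.
    by rewrite expr2 ler_peMr// (le_trans _ M1).
  - rewrite (le_trans (ltW hk))// fine_le//.
    + rewrite ge0_fin_numE//; apply: (@le_lt_trans _ _ (mu setT)); last by rewrite mu1 ltry.
      by rewrite le_measure// ?inE.
    + rewrite ge0_fin_numE//; apply: (@le_lt_trans _ _ (mu setT)); last by rewrite mu1 ltry.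
      by rewrite le_measure// ?inE.
    + rewrite le_measure// ?inE// => x xk i; rewrite (le_trans (xk i))// /M.
      by rewrite addrAC lerDr addr_ge0.
have [T tT [TB fT]] := trig_approx cf M1 e_gt0 fB.
have bT := bdm_trig tT.
have [del del0 fdel] := unif_continuous_cube M cf e_gt0.
have fT2 x : `|f x - T x| <= 2 * B.
  by rewrite (le_trans (ler_normB _ _))// mulr_natl mulr2n lerD.
near=> m.
have PT := probability_setT (P m).
have h1 : `|\int[mu]_x f x - \int[mu]_x T x| <= e + 2 * B * e.
  rewrite -ExB//; apply: (@le_trans _ _ (\int[mu]_x (e + 2 * B * (1 - \1_(cubeM M) x)))).
    have bi : bdm (fun x => e + 2 * B * (1 - \1_(cubeM M) x) : R).
      apply: bdmD; first exact: bdm_cst; apply: bdmM; first exact: bdm_cst.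
      by apply: bdmB; [exact: bdm_cst|exact: bdm_indic].
    apply: normr_Ex_le => //; first exact: bdmB.
    move=> x; rewrite indicE; case: (boolP (x \in cubeM M)) => [/set_mem xM|_].
      by rewrite subrr mulr0 addr0; exact: fT.
    by rewrite subr0 mulr1 (le_trans (fT2 x))// lerDr ltW.
  have bi : bdm (fun x => (1 - \1_(cubeM M) x) : R).
    by apply: bdmB; [exact: bdm_cst|exact: bdm_indic].
  rewrite ExD//; [|exact: bdm_cst|by apply: bdmM => //; exact: bdm_cst].
  rewrite Ex_cst// ExZ// ExB//; [|exact: bdm_cst|exact: bdm_indic].
  rewrite Ex_cst// Ex_indic// lerD2l ler_wpM2l ?mulr_ge0//; lra.
have h2 : `|\int[mu]_x T x - \int[P m]_w T (Y w)| <= e.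
  by near: m; move/cvgrPdist_le: (cvg_trig tT); apply.
have EY : \int[P m]_w (\sum_i Y w ord0 i ^+ 2) / M ^+ 2 <= e.
  rewrite (le_trans _ MC)// ler_wpM2r ?invr_ge0 ?sqr_ge0//.
  by near: m.
have bY2 : bdm (fun w => 2 * B * ((\sum_i @Y m w ord0 i ^+ 2) / M ^+ 2)).
  by apply: bdmM (bdm_cst _) (bdmM _ (bdm_cst _)).
have EY2 : \int[P m]_w (2 * B * ((\sum_i Y w ord0 i ^+ 2) / M ^+ 2)) <= 2 * B * e.
  rewrite ExZ//; last exact: bdmM (bdm_cst _).
  rewrite ler_wpM2l ?mulr_ge0//; under eq_Rintegral do rewrite mulrC.
  by rewrite ExZ// mulrC.
have Yge0 w : 0 <= 2 * B * ((\sum_i @Y m w ord0 i ^+ 2) / M ^+ 2).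
  apply: mulr_ge0; [exact: mulr_ge0|apply: divr_ge0; [|exact: sqr_ge0]].
  by apply: sumr_ge0 => i _; exact: sqr_ge0.
have h3 : `|\int[P m]_w T (Y w) - \int[P m]_w f (Y w)| <= e + 2 * B * e.
  rewrite -ExB//; [|exact: bdm_Y|exact: bdm_Y].
  apply: (@le_trans _ _ (\int[P m]_w (e + 2 * B * ((\sum_i Y w ord0 i ^+ 2) / M ^+ 2)))).
    apply: normr_Ex_le => //; [by apply: bdmB; exact: bdm_Y|by apply: bdmD => //; exact: bdm_cst|].
    move=> w; rewrite distrC; have [wM|wM] := pselect (cubeM M (Y w)).
      by rewrite (le_trans (fT _ wM))// lerDl.
    rewrite (le_trans (fT2 _))// (@le_trans _ _ (0 + 2 * B * 1))//; first by rewrite add0r mulr1.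
    by rewrite lerD ?(ltW e_gt0)// ler_wpM2l ?mulr_ge0// Y_out.
  by rewrite ExD//; [rewrite Ex_cst// lerD2l|exact: bdm_cst].
have h4 : `|\int[P m]_w f (Y w) - \int[P m]_w f (V w)| <= e + (2 * B * e + 2 * B * e).
  have [A [mA PA hA]] : exists A : set (Omega m), [/\ measurable A, fine (P m A) <= e &
      forall w, ~ A w -> forall i, `|Y w ord0 i - V w ord0 i| < del] by near: m; exact: VY.
  have bA : bdm (fun w => 2 * B * \1_A w : R) by apply: bdmM (bdm_cst _) (bdm_indic _).
  rewrite -ExB//; [|exact: bdm_Y|exact: bdm_V].
  apply: (@le_trans _ _ (\int[P m]_w (e + (2 * B * \1_A w +
       2 * B * ((\sum_i Y w ord0 i ^+ 2) / M ^+ 2))))).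
    apply: normr_Ex_le => //.
    - by apply: bdmB; [exact: bdm_Y|exact: bdm_V].
    - by apply: bdmD; [exact: bdm_cst|exact: bdmD].
    move=> w.
    have f2 : `|f (Y w) - f (V w)| <= 2 * B.
      by rewrite (le_trans (ler_normB _ _))// mulr_natl mulr2n lerD.
    rewrite indicE; case: (boolP (w \in A)) => [/set_mem wA|/negP wA].
      by rewrite mulr1 (le_trans f2)// addrCA lerDl addr_ge0// ltW.
    have {}wA : ~ A w by move=> /mem_set.
    rewrite mulr0 add0r; have [wM|wM] := pselect (cubeM M (Y w)).
      by rewrite (le_trans (ltW (fdel _ _ wM (hA _ wA))))// lerDl.
    rewrite (le_trans f2)// (@le_trans _ _ (0 + 2 * B * 1))//; first by rewrite add0r mulr1.
    by rewrite lerD ?(ltW e_gt0)// ler_wpM2l ?mulr_ge0// Y_out.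
  rewrite ExD//; [|exact: bdm_cst|exact: bdmD].
  rewrite Ex_cst// lerD2l ExD// lerD// ExZ; [|by []|exact: bdm_indic].
  by rewrite Ex_indic// ler_wpM2l ?mulr_ge0.
have -> : \int[mu]_x f x - \int[P m]_w f (V w) =
  (\int[mu]_x f x - \int[mu]_x T x) + (\int[mu]_x T x - \int[P m]_w T (Y w)) +
  (\int[P m]_w T (Y w) - \int[P m]_w f (Y w)) + (\int[P m]_w f (Y w) - \int[P m]_w f (V w)).
  by ring.
rewrite (@le_trans _ _ ((e + 2 * B * e) + e + (e + 2 * B * e) + (e + (2 * B * e + 2 * B * e))))//.
  rewrite (le_trans (ler_normD _ _))// lerD// (le_trans (ler_normD _ _))// lerD//.
  by rewrite (le_trans (ler_normD _ _))// lerD.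
rewrite (_ : _ + _ = e * (4 + 8 * B)); last by ring.
by rewrite /e divfK// gt_eqF// ltr_pwDl// mulr_ge0.
Unshelve. all: end_near. Qed.
End levy_slutsky.

(** * Measures and conditional laws given by densities *)

Section measure_with_density.
Local Open Scope ereal_scope.
Context {d} {T : measurableType d} {R : realType}.
Variables (mu : {measure set T -> \bar R}) (g : T -> R).
Hypotheses (mg : measurable_fun setT g) (g0 : forall x, (0 <= g x)%R).

(** The two proofs are arguments so that the measure structure can be inferred from the term
    itself. *)
Definition mdens of measurable_fun setT g & (forall x, (0 <= g x)%R) :=
  fun A : set T => \int[mu]_(x in A) (g x)%:E.

Local Notation m := (mdens mg g0).

Let mdens0 : m set0 = 0. Proof. by rewrite /mdens integral_set0. Qed.

Let mdens_ge0 A : 0 <= m A.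
Proof. by apply: integral_ge0 => x _; rewrite lee_fin. Qed.

Let mdens_sigma_additive : semi_sigma_additive m.
Proof.
move=> F mF tF mUF; rewrite /mdens ge0_integral_bigcup//=.
- apply: is_cvg_ereal_nneg_natsum_cond => k _ _.
  by apply: integral_ge0 => x _; rewrite lee_fin.
- by apply/measurable_EFinP; apply: measurable_funTS.
- by move=> x _; rewrite lee_fin.
Qed.

HB.instance Definition _ := isMeasure.Build _ _ _ m mdens0 mdens_ge0 mdens_sigma_additive.

End measure_with_density.

Section conditional_density.
Local Open Scope ereal_scope.
Context {d d1 d2} {T : measurableType d} {T1 : measurableType d1}
  {T2 : measurableType d2} {R : realType}.
Variables (P : probability T R) (y : {mfun T >-> T1}) (x : T -> T2).
Hypothesis mx : measurable_fun setT x.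
Variables (la : {sigma_finite_measure set T2 -> \bar R}) (q : T1 * T2 -> R).
Hypotheses (mq : measurable_fun setT q) (q0 : forall z, (0 <= q z)%R).

(* The pair (y, x) and the measure with density q with respect to the product of the
   law of y and la agree on rectangles, hence on the product sigma-algebra. *)
Lemma conditional_density (G : set T1) : measurable G ->
  (forall A B, measurable A -> measurable B ->
    P (y @^-1` (A `&` G) `&` x @^-1` B) =
    \int[P]_(w in y @^-1` A) \int[la]_(u in B) (q (y w, u))%:E) ->
  forall C, measurable C ->
    P [set w | C (y w, x w) /\ G (y w)] = \int[P]_w \int[la]_u (\1_C (y w, u) * q (y w, u))%:E.
Proof.
move=> mG rect C mC.
have myG : measurable (y @^-1` G).
  by have := (measurable_funP y) measurableT _ mG; rewrite setTI.
have myx : measurable_fun setT (fun w => (y w, x w)) by exact: measurable_fun_pair.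
(* Law of the pair on the event that y lies in [G]. In the application [G] says that the process has
   not jammed, and the density vanishes off it. *)
pose m1 := pushforward (mrestr P myG) (fun w => (y w, x w)).
pose nu := distribution P y.
pose m2 := mdens (nu \x la) mq q0.
have m2E D : measurable D -> m2 D = \int[P]_w \int[la]_u (\1_D (y w, u) * q (y w, u))%:E.
  move=> mD; rewrite /m2/= /mdens integral_mkcond.
  have mDq : measurable_fun setT (fun z => (\1_D z * q z)%:E).
    by apply/measurable_EFinP; apply: measurable_funM.
  rewrite (_ : (_ \_ _) = (fun z => (\1_D z * q z)%:E)); last first.
    apply/funext => z; rewrite patchE indicE.
    by case: ifPn => _; rewrite ?mul1r ?mul0r.
  have Dq0 z : 0 <= (\1_D z * q z)%:E by rewrite lee_fin mulr_ge0.
  rewrite fubini_tonelli1//= /fubini_F.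
  have mF : measurable_fun setT (fun z => \int[la]_u (\1_D (z, u) * q (z, u))%:E).
    exact: (measurable_fun_fubini_tonelli_F (m2 := la) (fun z => (\1_D z * q z)%:E)).
  rewrite ge0_integral_pushforward//.
  by move=> z _; exact: integral_ge0.
transitivity (m2 C); last exact: m2E.
rewrite -[LHS]/(m1 C).
apply: (measure_unique (fun D => exists A B, [/\ measurable A, measurable B & D = A `*` B])
  (fun=> setT)) => //.
- rewrite measurable_prod_measurableType; congr (<<s _ >>).
  apply/seteqP; split => D; first by move=> [A mA [B mB <-]]; exists A, B.
  by move=> [A [B [mA mB ->]]]; exists A => //; exists B.
- move=> _ _ [A [B [mA mB ->]]] [A' [B' [mA' mB' ->]]].
  by exists (A `&` A'), (B `&` B'); rewrite setXI; split => //; exact: measurableI.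
- by move=> _; exists setT, setT; rewrite setXTT.
- by rewrite bigcup_const.
- move=> _ [A [B [mA mB ->]]]; transitivity (m2 (A `*` B)) => //.
  rewrite m2E; last exact: measurableX.
  rewrite -[LHS]/(P ([set w | A (y w) /\ B (x w)] `&` y @^-1` G)).
  rewrite (_ : _ `&` _ = y @^-1` (A `&` G) `&` x @^-1` B); last first.
    by apply/seteqP; split => w /= [[]].
  rewrite rect// integral_mkcond; apply: eq_integral => w _.
  rewrite patchE; case: ifPn => wA; last first.
    rewrite integral0_eq// => u _; rewrite indicE (_ : _ \in _ = false) ?mul0r//.
    by apply/negbTE; apply: contra wA => /set_mem [/= /mem_set].
  rewrite integral_mkcond; apply: eq_integral => u _.
  rewrite patchE indicE; have [uB|uB] := boolP (u \in B).
    by rewrite mem_set ?mul1r//; split => /=; exact: set_mem.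
  rewrite (_ : _ \in _ = false) ?mul0r//.
  by apply/negbTE; apply: contra uB => /set_mem [/= _ /mem_set].
- move=> _; apply: (@le_lt_trans _ _ 1); last exact: ltry.
  by rewrite -[X in X <= _]/(P (setT `&` _)) probability_le1// setTI.
Qed.

End conditional_density.

(** * The adsorption process *)

Section csa_measurability.
Context {R : realType} (d N : nat) (r : R).
Local Notation point := 'rV[R]_d.
Implicit Types (m k j : nat) (beta : 'rV[R]_N).

Lemma measurable_cube m : measurable (cube m : set point).
Proof.
rewrite (_ : cube m = \bigcap_(i in [set: 'I_d])
    [set x : point | `|x ord0 i| <= (m%:R `^ d%:R^-1) / 2]); last first.
  by apply/seteqP; split => x /= h; [move=> i _; exact: h|move=> i; exact: h].
apply: fin_bigcap_measurable => //= i _.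
have mn : measurable_fun setT (fun x : point => `|x ord0 i|).
  by apply: measurableT_comp => //; exact: measurable_rV_coord.
have := mn measurableT _ (measurable_itv `]-oo, (m%:R `^ d%:R^-1) / 2]); rewrite setTI.
by congr measurable; apply/seteqP; split => x /=; rewrite in_itv.
Qed.

Lemma lebesgue_box n (c : R) :
  (lebesgue_rV n [set x : 'rV[R]_n | forall i, (`|x ord0 i| <= c)%R] < +oo)%E.
Proof.
have [c0|c0] := ltP c 0.
  case: n => [|n]; first by rewrite /= diracE; case: (_ \in _); rewrite ltry.
  rewrite (_ : [set _ | _] = set0) ?measure0//.
  apply/seteqP; split => // x /(_ ord0) h.
  by have := le_lt_trans h c0; rewrite normr_lt0.
elim: n => [|n IH]; first by rewrite /= diracE; case: (_ \in _); rewrite ltry.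
rewrite /= /leb_cons /pushforward.
rewrite (_ : _ @^-1` _ = `[- c, c]%classic `*` [set x : 'rV[R]_n | forall i, (`|x ord0 i| <= c)%R]).
  rewrite product_measure1E//; last first.
    rewrite (_ : [set _ | _] = \bigcap_(i in [set: 'I_n]) [set x : 'rV[R]_n | `|x ord0 i| <= c]); last first.
      by apply/seteqP; split => x /= h; [move=> i _; exact: h|move=> i; exact: h].
    apply: fin_bigcap_measurable => //= i _.
    have mn : measurable_fun setT (fun x : 'rV[R]_n => `|x ord0 i|).
      by apply: measurableT_comp => //; exact: measurable_rV_coord.
    have := mn measurableT _ (measurable_itv `]-oo, c]); rewrite setTI.
    by congr measurable; apply/seteqP; split => x /=; rewrite in_itv.
  have lE : lebesgue_measure (`[- c, c]%classic : set R) = (c - - c)%:E.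
    rewrite lebesgue_measure_itv/= lte_fin -EFinB; case: ifPn => // h.
    by congr EFin; move: h; rewrite -leNgt => ?; lra.
  apply: lte_mul_pinfty => //; rewrite ge0_fin_numE//.
  by rewrite -[X in (X < _)%E]/(lebesgue_measure _) lE ltry.
apply/seteqP; split => [[a x] /= h|[a x] /= [h1 h2] i]; last first.
  rewrite mxE; case: unliftP => [j _|_] /=; first exact: h2.
  by move: h1; rewrite in_itv/= -ler_norml.
split; first by have := h ord0; rewrite mxE unlift_none/= in_itv/= -ler_norml.
by move=> i; have := h (lift ord0 i); rewrite mxE liftK.
Qed.

Lemma lebesgue_cube_fin m : (lebesgue_rV d (cube m : set point) < +oo)%E.
Proof. exact: lebesgue_box. Qed.

Lemma measurable_euclidean_dist disp (T : measurableType disp) (f g : T -> point) :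
  measurable_fun setT f -> measurable_fun setT g ->
  measurable_fun setT (fun t => euclidean_dist (f t) (g t)).
Proof.
move=> mf mg; apply: (measurableT_comp (f := @Num.sqrt R)).
  by apply: continuous_measurable_fun; exact: sqrt_continuous.
apply: measurable_sum => i; apply: measurable_funX; apply: measurable_funB.
- by move/measurable_fun_rVP : mf.
- by move/measurable_fun_rVP : mg.
Qed.

(** Joint measurability in the past and the next point, as Tonelli's theorem requires. *)
Lemma measurable_nu k : measurable_fun setT
  (fun z : k.-tuple point * point => (nu r z.2 z.1)%:R : R).
Proof.
have -> : (fun z : k.-tuple point * point => (nu r z.2 z.1)%:R : R) =
    (fun z => \sum_(i < k) \1_[set z : k.-tuple point * point | euclidean_dist z.2 (tnth z.1 i) <= r] z).
  apply/funext => z; rewrite /nu -sum1_count big_tuple big_mkcond natr_sum.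
  apply: eq_bigr => i _; rewrite indicE.
  by rewrite (_ : _ \in _ = (euclidean_dist z.2 (tnth z.1 i) <= r)) ?[RHS]fun_if;
    [case: ifP|apply/idP/idP => [/set_mem|/mem_set]].
apply: measurable_sum => i; apply: measurable_indic.
have md : measurable_fun setT (fun z : k.-tuple point * point => euclidean_dist z.2 (tnth z.1 i)).
  apply: measurable_euclidean_dist => //.
  by apply: (measurableT_comp (measurable_tnth i)).
have := md measurableT _ (measurable_itv `]-oo, r]); rewrite setTI.
by congr measurable; apply/seteqP; split => x /=; rewrite in_itv.
Qed.

Lemma measurable_nu_eq k j :
  measurable [set z : k.-tuple point * point | nu r z.2 z.1 = j].
Proof.
have := @measurable_nu k measurableT [set j%:R : R] (measurable_set1 _); rewrite setTI.
congr measurable; apply/seteqP; split => x /=; last by move->.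
by move/eqP; rewrite eqr_nat => /eqP.
Qed.

Let indE k j (y : k.-tuple point) u : (nu r u y == j)%:R =
  \1_[set z : k.-tuple point * point | nu r z.2 z.1 = j] (y, u) :> R.
Proof.
rewrite indicE; congr (nat_of_bool _)%:R; apply/idP/idP => [/eqP h|/set_mem/= ->//].
by rewrite mem_set.
Qed.

Lemma measurable_nu_section k j (y : k.-tuple point) :
  measurable_fun setT (fun u => (nu r u y == j)%:R : R).
Proof.
under eq_fun do rewrite indE; apply: measurableT_comp => //.
by apply: measurable_indic; exact: measurable_nu_eq.
Qed.

Lemma integrable_cube m (f : point -> R) (M : R) : measurable_fun setT f ->
  (forall u, `|f u| <= M) -> (lebesgue_rV d).-integrable (cube m) (EFin \o f).
Proof.
move=> mf fM; apply: (@le_integrable _ _ _ _ _ (measurable_cube m) _ (EFin \o cst M)).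
- exact/measurable_EFinP/measurable_funTS.
- by move=> u _ /=; rewrite lee_fin (le_trans (fM u))// ler_norm.
- apply/integrableP; split; first exact: (measurable_cst M%:E).
  rewrite (_ : (fun u => _) = cst `|M|%:E)//.
  by rewrite integral_cst ?lte_mul_pinfty ?lebesgue_cube_fin//; exact: measurable_cube.
Qed.

Lemma EFin_Gamma m j k (y : k.-tuple point) : (Gamma r m j y)%:E =
  (\int[lebesgue_rV d]_(u in cube m) ((nu r u y == j)%:R)%:E)%E.
Proof.
rewrite /Gamma /Rintegral fineK//; apply: integrable_fin_num; first exact: measurable_cube.
apply: (@integrable_cube _ _ 1); first exact: measurable_nu_section.
by move=> u; case: (_ == _); rewrite ?normr1 ?normr0.
Qed.

Lemma Gamma_ge0 m j (y : seq point) : 0 <= Gamma r m j y.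
Proof. by apply: Rintegral_ge0 => u _; exact: ler0n. Qed.

Lemma measurable_Gamma m j k : measurable_fun setT (fun y : k.-tuple point => Gamma r m j y).
Proof.
apply/measurable_EFinP.
rewrite (_ : _ \o _ = (fun y : k.-tuple point => \int[lebesgue_rV d]_u
   (\1_(cube m) u * \1_[set z : k.-tuple point * point | nu r z.2 z.1 = j] (y, u))%:E)%E); last first.
  apply/funext => y; rewrite /= EFin_Gamma integral_mkcond; apply: eq_integral => u _.
  by rewrite patchE indE [\1_(cube m) u]indicE; case: ifPn => _; rewrite ?mul1r ?mul0r.
apply: (measurable_fun_fubini_tonelli_F (m2 := lebesgue_rV d)
  (fun z : k.-tuple point * point => (\1_(cube m) z.2 *
    \1_[set z : k.-tuple point * point | nu r z.2 z.1 = j] z)%:E)).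
  apply/measurable_EFinP; apply: measurable_funM.
    by apply: measurableT_comp => //; apply: measurable_indic; exact: measurable_cube.
  by apply: measurable_indic; exact: measurable_nu_eq.
by move=> z; rewrite lee_fin mulr_ge0.
Qed.

Lemma rate_ge0 beta k : positive beta -> 0 <= rate beta k.
Proof.
move=> b0; case: k => [|k] /=; first exact: ler01.
by case: insubP => //= i _ _; exact: ltW.
Qed.

(** Types above N have rate 0, so N + 1 indicators suffice; this makes [total_rate] a finite
    combination of the areas [Gamma]. *)
Lemma rate_sum beta (l : nat) : rate beta l = \sum_(j < N.+1) rate beta j * (l == j)%:R.
Proof.
have [lN|lN] := ltnP l N.+1.
  rewrite (bigD1 (Ordinal lN))//= eqxx mulr1 big1 ?addr0// => j jl.
  by rewrite (_ : (l == j) = false) ?mulr0//; apply/negbTE; apply: contra jl => /eqP jl; exact/eqP/val_inj.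
rewrite big1 => [|j _]; last by rewrite gtn_eqF ?mulr0// (leq_trans (ltn_ord j)).
by case: l lN => //= l lN; rewrite insubF//= ltnNge -ltnS lN.
Qed.

Lemma total_rateE m beta k (y : k.-tuple point) :
  total_rate r m beta y = \sum_(j < N.+1) rate beta j * Gamma r m j y.
Proof.
have intj j : (lebesgue_rV d).-integrable (cube m) (EFin \o (fun u => (nu r u y == j)%:R)).
  apply: (@integrable_cube _ _ 1); first exact: measurable_nu_section.
  by move=> u; case: (_ == _); rewrite ?normr1 ?normr0.
rewrite /total_rate /Gamma; under eq_Rintegral do rewrite rate_sum.
have mC := measurable_cube m.
rewrite (_ : (\sum_(j < N.+1) _) =
    \sum_(j < N.+1) \int[lebesgue_rV d]_(u in cube m) (rate beta j * (nu r u y == j)%:R)); last first.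
  by apply: eq_bigr => j _; rewrite RintegralZl.
have intZ (j : nat) : (lebesgue_rV d).-integrable (cube m)
    (EFin \o (fun u => rate beta j * (nu r u y == j)%:R)).
  rewrite (_ : EFin \o _ = (fun u => (rate beta j)%:E * (EFin \o (fun u => (nu r u y == j)%:R)) u)%E).
    exact: integrableZl.
  by apply/funext => u /=; rewrite EFinM.
elim: (index_enum _) => [|j s IH].
  under eq_Rintegral do rewrite big_nil.
  by rewrite big_nil Rintegral_cst// mul0r.
under eq_Rintegral do rewrite big_cons.
rewrite big_cons RintegralD//; first by rewrite IH.
elim: s {IH} => [|i s IH].
  rewrite (_ : EFin \o _ = cst 0%E); last by apply/funext => u /=; rewrite big_nil.
  exact: integrable0.
rewrite (_ : EFin \o _ = ((EFin \o (fun u => rate beta i * (nu r u y == i)%:R)%R) \+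
  (EFin \o (fun u => \sum_(j <- s) rate beta j * (nu r u y == j)%:R)%R))%E).
  exact: integrableD.
by apply/funext => u /=; rewrite big_cons EFinD.
Qed.

Lemma total_rate_ge0 m beta (y : seq point) : positive beta -> 0 <= total_rate r m beta y.
Proof. by move=> b0; apply: Rintegral_ge0 => u _; exact: rate_ge0. Qed.

Lemma measurable_total_rate m beta k :
  measurable_fun setT (fun y : k.-tuple point => total_rate r m beta y).
Proof.
under eq_fun do rewrite total_rateE.
by apply: measurable_sum => j; apply: measurable_funM => //; exact: measurable_Gamma.
Qed.

(* The conditional probability, given the points y, that the next point has j
   neighbours; it is set to 0 once the process has jammed. *)
Definition type_prob m beta j (y : seq point) : R :=
  if 0 < total_rate r m beta y then rate beta j * Gamma r m j y / total_rate r m beta y else 0.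

Lemma type_prob_ge0 m beta j (y : seq point) : positive beta -> 0 <= type_prob m beta j y.
Proof.
move=> b0; rewrite /type_prob; case: ifPn => // t0.
by rewrite divr_ge0 ?(ltW t0)// mulr_ge0 ?rate_ge0 ?Gamma_ge0.
Qed.

Lemma sum_type_prob m beta k (y : k.-tuple point) : 0 < total_rate r m beta y ->
  \sum_(j < N.+1) type_prob m beta j y = 1.
Proof.
move=> t0; rewrite /type_prob t0 -mulr_suml -total_rateE divff// gt_eqF//.
Qed.

Lemma type_prob_le1 m beta j k (y : k.-tuple point) : positive beta -> (j <= N)%N ->
  type_prob m beta j y <= 1.
Proof.
move=> b0 jN; have [t0|t0] := boolP (0 < total_rate r m beta y); last first.
  by rewrite /type_prob (negbTE t0).
rewrite -(sum_type_prob t0) (bigD1 (Ordinal (jN : (j < N.+1)%N)))//= lerDl sumr_ge0// => i _.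
exact: type_prob_ge0.
Qed.

Lemma measurable_type_prob m beta j k : positive beta ->
  measurable_fun setT (fun y : k.-tuple point => type_prob m beta j y).
Proof.
move=> b0; rewrite /type_prob; apply: measurable_fun_if => //.
- by apply: measurable_fun_ltr => //; exact: measurable_total_rate.
- apply: measurable_funTS; apply: measurable_funM.
    by apply: measurable_funM => //; exact: measurable_Gamma.
  (* The reciprocal is expressed as a real power, which is measurable on the whole line. *)
  rewrite (_ : (fun y => _) = (fun y : k.-tuple point => total_rate r m beta y `^ (- 1))); last first.
    by apply/funext => y; rewrite powR_inv1// total_rate_ge0.
  by apply: (measurableT_comp (measurable_powR (-1))); exact: measurable_total_rate.
Qed.

Lemma bdm_type_prob m beta j k : positive beta -> (j <= N)%N ->
  bdm (fun y : k.-tuple point => type_prob m beta j y).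
Proof.
move=> b0 jN; split; first exact: measurable_type_prob.
by exists 1 => y; rewrite ger0_norm ?type_prob_ge0// type_prob_le1.
Qed.

End csa_measurability.

(** * Conditional law of the next point *)

Section csa_law.
Context {R : realType} (d N : nat) (r : R).
Local Notation point := 'rV[R]_d.
Variables (m : nat) (beta : 'rV[R]_N).
Context {disp : measure_display} {Omega : measurableType disp}.
Variables (P : probability Omega R) (X : nat -> {RV P >-> point}).

Lemma measurable_first_points k : measurable_fun setT (first_points X k).
Proof.
apply/measurable_fun_tnthP => i.
rewrite (_ : _ \o _ = X i) //.
by apply/funext => w /=; rewrite tnth_mktuple.
Qed.

(** Cut off at jamming, after which the values of [X] are unconstrained; this matches the convention
    for [type_prob]. *)
Definition type_indic k j (w : Omega) : R :=
  ((0 < total_rate r m beta (first_points X k w)) && (nu r (X k w) (first_points X k w) == j))%:R.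

Hypotheses (b0 : positive beta) (hX : is_csa r m beta X).

Let mX k : measurable_fun setT (X k). Proof. by []. Qed.

Let active k := [set y : k.-tuple point | 0 < total_rate r m beta y].
Arguments active : clear implicits.

Let mactive k : measurable (active k).
Proof.
have := @measurable_total_rate R d N r m beta k measurableT _ (measurable_itv `]0, +oo[); rewrite setTI.
by congr measurable; apply/seteqP; split => y /=; rewrite in_itv/= andbT.
Qed.

Let mtype k j : measurable [set w | 0 < total_rate r m beta (first_points X k w) /\
  nu r (X k w) (first_points X k w) = j].
Proof.
have mp : measurable_fun setT (fun w => (first_points X k w, X k w)).
  by apply: measurable_fun_pair => //; exact: (@measurable_first_points k).
have := mp measurableT _ (@measurable_nu_eq _ _ r k j); rewrite setTI => h1.
have := @measurable_first_points k measurableT _ (@mactive k); rewrite setTI => h2.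
by have := measurableI _ _ h2 h1.
Qed.

Let type_indicE k j : type_indic k j =
  \1_[set w | 0 < total_rate r m beta (first_points X k w) /\
               nu r (X k w) (first_points X k w) = j].
Proof.
apply/funext => w; rewrite indicE /type_indic; congr (nat_of_bool _)%:R.
by apply/andP/idP => [[h /eqP h']|/set_mem[h h']]; [exact/mem_set|split => //; exact/eqP].
Qed.

Lemma bdm_type_indic k j : bdm (type_indic k j).
Proof. by rewrite type_indicE; exact: bdm_indic. Qed.

Lemma bdm_first_points k (a : k.-tuple point -> R) : bdm a ->
  bdm (fun w => a (first_points X k w)).
Proof.
move=> [ma [M aM]]; split; last by exists M.
by apply: measurableT_comp => //; exact: measurable_first_points.
Qed.

(** The conditional density of the next point, extended by 0 to jammed configurations and to points
    outside the cube. *)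
Let q k (z : k.-tuple point * point) : R :=
  \1_(active k) z.1 * \1_(cube m) z.2 *
  (rate beta (nu r z.2 z.1) * total_rate r m beta z.1 `^ (- 1)).

Let mq k : measurable_fun setT (@q k).
Proof.
apply: measurable_funM.
  apply: measurable_funM; apply: measurableT_comp => //; apply: measurable_indic.
    exact: mactive.
  exact: measurable_cube.
apply: measurable_funM.
  under eq_fun do rewrite rate_sum.
  apply: measurable_sum => j; apply: measurable_funM => //.
  rewrite (_ : (fun z => _) = \1_[set z : k.-tuple point * point | nu r z.2 z.1 = j]).
    by apply: measurable_indic; exact: measurable_nu_eq.
  apply/funext => z; rewrite indicE; congr (nat_of_bool _)%:R.
  by apply/eqP/idP => [h|/set_mem//]; exact: mem_set.
apply: (measurableT_comp (measurable_powR (-1))).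
by apply: (measurableT_comp (@measurable_total_rate R d N r m beta k)).
Qed.

Let q0 k z : 0 <= @q k z.
Proof. by rewrite !mulr_ge0// ?rate_ge0 ?powR_ge0. Qed.

Let fp k : {mfun Omega >-> k.-tuple point} :=
  HB.pack (first_points X k) (isMeasurableFun.Build _ _ _ _ _ (@measurable_first_points k)).

(** [is_csa] speaks of rectangles, past in B and next point in A, but having j neighbours couples
    the two. [conditional_density] bridges the gap, and the inner integral is an area. *)
Let law_type k j (B : set (k.-tuple point)) : (j <= N)%N -> measurable B ->
  P [set w | [/\ B (first_points X k w), 0 < total_rate r m beta (first_points X k w) &
              nu r (X k w) (first_points X k w) = j]] =
  (\int[P]_w (\1_B (first_points X k w) * type_prob r m beta j (first_points X k w))%:E)%E.
Proof.
move=> jN mB.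
pose C := [set z : k.-tuple point * point | [/\ B z.1, active k z.1 & nu r z.2 z.1 = j]].
have mC : measurable C.
  have m1 : measurable [set z : k.-tuple point * point | B z.1].
    by rewrite -[X in measurable X]setTI; exact: measurable_fst.
  have m2 : measurable [set z : k.-tuple point * point | active k z.1].
    by rewrite -[X in measurable X]setTI; apply: measurable_fst => //; exact: mactive.
  have := measurableI _ _ (measurableI _ _ m1 m2) (@measurable_nu_eq R d r k j).
  by congr measurable; apply/seteqP; split => [z [[]]|z []] //.
have inner (y : k.-tuple point) : (\int[lebesgue_rV d]_u (\1_C (y, u) * q (y, u))%:E =
    (\1_B y * type_prob r m beta j y)%:E)%E.
  have [By|nBy] := pselect (B y); last first.
    rewrite [\1_B _]indicE memNset// mul0r integral0_eq// => u _.
    by rewrite indicE memNset ?mul0r// => -[].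
  rewrite [\1_B _]indicE mem_set// mul1r /type_prob; case: ifPn => t0; last first.
    rewrite integral0_eq// => u _.
    by rewrite /q [\1_(active k) _]indicE memNset ?mul0r ?mulr0//=; exact/negP.
  rewrite mulrAC EFinM EFin_Gamma -ge0_integralZl//; first last.
  - by rewrite lee_fin mulr_ge0 ?rate_ge0// invr_ge0 ltW.
  - by apply/measurable_EFinP/measurable_funTS; exact: measurable_nu_section.
  - exact: measurable_cube.
  rewrite [RHS]integral_mkcond; apply: eq_integral => u _.
  rewrite patchE /q [\1_(active k) _]indicE mem_set// mul1r [\1_(cube m) _]indicE.
  case: ifPn => [uC|uC] /=; last by rewrite mul0r mulr0.
  rewrite mul1r indicE powR_inv1 ?(ltW t0)//.
  have [nj|nj] := eqVneq (nu r u y) j; last first.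
    by rewrite memNset ?mul0r ?mule0// => -[_ _ /= /eqP]; rewrite (negbTE nj).
  by rewrite mem_set// mul1r mule1 nj mulrC.
have rect A D : measurable A -> measurable D ->
    P (fp k @^-1` (A `&` active k) `&` X k @^-1` D) =
    (\int[P]_(w in fp k @^-1` A) \int[lebesgue_rV d]_(u in D) (q (fp k w, u))%:E)%E.
  move=> mA mD; etransitivity; first exact: hX mA mD.
  rewrite integral_mkcond [RHS]integral_mkcond; apply: eq_integral => w _.
  rewrite !patchE; have [Aw|nAw] := pselect (A (first_points X k w)); last first.
    by rewrite !memNset// => -[].
  rewrite [in RHS]mem_set//; have [t0|t0] := pselect (active k (first_points X k w)); last first.
    rewrite memNset; last by case.
    by rewrite integral0_eq// => u _; rewrite /q [\1_(active k) _]indicE memNset ?mul0r.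
  rewrite ifT; last by apply/mem_set; split.
  rewrite setIC [LHS]integral_mkcondr; apply: eq_integral => u _.
  rewrite patchE /q /= (_ : \1_(active k) _ = 1); last by rewrite indicE mem_set.
  by rewrite indicE; case: ifPn => uC; rewrite !mul1r ?mul0r// powR_inv1// ltW.
have := @conditional_density _ _ _ _ _ _ _ P (fp k) (X k) (mX k) (lebesgue_rV d) (@q k)
  (@mq k) (@q0 k) _ (@mactive k) rect C mC.
rewrite (_ : [set w | _ /\ active k _] = [set w | [/\ B (first_points X k w),
  0 < total_rate r m beta (first_points X k w) & nu r (X k w) (first_points X k w) = j]]) => [->|].
  by apply: eq_integral => w _; exact: inner.
by apply/seteqP; split => w /=; [move=> [[]]|move=> []].
Qed.

(** By [law_type], weighting by [type_indic] and weighting by [type_prob] induce the same measure on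
    the past; the bounded function [a] is integrated against it. *)
Lemma expectation_type_indic k j (a : k.-tuple point -> R) : (j <= N)%N -> bdm a ->
  \int[P]_w (a (first_points X k w) * type_indic k j w) =
  \int[P]_w (a (first_points X k w) * type_prob r m beta j (first_points X k w)).
Proof.
move=> jN ba; pose S := [set w | 0 < total_rate r m beta (first_points X k w) /\
  nu r (X k w) (first_points X k w) = j].
have mS : measurable S by exact: mtype.
have [mI _] := bdm_type_indic k j.
have I0 w : 0 <= type_indic k j w by exact: ler0n.
pose nu0 := mdens P mI I0.
pose nu1 := pushforward nu0 (first_points X k).
have bt : bdm (fun y : k.-tuple point => type_prob r m beta j y) by exact: bdm_type_prob.
have mfp := @measurable_first_points k.
have nu0E A : measurable A -> nu0 A = P (A `&` S).
  move=> mA; rewrite /nu0/= /mdens.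
  under eq_integral do rewrite type_indicE.
  by rewrite integral_indic// setIC.
have nuE A : measurable A -> nu1 A =
    (\int[distribution P (fp k)]_(y in A) (type_prob r m beta j y)%:E)%E.
  move=> mA; rewrite integral_mkcond ge0_integral_pushforward//; first last.
  - move=> y _; rewrite patchE; case: ifPn => // _; rewrite lee_fin; exact: type_prob_ge0.
  - apply/(measurable_restrictT _ _).1 => //; apply: measurable_funTS.
    by apply/measurable_EFinP; case: bt.
  rewrite preimage_setT; transitivity (P [set w | [/\ A (first_points X k w),
      0 < total_rate r m beta (first_points X k w) & nu r (X k w) (first_points X k w) = j]]).
    rewrite -[LHS]/(nu0 ([set w | A (first_points X k w)])) nu0E; last first.
      by rewrite -[X in measurable X]setTI; exact: mfp.
    by congr (P _); apply/seteqP; split => w /=; [move=> [? []]|move=> []].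
  rewrite law_type//; apply: eq_integral => w _.
  by rewrite /= patchE indicE; case: ifPn => _; rewrite ?mul1r ?mul0r.
have nu0fin : (nu0 setT < +oo)%E.
  by rewrite nu0E// setTI (le_lt_trans (probability_le1 P mS))// ltry.
have ba' : bdm (fun w => a (first_points X k w)) by exact: bdm_first_points.
transitivity (\int[nu0]_w a (first_points X k w)).
  rewrite (@Rintegral_density _ _ _ P nu0 (type_indic k j))//; first by case: ba'.
  exact: bdm_integrable_fin.
have dens := @Rintegral_density _ _ _ (distribution P (fp k)) _ _ (proj1 bt)
  (fun y => type_prob_ge0 r m j y b0) nuE a (proj1 ba).
transitivity (\int[distribution P (fp k)]_y (a y * type_prob r m beta j y)).
  rewrite -dens//; last exact: bdm_integrable_fin.
  rewrite /Rintegral; congr fine; rewrite integral_pushforward//.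
    by apply/measurable_EFinP; case: ba.
  exact: bdm_integrable_fin.
rewrite /Rintegral; congr fine; rewrite integral_pushforward//.
  by apply/measurable_EFinP; case: (bdmM ba bt).
apply: (bdm_integrable (probability_setT P)).
exact: (bdm_first_points (bdmM ba bt)).
Qed.

End csa_law.

(** * Elementary Taylor bounds *)

Section taylor_bounds.
Context {R : realType}.
Implicit Types x : R.

(** Mean value inequality on both sides of 0. The bounds on sine and cosine follow from one another
    through it, with constant 1 in place of inverse factorials, which is enough for error terms. *)
Lemma mvt_bound (f g : R -> R) (B x : R) : (forall y, is_derive y (1 : R) f (g y)) ->
  f 0 = 0 -> (forall y, `|y| <= `|x| -> `|g y| <= B) -> `|f x| <= B * `|x|.
Proof.
move=> df f0 gB.
have cf : continuous f.
  by move=> y; apply: differentiable_continuous; exact/derivable1_diffP.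
have [x0|x0] := leP 0 x.
  have [c cx fE] := @MVT_segment R f g 0 x x0 (fun y _ => df y) (continuous_subspaceT cf).
  rewrite f0 !subr0 in fE; rewrite fE normrM ler_wpM2r// gB//.
  by move: cx; rewrite in_itv/= => /andP[c0 cx]; rewrite !ger0_norm.
have [c cx fE] := @MVT_segment R f g x 0 (ltW x0) (fun y _ => df y) (continuous_subspaceT cf).
rewrite f0 !sub0r in fE.
have -> : f x = g c * x by rewrite -[f x]opprK fE mulrN opprK.
rewrite normrM ler_wpM2r// gB//.
by move: cx; rewrite in_itv/= => /andP[xc c0]; rewrite !ler0_norm ?(ltW x0)// lerN2.
Qed.

Lemma normr_sin_le x : `|sin x| <= `|x|.
Proof.
have := @mvt_bound sin cos 1 x _ (sin0 R); rewrite mul1r; apply => // y _.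
by rewrite ler_norml cos_geN1 cos_le1.
Qed.

Lemma cos_taylor2 x : `|1 - cos x| <= `|x| ^+ 2.
Proof.
apply: (@mvt_bound (fun x => 1 - cos x) sin `|x| x) => [y||y yx].
- by apply: is_derive_eq; rewrite /GRing.scale/=; ring.
- by rewrite cos0 subrr.
- exact: le_trans (normr_sin_le y) yx.
Qed.

Lemma sin_taylor3 x : `|sin x - x| <= `|x| ^+ 3.
Proof.
rewrite exprSr; apply: (@mvt_bound (fun x => sin x - x) (fun x => cos x - 1)) => [|y yx].
- by rewrite sin0 subrr.
- by rewrite distrC (le_trans (cos_taylor2 y))// lerXn2r ?nnegrE.
Qed.

Lemma cos_taylor4 x : `|cos x - 1 + x ^+ 2 / 2| <= `|x| ^+ 4.
Proof.
rewrite [`|x| ^+ 4]exprSr; apply: (@mvt_bound (fun x => cos x - 1 + x ^+ 2 / 2) (fun x => x - sin x) (`|x| ^+ 3) x) => [y||y yx].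
- by apply: is_derive_eq; rewrite /GRing.scale/=; field.
- by rewrite cos0 subrr expr0n/= mul0r addr0.
- by rewrite distrC (le_trans (sin_taylor3 y))// lerXn2r ?nnegrE.
Qed.

(** The lower bound comes from exp v >= 1 + v, the upper one from exp (- v) >= 1 - v. *)
Lemma expR_taylor2 (v : R) : 0 <= v <= 1 -> `|expR v * (1 - v) - 1| <= v ^+ 2.
Proof.
move=> /andP[v0 v1]; rewrite ler_norml; apply/andP; split.
  have h := ler_wpM2r (_ : 0 <= 1 - v) (expR_ge1Dx v).
  have {}h := h (eq_ind_r is_true v1 (subr_ge0 v 1)).
  by rewrite lerBrDr (le_trans _ h)//; lra.
rewrite (@le_trans _ _ 0) ?sqr_ge0// subr_le0.
have := expR_ge1Dx (- v); rewrite -/(1 - v) => h.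
by rewrite (le_trans (ler_wpM2l (expR_ge0 v) h))// -expRD subrr expR0.
Qed.

End taylor_bounds.

(** * Martingale structure of the score *)

Section csa_martingale.
Context {R : realType} (d N : nat) (r : R).
Local Notation point := 'rV[R]_d.
Variables (m : nat) (beta : 'rV[R]_N).
Context {disp : measure_display} {Omega : measurableType disp}.
Variables (P : probability Omega R) (X : nat -> {RV P >-> point}).
Hypotheses (b0 : positive beta) (hX : is_csa r m beta X).

Let P1 := probability_setT P.

(** Measurability with respect to the past is a factorisation through the first k points.
    Boundedness is included, so that adapted functions are admissible in
    [expectation_type_indic]. *)
Definition adapted k (f : Omega -> R) : Prop :=
  exists2 a : k.-tuple point -> R, bdm a & f = a \o first_points X k.

Lemma adapted_bdm k f : adapted k f -> bdm f.
Proof. by move=> [a ba ->]; exact: bdm_first_points. Qed.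

Lemma adapted_cst k (c : R) : adapted k (fun=> c).
Proof. by exists (fun=> c) => //; exact: bdm_cst. Qed.

Lemma adaptedD k f g : adapted k f -> adapted k g -> adapted k (fun w => f w + g w).
Proof.
move=> [a ba ->] [b bb ->]; exists (fun y => a y + b y) => //; exact: bdmD.
Qed.

Lemma adaptedM k f g : adapted k f -> adapted k g -> adapted k (fun w => f w * g w).
Proof.
move=> [a ba ->] [b bb ->]; exists (fun y => a y * b y) => //; exact: bdmM.
Qed.

Lemma adapted_sum k I (s : seq I) (F : I -> Omega -> R) :
  (forall i, adapted k (F i)) -> adapted k (fun w => \sum_(i <- s) F i w).
Proof.
move=> aF; elim: s => [|i s IH].
  by under eq_fun do rewrite big_nil; exact: adapted_cst.
by under eq_fun do rewrite big_cons; exact: adaptedD.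
Qed.

Lemma adapted_comp k f (h : R -> R) : adapted k f -> measurable_fun setT h ->
  (forall M, exists K, forall y, `|y| <= M -> `|h y| <= K) -> adapted k (fun w => h (f w)).
Proof.
move=> [a ba ->] mh hb; exists (fun y => h (a y)) => //; exact: bdm_comp.
Qed.

Lemma adapted_cos k f : adapted k f -> adapted k (fun w => cos (f w)).
Proof.
move=> af; apply: adapted_comp => //.
  by apply: continuous_measurable_fun; exact: continuous_cos.
by move=> M; exists 1 => y _; rewrite ler_norml cos_geN1 cos_le1.
Qed.

Lemma adapted_sin k f : adapted k f -> adapted k (fun w => sin (f w)).
Proof.
move=> af; apply: adapted_comp => //.
  by apply: continuous_measurable_fun; exact: continuous_sin.
by move=> M; exists 1 => y _; rewrite ler_norml sin_geN1 sin_le1.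
Qed.

Lemma adapted_expR k f : adapted k f -> adapted k (fun w => expR (f w)).
Proof.
move=> af; apply: adapted_comp => // M; exists (expR M) => y yM.
by rewrite ger0_norm ?expR_ge0// ler_expR (le_trans (ler_norm _)).
Qed.

Let proj i k (ik : (i <= k)%N) (y : k.-tuple point) : i.-tuple point :=
  [tuple tnth y (widen_ord ik l) | l < i].

Let measurable_proj i k (ik : (i <= k)%N) : measurable_fun setT (proj ik).
Proof.
apply/measurable_fun_tnthP => l.
rewrite (_ : _ \o _ = (fun y => tnth y (widen_ord ik l))); first exact: measurable_tnth.
by apply/funext => y /=; rewrite tnth_mktuple.
Qed.

Let proj_first_points i k (ik : (i <= k)%N) w :
  proj ik (first_points X k w) = first_points X i w.
Proof. by apply: eq_from_tnth => l; rewrite !tnth_mktuple. Qed.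

Lemma adaptedW i k f : (i <= k)%N -> adapted i f -> adapted k f.
Proof.
move=> ik [a [ma [M aM]] ->]; exists (a \o proj ik).
  split; first by apply: measurableT_comp => //; exact: measurable_proj.
  by exists M => y; exact: aM.
by apply/funext => w /=; rewrite proj_first_points.
Qed.

Local Notation I_ := (type_indic r m beta X).
Local Notation p_ k j w := (type_prob r m beta j (first_points X k w)).

Lemma adapted_type_prob k j : (j <= N)%N -> adapted k (fun w => p_ k j w).
Proof. by move=> jN; exists (fun y => type_prob r m beta j y) => //; exact: bdm_type_prob. Qed.

Lemma adapted_type_indic k j : adapted k.+1 (I_ k j).
Proof.
pose S := [set y : k.+1.-tuple point | 0 < total_rate r m beta (proj (leqnSn k) y) /\
  nu r (tnth y ord_max) (proj (leqnSn k) y) = j].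
exists (\1_S).
  apply: bdm_indic; apply: measurableI.
    have mt : measurable_fun setT (fun y : k.+1.-tuple point => total_rate r m beta (proj (leqnSn k) y)).
      apply: (measurableT_comp (@measurable_total_rate R d N r m beta k)).
      exact: measurable_proj.
    have := mt measurableT _ (measurable_itv `]0, +oo[); rewrite setTI.
    by congr measurable; apply/seteqP; split => y /=; rewrite in_itv/= andbT.
  have mp : measurable_fun setT (fun y : k.+1.-tuple point => (proj (leqnSn k) y, tnth y ord_max)).
    by apply: measurable_fun_pair; [exact: measurable_proj|exact: measurable_tnth].
  by have := mp measurableT _ (@measurable_nu_eq _ _ r k j); rewrite setTI.
apply/funext => w; rewrite /= /type_indic indicE; congr (nat_of_bool _)%:R.
have Sw : S (first_points X k.+1 w) <->
    0 < total_rate r m beta (first_points X k w) /\ nu r (X k w) (first_points X k w) = j.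
  by rewrite /S /mkset proj_first_points tnth_mktuple.
by apply/andP/idP => [[h /eqP h']|/set_mem /Sw [h h']]; [exact/mem_set/Sw|split => //; exact/eqP].
Qed.

Lemma expectation_adapted k j f : (j <= N)%N -> adapted k f ->
  \int[P]_w (f w * I_ k j w) = \int[P]_w (f w * p_ k j w).
Proof. by move=> jN [a ba ->]; exact: expectation_type_indic. Qed.

Variables (c : nat -> R) (C : R).
Hypothesis cC : forall j, `|c j| <= C.

Let C0 : 0 <= C. Proof. exact: le_trans (cC 0). Qed.

Definition drift k w := \sum_(j < N.+1) c j * p_ k j w.

Definition increment k w := \sum_(j < N.+1) c j * (I_ k j w - p_ k j w).

Definition score n w := \sum_(k < n) increment k w.

Definition cond_var k w := \sum_(j < N.+1) (c j - drift k w) ^+ 2 * p_ k j w.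

(** The indicator of not having jammed, written as a total probability and hence linear in the type
    probabilities. *)
Let act k w : R := \sum_(j < N.+1) p_ k j w.

Let active_cases k w :
  (act k w = 1 /\ 0 < total_rate r m beta (first_points X k w)) \/
  (act k w = 0 /\ (forall j, p_ k j w = 0 /\ I_ k j w = 0)).
Proof.
have [t0|t0] := boolP (0 < total_rate r m beta (first_points X k w)).
  by left; rewrite /act sum_type_prob.
right; have p0 j : p_ k j w = 0 /\ I_ k j w = 0.
  by rewrite /type_prob /type_indic (negbTE t0).
by split => //; rewrite /act big1// => j _; have [] := p0 j.
Qed.

Let adapted_act k : adapted k (act k).
Proof. by apply: adapted_sum => j; apply: adapted_type_prob; rewrite -ltnS. Qed.

Let adapted_drift k : adapted k (drift k).
Proof.
apply: adapted_sum => j; apply: adaptedM; first exact: adapted_cst.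
by apply: adapted_type_prob; rewrite -ltnS.
Qed.

Lemma adapted_increment k : adapted k.+1 (increment k).
Proof.
apply: adapted_sum => j; apply: adaptedM; first exact: adapted_cst.
apply: adaptedD; first exact: adapted_type_indic.
rewrite (_ : (fun w => _) = (fun w => -1 * p_ k j w)); last by apply/funext => w; rewrite mulN1r.
apply: adaptedM; first exact: adapted_cst.
by apply: (adaptedW (leqnSn k)); apply: adapted_type_prob; rewrite -ltnS.
Qed.

Lemma adapted_score n : adapted n (score n).
Proof.
apply: adapted_sum => k; exact: adaptedW (ltn_ord k) (adapted_increment k).
Qed.

Lemma drift_le k w : `|drift k w| <= C.
Proof.
have [[a1 _]|[_ p0]] := active_cases k w; last first.
  by rewrite /drift big1 ?normr0// => j _; have [-> _] := p0 j; rewrite mulr0.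
rewrite (le_trans (ler_norm_sum _ _ _))// -[C]mulr1 -a1 mulr_sumr ler_sum// => j _.
by rewrite normrM (ger0_norm (type_prob_ge0 _ _ _ _ b0)) ler_wpM2r ?type_prob_ge0.
Qed.

(** Three exclusive cases: the process has jammed and the increment is 0; the next point has j <= N
    neighbours and the increment is c_j minus the drift; or it has more than N, which leaves minus
    the drift. *)
Let phi_increment (phi : R -> R) k w : phi (increment k w) =
  (1 - act k w) * phi 0 + \sum_(j < N.+1) I_ k j w * phi (c j - drift k w) +
  (act k w - \sum_(j < N.+1) I_ k j w) * phi (- drift k w).
Proof.
have incE : increment k w = \sum_(j < N.+1) c j * I_ k j w - drift k w.
  by rewrite /drift -sumrB; apply: eq_bigr => j _; rewrite mulrBr.
have [[a1 t0]|[a0 p0]] := active_cases k w; last first.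
  rewrite a0 !big1//; [|by move=> j _; have [_ ->] := p0 j; rewrite ?mul0r..].
  rewrite subr0 mul1r subrr mul0r !addr0; congr phi.
  by rewrite /increment big1// => j _; have [-> ->] := p0 j; rewrite subrr mulr0.
rewrite incE a1 subrr mul0r add0r.
have IE j : I_ k j w = (nu r (X k w) (first_points X k w) == j)%:R.
  by rewrite /type_indic t0.
set l := nu r (X k w) (first_points X k w) in IE.
have [lN|lN] := ltnP l N.+1; last first.
  have I0 (j : 'I_N.+1) : I_ k j w = 0.
    by rewrite IE gtn_eqF// (leq_trans (ltn_ord j)).
  by rewrite !big1 => [|j _|j _|j _]; rewrite ?I0 ?mul0r ?mulr0// sub0r add0r subr0 mul1r.
have I1 (F : nat -> R) : \sum_(j < N.+1) F j * I_ k j w = F l.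
  rewrite (bigD1 (Ordinal lN))//= IE eqxx mulr1 big1 ?addr0// => j jl.
  rewrite IE (_ : (l == j) = false) ?mulr0//.
  by apply/negbTE; apply: contra jl => /eqP jl; exact/eqP/val_inj.
rewrite (I1 c); have := I1 (fun=> 1); under eq_bigr do rewrite mul1r.
move=> ->; rewrite subrr mul0r addr0 -(I1 (fun j => phi (c j - drift k w))).
by apply: eq_bigr => j _; rewrite mulrC.
Qed.

(* The event that the next point has more than N neighbours is handled by the last
   term of phi_increment, which has expectation 0. *)
Lemma expectation_phi_increment k f (phi : R -> R) : adapted k f ->
  measurable_fun setT phi -> (forall M, exists K, forall y, `|y| <= M -> `|phi y| <= K) ->
  \int[P]_w (f w * phi (increment k w)) =
  \int[P]_w (f w * ((1 - act k w) * phi 0 + \sum_(j < N.+1) phi (c j - drift k w) * p_ k j w)).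
Proof.
move=> af mphi bphi.
have jN (j : 'I_N.+1) : (j <= N)%N by rewrite -ltnS.
have aphi j : adapted k (fun w => phi (c j - drift k w)).
  apply: (adapted_comp (f := fun w => c j - drift k w)) => //.
  apply: adaptedD; first exact: adapted_cst.
  rewrite (_ : (fun w => _) = (fun w => -1 * drift k w)); last by apply/funext => w; rewrite mulN1r.
  by apply: adaptedM => //; exact: adapted_cst.
have aphi' : adapted k (fun w => phi (- drift k w)).
  apply: (adapted_comp (f := fun w => - drift k w)) => //.
  rewrite (_ : (fun w => _) = (fun w => -1 * drift k w)); last by apply/funext => w; rewrite mulN1r.
  by apply: adaptedM => //; exact: adapted_cst.
have bI j : bdm (I_ k j) by exact: bdm_type_indic.
have bp (j : 'I_N.+1) : bdm (fun w => p_ k j w) by exact: adapted_bdm (adapted_type_prob _ _).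
have bact : bdm (act k) := adapted_bdm (adapted_act k).
have bf := adapted_bdm af.
pose g w := f w * ((1 - act k w) * phi 0).
have bg : bdm g by apply: bdmM => //; apply: bdmM (bdm_cst _); apply: bdmB => //; exact: bdm_cst.
pose G (j : 'I_N.+1) w := f w * phi (c j - drift k w).
have aG j : adapted k (G j) by exact: adaptedM.
pose H w := f w * phi (- drift k w).
have aH : adapted k H by exact: adaptedM.
transitivity (\int[P]_w (g w + \sum_(j < N.+1) G j w * I_ k j w +
   \sum_(j < N.+1) (H w * p_ k j w - H w * I_ k j w))).
  apply: eq_Rintegral => w _; rewrite phi_increment 2!mulrDr.
  congr (_ + _ + _); first by rewrite mulr_sumr; apply: eq_bigr => j _; rewrite /G; ring.
  by rewrite sumrB -!mulr_sumr /H/act; ring.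
transitivity (\int[P]_w (g w + \sum_(j < N.+1) G j w * p_ k j w)); last first.
  by apply: eq_Rintegral => w _; rewrite mulrDr mulr_sumr; congr (_ + _); apply: eq_bigr => j _; rewrite mulrA.
have bGI : bdm (fun w => \sum_(j < N.+1) G j w * I_ k j w).
  by apply: bdm_sum => j _; apply: bdmM => //; exact: adapted_bdm.
have bGp : bdm (fun w => \sum_(j < N.+1) G j w * p_ k j w).
  by apply: bdm_sum => j _; apply: bdmM => //; exact: adapted_bdm.
have bH := adapted_bdm aH.
have bHI : bdm (fun w => \sum_(j < N.+1) (H w * p_ k j w - H w * I_ k j w)).
  by apply: bdm_sum => j _; apply: bdmB; exact: bdmM.
rewrite (ExD P1)//; last exact: bdmD.
rewrite (ExD P1 bg bGI) (ExD P1 bg bGp) -addrA; congr (_ + _).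
rewrite [X in _ + X](Ex_sum P1); last by move=> j _ /=; apply: bdmB; exact: bdmM.
rewrite [X in _ + X]big1 ?addr0 => [|j _].
  rewrite (Ex_sum P1); last by move=> j _ /=; apply: bdmM => //; exact: adapted_bdm.
  rewrite (Ex_sum P1); last by move=> j _ /=; apply: bdmM => //; exact: adapted_bdm.
  by apply: eq_bigr => j _; rewrite expectation_adapted.
rewrite (ExB P1); [|exact: bdmM|exact: bdmM].
by rewrite expectation_adapted// subrr.
Qed.

Lemma sum_increment_mean k w : \sum_(j < N.+1) (c j - drift k w) * p_ k j w = 0.
Proof.
have -> : \sum_(j < N.+1) (c j - drift k w) * p_ k j w = drift k w - drift k w * act k w.
  by rewrite /act mulr_sumr -sumrB; apply: eq_bigr => j _; rewrite mulrBl.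
have [[-> _]|[-> p0]] := active_cases k w; first by rewrite mulr1 subrr.
by rewrite mulr0 subr0 /drift big1// => j _; have [-> _] := p0 j; rewrite mulr0.
Qed.

Let act_le1 k w : 0 <= act k w <= 1.
Proof. by have [[-> _]|[-> _]] := active_cases k w; rewrite lexx ler01. Qed.

Let dev_le k w j : `|c j - drift k w| <= 2 * C.
Proof. by rewrite (le_trans (ler_normB _ _))// mulr_natl mulr2n lerD// drift_le. Qed.

Let wsum_le (F : nat -> R) (B : R) k w : 0 <= B -> (forall j, `|F j| <= B) ->
  `|\sum_(j < N.+1) F j * p_ k j w| <= B.
Proof.
move=> B0 FB; rewrite (le_trans (ler_norm_sum _ _ _))//.
rewrite (@le_trans _ _ (B * act k w))//.
  rewrite /act mulr_sumr ler_sum// => j _.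
  by rewrite normrM (ger0_norm (type_prob_ge0 _ _ _ _ b0)) ler_wpM2r ?type_prob_ge0.
by have /andP[_ a1] := act_le1 k w; rewrite ler_piMr.
Qed.

Lemma cond_var_ge0 k w : 0 <= cond_var k w.
Proof. by apply: sumr_ge0 => j _; rewrite mulr_ge0 ?sqr_ge0 ?type_prob_ge0. Qed.

Lemma cond_var_le k w : cond_var k w <= (2 * C) ^+ 2.
Proof.
rewrite (le_trans (ler_norm _))//; apply: (wsum_le (F := fun j => (c j - drift k w) ^+ 2)).
  exact: sqr_ge0.
by move=> j; rewrite normrX lerXn2r ?nnegrE ?mulr_ge0.
Qed.

Lemma adapted_cond_var k : adapted k (cond_var k).
Proof.
apply: adapted_sum => j; apply: adaptedM; last first.
  by apply: adapted_type_prob; rewrite -ltnS.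
have ad : adapted k (fun w => c j - drift k w).
  apply: adaptedD; first exact: adapted_cst.
  rewrite (_ : (fun w => _) = (fun w => -1 * drift k w)); last by apply/funext => w; rewrite mulN1r.
  by apply: adaptedM => //; exact: adapted_cst.
by under eq_fun do rewrite expr2; exact: adaptedM.
Qed.

(** Orthogonality of martingale differences: conditioning kills the cross term, and every
    conditional variance is at most (2 C)^2. *)
Lemma expectation_score_sq n : \int[P]_w (score n w ^+ 2) <= n%:R * (2 * C) ^+ 2.
Proof.
elim: n => [|n IH].
  under eq_Rintegral do rewrite /score big_ord0 expr0n/=.
  by rewrite (Ex_cst P1) mul0r.
have aS := adapted_score n; have bS := adapted_bdm aS.
have aD := adapted_increment n; have bD := adapted_bdm aD.
have sq_bnd M : exists K : R, forall y : R, `|y| <= M -> `|y ^+ 2| <= K.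
  by exists (M ^+ 2) => y yM; rewrite normrX lerXn2r ?nnegrE// (le_trans _ yM).
have E1 : \int[P]_w (score n w * increment n w) = 0.
  rewrite (expectation_phi_increment (phi := id) aS)//; last by move=> M; exists M.
  under eq_Rintegral do rewrite mulr0 add0r sum_increment_mean mulr0.
  by rewrite (Ex_cst P1).
have E2 : \int[P]_w (increment n w ^+ 2) <= (2 * C) ^+ 2.
  rewrite (_ : \int[P]_w _ = \int[P]_w cond_var n w); last first.
    transitivity (\int[P]_w (1 * increment n w ^+ 2)).
      by apply: eq_Rintegral => w _; rewrite mul1r.
    rewrite (expectation_phi_increment (phi := fun y => y ^+ 2) (adapted_cst n 1) _ sq_bnd).
      by apply: eq_Rintegral => w _; rewrite mul1r expr0n/= mulr0 add0r.
    exact: exprn_measurable.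
  rewrite -[leRHS](Ex_cst P1); apply: (le_Ex P1).
  - exact: adapted_bdm (adapted_cond_var n).
  - exact: bdm_cst.
  - by move=> w; exact: cond_var_le.
under eq_Rintegral do rewrite /score big_ord_recr/= -/(score n _) sqrrD.
rewrite (ExD P1); [|apply: bdmD; [exact: bdmX|]|exact: bdmX]; last first.
  under eq_fun do rewrite -mulr_natl; apply: bdmM (bdm_cst _) (bdmM _ _) => //.
rewrite (ExD P1); [|exact: bdmX|]; last first.
  under eq_fun do rewrite -mulr_natl; apply: bdmM (bdm_cst _) (bdmM _ _) => //.
under [X in _ + X + _]eq_Rintegral do rewrite -mulr_natl.
rewrite (ExZ P1) ?E1 ?mulr0 ?addr0; last exact: bdmM.
by rewrite -natr1 mulrDl mul1r lerD.
Qed.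

(** A telescoping sum. With h = 2 |t| C, which bounds |t (c_j - drift)|, one more step changes the
    compensated expectation by O(h^3): the factor [expR (v k)] is determined by the first k points
    and cancels the quadratic term of the cosine, while the linear term of the sine has conditional
    mean 0. For t of order m^(-1/2) and n of order m the total n h^3 tends to 0. *)
Lemma characteristic_score n (t b : R) : 2 * `|t| * C <= 1 ->
  `|\int[P]_w (cos (t * score n w + b) * expR (t ^+ 2 / 2 * \sum_(k < n) cond_var k w)) - cos b|
    <= n%:R * (5 * (2 * `|t| * C) ^+ 3 * expR (n%:R * ((2 * `|t| * C) ^+ 2 / 2))).
Proof.
set h := 2 * `|t| * C => h1.
have h0 : 0 <= h by rewrite mulr_ge0// mulr_ge0.
pose v k w := t ^+ 2 / 2 * cond_var k w.
pose A n w := \sum_(k < n) v k w.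
pose M n w := cos (t * score n w + b) * expR (A n w).
have v0 k w : 0 <= v k w by rewrite mulr_ge0 ?cond_var_ge0// divr_ge0 ?sqr_ge0.
have vh k w : v k w <= h ^+ 2 / 2.
  rewrite /v (_ : h ^+ 2 / 2 = t ^+ 2 / 2 * (2 * C) ^+ 2).
    by rewrite ler_wpM2l ?cond_var_le// divr_ge0 ?sqr_ge0.
  by rewrite /h 2!exprMn real_normK ?num_real// exprMn; field.
have h21 : h ^+ 2 <= 1 by rewrite expr_le1.
have ev2 k w : expR (v k w) <= 2.
  have e1 := expR_ge1Dx (- v k w); have e2 := expRxMexpNx_1 (v k w).
  have e3 := expR_ge0 (v k w).
  have vle : v k w <= 1 / 2 by rewrite (le_trans (vh k w)) ?ler_wpM2r.
  have : expR (v k w) * (1 / 2) <= 1.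
    apply: (@le_trans _ _ (expR (v k w) * expR (- v k w))); last by rewrite e2.
    by rewrite ler_wpM2l//; lra.
  lra.
have av k : adapted k (v k).
  by apply: adaptedM; [exact: adapted_cst|exact: adapted_cond_var].
have aA k : adapted k (A k).
  by apply: adapted_sum => i; apply: adaptedW (ltnW (ltn_ord i)) (av _).
have aarg k : adapted k (fun w => t * score k w + b).
  apply: adaptedD; last exact: adapted_cst.
  by apply: adaptedM; [exact: adapted_cst|exact: adapted_score].
have aM k : adapted k (M k).
  by apply: adaptedM; [exact: adapted_cos|exact: adapted_expR].
have bnd1 k w : `|expR (v k w) * ((1 - act k w) * 1 +
     \sum_(j < N.+1) cos (t * (c j - drift k w)) * p_ k j w) - 1| <= 3 * h ^+ 3.
  pose x j := t * (c j - drift k w).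
  have xh j : `|x j| <= h by rewrite /x normrM /h mulrAC [2 * C * _]mulrC ler_wpM2l.
  have -> : (1 - act k w) * 1 + \sum_(j < N.+1) cos (t * (c j - drift k w)) * p_ k j w =
     1 - v k w + \sum_(j < N.+1) (cos (x j) - 1 + x j ^+ 2 / 2) * p_ k j w.
    have gen (q y : nat -> R) : 1 - \sum_(j < N.+1) q j + \sum_(j < N.+1) cos (y j) * q j =
        1 - \sum_(j < N.+1) y j ^+ 2 / 2 * q j + \sum_(j < N.+1) (cos (y j) - 1 + y j ^+ 2 / 2) * q j.
      rewrite -!addrA; congr (_ + _); rewrite -!sumrN -!big_split/=.
      by apply: eq_bigr => j _; ring.
    rewrite mulr1 [LHS](gen (fun j => p_ k j w) x); congr (_ - _ + _).
    by rewrite /v /cond_var mulr_sumr; apply: eq_bigr => j _; rewrite /x exprMn; ring.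
  have s4 : `|\sum_(j < N.+1) (cos (x j) - 1 + x j ^+ 2 / 2) * p_ k j w| <= h ^+ 4.
    apply: (wsum_le (F := fun j => cos (x j) - 1 + x j ^+ 2 / 2)); first exact: exprn_ge0.
    by move=> j; rewrite (le_trans (cos_taylor4 _))// lerXn2r ?nnegrE.
  rewrite mulrDr addrAC (le_trans (ler_normD _ _))//.
  have v1 : v k w <= 1 by rewrite (le_trans (vh k w))//; lra.
  have e1 := expR_taylor2 (introT andP (conj (v0 k w) v1)).
  have v2 : v k w ^+ 2 <= h ^+ 3.
    rewrite (@le_trans _ _ ((h ^+ 2 / 2) ^+ 2))//.
      by rewrite lerXn2r ?nnegrE// divr_ge0 ?sqr_ge0.
    have h3 : 0 <= h ^+ 3 by exact: exprn_ge0.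
    rewrite (_ : (h ^+ 2 / 2) ^+ 2 = h ^+ 3 * (h / 4)); last by field.
    by rewrite ler_piMr//; lra.
  have h4 : h ^+ 4 <= h ^+ 3 by rewrite exprSr ler_piMr ?exprn_ge0.
  rewrite normrM (ger0_norm (expR_ge0 _)).
  have : expR (v k w) * `|\sum_(j < N.+1) (cos (x j) - 1 + x j ^+ 2 / 2) * p_ k j w| <= 2 * h ^+ 3.
    by rewrite ler_pM ?expR_ge0// (le_trans s4).
  by move: e1 v2; lra.
(* [sum_increment_mean] allows t (c_j - drift) to be subtracted from the sine, leaving its third
   order remainder. *)
have bnd2 k w : `|\sum_(j < N.+1) sin (t * (c j - drift k w)) * p_ k j w| <= h ^+ 3.
  have -> : \sum_(j < N.+1) sin (t * (c j - drift k w)) * p_ k j w =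
    \sum_(j < N.+1) (sin (t * (c j - drift k w)) - t * (c j - drift k w)) * p_ k j w.
    apply/eqP; rewrite -subr_eq0 -sumrB; apply/eqP.
    transitivity (t * \sum_(j < N.+1) (c j - drift k w) * p_ k j w); last first.
      by rewrite sum_increment_mean mulr0.
    by rewrite mulr_sumr; apply: eq_bigr => j _; ring.
  apply: (wsum_le (F := fun j => sin (t * (c j - drift k w)) - t * (c j - drift k w))).
    exact: exprn_ge0.
  move=> j; rewrite (le_trans (sin_taylor3 _))// lerXn2r ?nnegrE//.
  by rewrite normrM /h mulrAC [2 * C * _]mulrC ler_wpM2l.
have eA k w : (k <= n)%N -> expR (A k w) <= expR (n%:R * (h ^+ 2 / 2)).
  move=> kn; rewrite ler_expR (@le_trans _ _ (\sum_(i < k) h ^+ 2 / 2))//.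
    by apply: ler_sum => i _; exact: vh.
  by rewrite sumr_const card_ord -[leLHS]mulr_natl ler_wpM2r ?ler_nat// divr_ge0 ?sqr_ge0.
have step k : (k < n)%N -> `|\int[P]_w M k.+1 w - \int[P]_w M k w| <=
    5 * h ^+ 3 * expR (n%:R * (h ^+ 2 / 2)).
  move=> kn.
  (* Addition formula for the cosine at step k + 1: [f1] and [f2] depend on the first k points only,
     since the conditional variance of step k does. *)
  pose f1 w := cos (t * score k w + b) * expR (A k w + v k w).
  pose f2 w := sin (t * score k w + b) * expR (A k w + v k w).
  have ae : adapted k (fun w => expR (A k w + v k w)) by apply: adapted_expR; exact: adaptedD.
  have af1 : adapted k f1 by apply: adaptedM => //; exact: adapted_cos.
  have af2 : adapted k f2 by apply: adaptedM => //; exact: adapted_sin.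
  have bD := (adapted_bdm (adapted_increment k)).1.
  have mtx : measurable_fun setT (fun x : R => t * x) by exact: measurable_funM.
  have bc : bdm (fun w => cos (t * increment k w)) by apply: bdm_cos; exact: measurableT_comp bD.
  have bs : bdm (fun w => sin (t * increment k w)) by apply: bdm_sin; exact: measurableT_comp bD.
  have -> : \int[P]_w M k.+1 w =
      \int[P]_w (f1 w * cos (t * increment k w)) - \int[P]_w (f2 w * sin (t * increment k w)).
    rewrite -(ExB P1); [|exact: bdmM (adapted_bdm af1) bc|exact: bdmM (adapted_bdm af2) bs].
    apply: eq_Rintegral => w _.
    rewrite /M /A /score !big_ord_recr/= -/(score k w) -/(A k w).
    by rewrite mulrDr addrAC cosD /f1 /f2; ring.
  rewrite (expectation_phi_increment (phi := fun x => cos (t * x)) af1); first last.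
  - by move=> ?; exists 1 => y _; rewrite ler_norml cos_geN1 cos_le1.
  - by apply: (proj1 (bdm_cos _)).
  rewrite (expectation_phi_increment (phi := fun x => sin (t * x)) af2); first last.
  - by move=> ?; exists 1 => y _; rewrite ler_norml sin_geN1 sin_le1.
  - by apply: (proj1 (bdm_sin _)).
  rewrite !mulr0 cos0 sin0.
  have ax j : adapted k (fun w => t * (c j - drift k w)).
    apply: adaptedM; first exact: adapted_cst.
    apply: adaptedD; first exact: adapted_cst.
    rewrite (_ : (fun w => _) = (fun w => -1 * drift k w)); last by apply/funext => w; rewrite mulN1r.
    by apply: adaptedM => //; exact: adapted_cst.
  have b1 : bdm (fun w => (1 - act k w) * 1 + \sum_(j < N.+1) cos (t * (c j - drift k w)) * p_ k j w).
    apply: bdmD.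
      apply: bdmM (bdm_cst _); apply: bdmB; first exact: bdm_cst.
      exact: adapted_bdm (adapted_act k).
    apply: bdm_sum => j _; apply: bdmM; first exact: adapted_bdm (adapted_cos (ax j)).
    by apply: adapted_bdm (adapted_type_prob _ _); rewrite -ltnS.
  have b2 : bdm (fun w => (1 - act k w) * 0 + \sum_(j < N.+1) sin (t * (c j - drift k w)) * p_ k j w).
    apply: bdmD.
      apply: bdmM (bdm_cst _); apply: bdmB; first exact: bdm_cst.
      exact: adapted_bdm (adapted_act k).
    apply: bdm_sum => j _; apply: bdmM; first exact: adapted_bdm (adapted_sin (ax j)).
    by apply: adapted_bdm (adapted_type_prob _ _); rewrite -ltnS.
  have bf1 := adapted_bdm af1; have bf2 := adapted_bdm af2; have bM := adapted_bdm (aM k).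
  rewrite -(ExB P1); [|exact: bdmM|exact: bdmM].
  rewrite -(ExB P1) => [||//]; last by apply: bdmB; exact: bdmM.
  rewrite -[leRHS](Ex_cst P1); apply: (normr_Ex_le P1).
  - by apply: bdmB => //; apply: bdmB; exact: bdmM.
  - exact: bdm_cst.
  move=> w; rewrite mulr0 add0r.
  have -> : f1 w * ((1 - act k w) * 1 + \sum_(j < N.+1) cos (t * (c j - drift k w)) * p_ k j w) -
      f2 w * \sum_(j < N.+1) sin (t * (c j - drift k w)) * p_ k j w - M k w =
    expR (A k w) * (cos (t * score k w + b) * (expR (v k w) * ((1 - act k w) * 1 +
       \sum_(j < N.+1) cos (t * (c j - drift k w)) * p_ k j w) - 1)
     - sin (t * score k w + b) * (expR (v k w) * \sum_(j < N.+1) sin (t * (c j - drift k w)) * p_ k j w)).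
    by rewrite /f1 /f2 /M expRD; ring.
  rewrite normrM (ger0_norm (expR_ge0 _)) mulrC ler_pM ?expR_ge0 ?eA ?(ltnW kn)//.
  rewrite (le_trans (ler_normB _ _))// (_ : 5 * h ^+ 3 = 3 * h ^+ 3 + 2 * h ^+ 3); last by ring.
  rewrite !normrM lerD//.
    rewrite (le_trans _ (bnd1 k w))// ler_piMl// ler_norml cos_geN1 cos_le1//.
  rewrite (@le_trans _ _ (1 * (2 * h ^+ 3)))//; last by rewrite mul1r.
  rewrite ler_pM ?mulr_ge0//; first by rewrite ler_norml sin_geN1 sin_le1.
  by rewrite (ger0_norm (expR_ge0 _)) ler_pM ?expR_ge0.
have M0 : \int[P]_w M 0%N w = cos b.
  rewrite -[RHS](Ex_cst P1); apply: eq_Rintegral => w _.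
  by rewrite /M /A /score !big_ord0 mulr0 add0r expR0 mulr1.
have tele k : (k <= n)%N -> `|\int[P]_w M k w - cos b| <=
    k%:R * (5 * h ^+ 3 * expR (n%:R * (h ^+ 2 / 2))).
  elim: k => [_|k IH kn]; first by rewrite M0 subrr normr0 mul0r.
  rewrite (_ : _ - cos b = (\int[P]_w M k w - cos b) + (\int[P]_w M k.+1 w - \int[P]_w M k w)); last by ring.
  rewrite (le_trans (ler_normD _ _))// -natr1 mulrDl mul1r lerD//.
    exact: IH (ltnW kn).
  exact: step.
rewrite (_ : (fun w => _) = M n); first exact: tele.
by apply/funext => w; rewrite /M; congr (_ * expR _); rewrite /A mulr_sumr.
Qed.

End csa_martingale.

(** * Law of large numbers *)

Section step_functions.
Context {R : realType}.

Lemma measurable_truncn_eq (k : nat) : measurable [set x : R | Num.truncn x = k].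
Proof.
case: k => [|k].
  rewrite (_ : [set _ | _] = `]-oo, 1[%classic) //.
  apply/seteqP; split => x /=; rewrite in_itv/= ltNge -truncn_gt0; first by move=> ->.
  by rewrite lt0n negbK => /eqP.
rewrite (_ : [set _ | _] = `[k.+1%:R, k.+2%:R[%classic) //.
apply/seteqP; split => x /=; rewrite in_itv/=; last exact: truncn_def.
move=> xk; rewrite -{1}xk -[in k.+2]xk; apply: truncn_itv.
by apply: le_trans ler01 _; rewrite -truncn_gt0 xk.
Qed.

(** A function of the integer part is constant on countably many measurable pieces, whatever [F]
    is. *)
Lemma measurable_step (F : nat -> R) (a : R) :
  measurable_fun setT (fun x : R => F (Num.truncn (x * a))).
Proof.
move=> _ Y mY; rewrite setTI.
rewrite (_ : _ @^-1` Y = \bigcup_(k in F @^-1` Y) [set x : R | Num.truncn (x * a) = k]).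
  apply: bigcup_measurable => k _.
  have mx : measurable_fun setT (fun x : R => x * a) by exact: measurable_funM.
  by have := mx measurableT _ (measurable_truncn_eq k); rewrite setTI.
apply/seteqP; split => x /=; last by move=> [k /= Fk ->].
by move=> Fx; exists (Num.truncn (x * a)).
Qed.

(** These are the deterministic sequences along which the convergence of the areas is invoked. *)
Lemma cvg_truncn_ratio (a : R) : 0 <= a ->
  (Num.truncn (a * m%:R))%:R / m%:R @[m --> \oo] --> a.
Proof.
move=> a0; apply/cvgrPdist_le => e e0; near=> m.
have m0 : 0 < m%:R :> R by rewrite ltr0n; near: m; exact: nbhs_infty_gt.
have /andP[h1 h2] := @truncn_itv R (a * m%:R) (mulr_ge0 a0 (ltW m0)).
have h3 : m%:R^-1 <= e.
  rewrite -[leRHS]invrK lef_pV2 ?posrE ?invr_gt0//.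
  by near: m; exact: nbhs_infty_ger.
rewrite ger0_norm; last by rewrite subr_ge0 ler_pdivrMr.
rewrite (le_trans _ h3)// lerBlDr -(ler_pM2r m0) mulrDl mulVf ?gt_eqF// divfK ?gt_eqF//.
by rewrite addrC natr1 ltW.
Unshelve. all: end_near. Qed.

Lemma sum_dist_le (F : nat -> R) (B : R) (a b : nat) : (forall k, `|F k| <= B) ->
  `|\sum_(k < a) F k - \sum_(k < b) F k| <= B * `|a%:R - b%:R|.
Proof.
move=> FB; wlog ab : a b / (a <= b)%N => [hw|].
  have [/hw//|/ltnW/hw] := leqP a b.
  by rewrite distrC [in X in _ -> X]distrC; move=> h; rewrite [leRHS](_ : _ = B * `|b%:R - a%:R|)// distrC.
rewrite -!(big_mkord predT F) distrC (big_cat_nat _ ab)//= [X in `|X - _|]addrC addrK.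
rewrite distrC -natrB// normr_nat.
rewrite (le_trans (ler_norm_sum _ _ _))// (@le_trans _ _ (\sum_(a <= k < b) B))//.
  by apply: ler_sum => k _; exact: FB.
by rewrite sumr_const_nat mulr_natr.
Qed.

End step_functions.

Section law_of_large_numbers.
Context {R : realType} {disp : nat -> measure_display}
  {Omega : forall m, measurableType (disp m)}
  (P : forall m, probability (Omega m) R).
Variables (psi : forall m, nat -> Omega m -> R) (B : R) (c : R -> R) (mu : R).
Hypothesis bpsi : forall m k, bdm (@psi m k).
Hypothesis psiB : forall m k w, `|@psi m k w| <= B.
Hypothesis mu0 : 0 < mu.
Hypothesis cB : forall l, 0 < l < mu -> `|c l| <= B.
Hypothesis cvg_psi : forall l, 0 < l < mu ->
  \int[P m]_w `|psi (Num.truncn (l * m%:R)) w - c l| @[m --> \oo] --> 0.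
Variable ell : nat -> nat.
Hypothesis hell : (ell m)%:R / m%:R @[m --> \oo] --> mu.

Let PT m := probability_setT (P m).
(** The level l is made uniform on [0, mu], so that integrals over levels obey the same rules as
    expectations. *)
Let nu : probability _ R := uniform_prob mu0.
Let nuT : nu setT = 1%E := probability_setT nu.
Let D : set R := `]0, mu[%classic.
Let c' := c \_ D.

Let B0 : 0 <= B.
Proof.
have h : 0 < mu / 2 < mu by rewrite divr_gt0//= ltr_pdivrMr// ltr_pMr// ltr1n.
exact: le_trans (normr_ge0 _) (cB h).
Qed.

Let c'B l : `|c' l| <= B.
Proof.
rewrite /c' patchE; case: ifPn => [/set_mem|_]; last by rewrite normr0.
by rewrite /D /= in_itv/=; exact: cB.
Qed.

Let g m (l : R) := \int[P m]_w psi (Num.truncn (l * m%:R)) w.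
Let h m (l : R) := \int[P m]_w (psi (Num.truncn (l * m%:R)) w ^+ 2).

Let gB m l : `|g m l| <= B.
Proof.
rewrite -[leRHS](Ex_cst (PT m)); apply: (normr_Ex_le (PT m)) => //; exact: bdm_cst.
Qed.

Let hB m l : `|h m l| <= B ^+ 2.
Proof.
rewrite -[leRHS](Ex_cst (PT m)); apply: (normr_Ex_le (PT m)) => //.
- exact: bdmX.
- exact: bdm_cst.
- by move=> w; rewrite normrX lerXn2r ?nnegrE.
Qed.

Let bg m : bdm (g m).
Proof.
split; last by exists B.
exact: (measurable_step (fun k => \int[P m]_w psi k w)).
Qed.

Let bh m : bdm (h m).
Proof.
split; last by exists (B ^+ 2).
exact: (measurable_step (fun k => \int[P m]_w (psi k w ^+ 2))).
Qed.

Let bD : bdm (\1_D : R -> R). Proof. by apply: bdm_indic; exact: measurable_itv. Qed.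

(** The limit [c] inherits measurability in l from the step functions [g m], whose pointwise limit
    it is on ]0, mu[. *)
Let bc' : bdm c'.
Proof.
split; last by exists B.
apply: (@measurable_fun_cvg _ _ _ _ (fun m l => \1_D l * g m l)) => [m|l _].
  exact: (bdmM bD (bg m)).1.
rewrite /c' patchE indicE; case: ifPn => [/set_mem|_]; last first.
  by under eq_fun do rewrite mul0r; exact: cvg_cst.
rewrite /D /= in_itv/= => lD; under eq_fun do rewrite mul1r.
apply/subr_cvg0; apply: norm_cvg0.
apply: (@squeeze_cvgr _ _ _ _ (cst 0) _ _ _ _ _ (cvg_psi lD)); last exact: cvg_cst.
apply: nearW => m; rewrite normr_ge0/=.
rewrite -{1}(Ex_cst (PT m) (c l)) /g -(ExB (PT m))//; last exact: bdm_cst.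
by apply: (normr_Ex (PT m)); apply: bdmB => //; exact: bdm_cst.
Qed.

(** Mean square distance from [psi] to its limit at level l. Expanded into the moments [g] and [h]
    it is measurable in l, and no joint measurability in level and trajectory enters. *)
Let e m l := \1_D l * (h m l - 2 * c' l * g m l + c' l ^+ 2).

Let be m : bdm (e m).
Proof.
apply: bdmM => //; apply: bdmD; last exact: bdmX.
by apply: bdmB => //; apply: bdmM => //; apply: bdmM => //; exact: bdm_cst.
Qed.

Let eE m l : 0 < l < mu -> e m l = \int[P m]_w (psi (Num.truncn (l * m%:R)) w - c l) ^+ 2.
Proof.
move=> lD; have lD' : l \in D by rewrite inE /D/= in_itv.
rewrite /e indicE lD' mul1r /c' patchE lD' /h /g.
rewrite -[X in _ + X](Ex_cst (PT m)) -(ExZ (PT m))//.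
rewrite -(ExB (PT m)); [|exact: bdmX|by apply: bdmM => //; exact: bdm_cst].
rewrite -(ExD (PT m)); [|by apply: bdmB; [exact: bdmX|apply: bdmM => //; exact: bdm_cst]|exact: bdm_cst].
by apply: eq_Rintegral => w _; ring.
Qed.

Let e0 m l : 0 <= e m l.
Proof.
have [lD|lD] := pselect (0 < l < mu).
  by rewrite eE//; apply: Rintegral_ge0 => w _; exact: sqr_ge0.
by rewrite /e indicE memNset ?mul0r// /D /= in_itv.
Qed.

(** At each level, convergence in mean of bounded variables gives mean square convergence; dominated
    convergence handles the integral over the levels. *)
Let cvg_e : \int[nu]_l e m l @[m --> \oo] --> 0.
Proof.
have bnd m l : `|e m l| <= 2 * B * (2 * B).
  have [lD|lD] := pselect (0 < l < mu); last first.
    by rewrite /e indicE memNset ?mul0r ?normr0 ?mulr_ge0// /D /= in_itv.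
  rewrite eE// -[leRHS](Ex_cst (PT m)); apply: (normr_Ex_le (PT m)).
  - by apply: bdmX; apply: bdmB => //; exact: bdm_cst.
  - exact: bdm_cst.
  - move=> w; rewrite normrX expr2 ler_pM//.
      by rewrite (le_trans (ler_normB _ _))// mulr_natl mulr2n lerD// cB.
    by rewrite (le_trans (ler_normB _ _))// mulr_natl mulr2n lerD// cB.
have [] := @dominated_convergence _ _ R nu setT measurableT
  (fun m => EFin \o e m) (cst 0%E) (cst (2 * B * (2 * B))%:E).
- by move=> m; apply/measurable_EFinP; exact: (be m).1.
- by [].
- apply: aeW => l _; apply: cvg_EFin; first exact: nearW.
  have [lD|lD] := pselect (0 < l < mu); last first.
    rewrite (_ : (fun m => _) = cst 0); first exact: cvg_cst.
    by apply/funext => m /=; rewrite /e indicE memNset ?mul0r// /D /= in_itv.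
  have cv : 2 * B * \int[P m]_w `|psi (Num.truncn (l * m%:R)) w - c l| @[m --> \oo] --> 0.
    by rewrite -[X in _ --> X](mulr0 (2 * B)); apply: cvgMr; exact: cvg_psi.
  apply: (@squeeze_cvgr _ _ _ _ (cst 0) _ _ _ _ _ cv); last exact: cvg_cst.
  apply: nearW => m /=; rewrite e0/= eE//.
  have b1 : bdm (fun w : Omega m => `|psi (Num.truncn (l * m%:R)) w - c l|).
    by apply: bdm_norm; apply: bdmB => //; exact: bdm_cst.
  rewrite -(ExZ (PT m))//; apply: (le_Ex (PT m)).
  - by apply: bdmX; apply: bdmB => //; exact: bdm_cst.
  - by apply: bdmM => //; exact: bdm_cst.
  - move=> w; rewrite -real_normK ?num_real// expr2 ler_wpM2r//.
    by rewrite (le_trans (ler_normB _ _))// mulr_natl mulr2n lerD// cB.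
- exact: (bdm_integrable nuT (bdm_cst _)).
- by apply: aeW => l m _ /=; rewrite lee_fin.
move=> _ _ /=; rewrite integral0 => /fine_cvg; exact.
Qed.

(** The levels l with floor (l m) = k, up to an endpoint. *)
Let cell m k : set R := `]k%:R / m%:R, k.+1%:R / m%:R[%classic.

Let cell_truncn m k l : (0 < m)%N -> cell m k l -> Num.truncn (l * m%:R) = k.
Proof.
move=> m0; rewrite /cell /= in_itv/= => /andP[l1 l2]; apply: truncn_def.
by rewrite -ler_pdivrMr ?ltr0n// (ltW l1)/= -ltr_pdivlMr ?ltr0n.
Qed.

Let nu_cell m k : (0 < m)%N -> k.+1%:R / m%:R <= mu ->
  \int[nu]_l \1_(cell m k) l = (m%:R * mu)^-1.
Proof.
move=> m0 km; have mr0 : 0 < m%:R :> R by rewrite ltr0n.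
rewrite Ex_indic//; last exact: measurable_itv.
rewrite /nu/= /uniform_prob.
transitivity (fine (\int[lebesgue_measure]_(x in cell m k) (mu^-1)%:E)%E).
  congr fine; apply: eq_integral => x; rewrite inE /cell/= in_itv/= => /andP[x1 x2].
  rewrite /uniform_pdf subr0 ifT//; apply/andP; split.
    by rewrite (le_trans _ (ltW x1))// divr_ge0.
  by rewrite (le_trans (ltW x2)).
have lE : lebesgue_measure (cell m k) = (m%:R^-1)%:E.
  rewrite /cell lebesgue_measure_itv/= lte_fin ifT; last first.
    by rewrite ltr_pM2r ?invr_gt0// ltr_nat.
  by rewrite -EFinB -mulrBl -natr1 [_ + 1]addrC addrK mul1r.
rewrite integral_cst; last exact: measurable_itv.
by rewrite -[X in (_ * X)%E]/(lebesgue_measure (cell m k)) lE -EFinM/= invfM mulrC.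
Qed.

(** The inequality |x| <= del + x^2 / del trades the absolute error on each cell for a mean square
    error that the moments control. The last term is the part of [0, mu] beyond n / m, which no cell
    covers. *)
Let main_bound m n (del : R) : (0 < m)%N -> n%:R / m%:R <= mu -> 0 < del ->
  \int[P m]_w `|m%:R^-1 * \sum_(k < n) psi k w - mu * \int[nu]_l c' l| <=
  mu * del + mu / del * \int[nu]_l e m l + B * (mu - n%:R / m%:R).
Proof.
move=> m0 nm del0; have mr0 : 0 < m%:R :> R by rewrite ltr0n.
pose I1 k : R -> R := \1_(cell m k).
have bI k : bdm (I1 k) by apply: bdm_indic; exact: measurable_itv.
have nk k : (k < n)%N -> \int[nu]_l I1 k l = (m%:R * mu)^-1.
  move=> kn; apply: nu_cell => //; apply: le_trans nm.
  by rewrite ler_pM2r ?invr_gt0// ler_nat.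
(* Mass of one cell under the uniform law. *)
pose N := (m%:R * mu)^-1.
have muN : m%:R^-1 = mu * N by rewrite /N; field; rewrite !gt_eqF.
have N0 : 0 <= N by rewrite invr_ge0 mulr_ge0 ?ltW.
have nN : n%:R * N <= 1.
  by rewrite ler_pdivrMr ?mulr_gt0// mul1r mulrC -ler_pdivrMr// mulrC.
have cellD k l : (k < n)%N -> cell m k l -> 0 < l < mu.
  move=> kn; rewrite /cell/= in_itv/= => /andP[l1 l2].
  rewrite (le_lt_trans _ l1) ?divr_ge0//=; apply: (lt_le_trans l2); apply: le_trans nm.
  by rewrite ler_pM2r ?invr_gt0// ler_nat.
(* A level lies in at most one cell, the one indexed by its own integer part. *)
have disj l (F : nat -> R) : (forall k, 0 <= F k) ->
    \sum_(k < n) I1 k l * F k <= F (Num.truncn (l * m%:R)).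
  move=> F0; set j := Num.truncn _.
  have I1j k : I1 k l != 0 -> k = j.
    rewrite /I1 indicE; case: (boolP (l \in _)) => [/set_mem lc _|]; last by rewrite eqxx.
    by rewrite /j (cell_truncn m0 lc).
  have [jn|jn] := ltnP j n.
    rewrite (bigD1 (Ordinal jn))//= [X in _ + X]big1 ?addr0 => [|k kj].
      by rewrite /I1 indicE; case: (_ \in _); rewrite ?mul1r ?mul0r.
    have [->|/I1j kj'] := eqVneq (I1 k l) 0; first by rewrite mul0r.
    by case/eqP: kj; exact/val_inj.
  rewrite big1// => k _; have [->|/I1j kj'] := eqVneq (I1 k l) 0; first by rewrite mul0r.
  by have := ltn_ord k; rewrite kj' ltnNge jn.
have bIc k : bdm (fun l => I1 k l * c' l) by exact: bdmM.
have bIcc k : bdm (fun l => I1 k l * c' l ^+ 2) by apply: bdmM => //; exact: bdmX.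
pose Ik k := \int[nu]_l (I1 k l * c' l).
pose IIk k := \int[nu]_l (I1 k l * c' l ^+ 2).
(* The bound del + (psi - c)^2 / del integrated over cell k, as a polynomial in psi: [s1] and [s2]
   stand for psi and its square, and then for their expectations. *)
pose quad (k : nat) (s2 s1 : R) := del * N + (s2 * N - 2 * s1 * Ik k + IIk k) / del.
have quadE k (s2 s1 : R) : (k < n)%N -> quad k s2 s1 =
    \int[nu]_l (I1 k l * (del + (s2 - 2 * s1 * c' l + c' l ^+ 2) / del)).
  move=> kn; transitivity (\int[nu]_l ((del + s2 / del) * I1 k l +
       ((- 2 * s1 / del) * (I1 k l * c' l) + del^-1 * (I1 k l * c' l ^+ 2)))).
    have q1 := bdmM (bdm_cst (del + s2 / del)) (bI k).
    have q2 := bdmM (bdm_cst (- 2 * s1 / del)) (bIc k).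
    have q3 := bdmM (bdm_cst del^-1) (bIcc k).
    rewrite (ExD nuT q1 (bdmD q2 q3)) (ExD nuT q2 q3).
    rewrite (ExZ nuT _ (bI k)) (ExZ nuT _ (bIc k)) (ExZ nuT _ (bIcc k)) nk// -/N -/(Ik k) -/(IIk k) /quad; field; by rewrite gt_eqF.
  by apply: eq_Rintegral => l _; field; rewrite gt_eqF.
have pw k w : (k < n)%N -> `|psi k w * N - Ik k| <= quad k (@psi m k w ^+ 2) (psi k w).
  move=> kn; rewrite quadE//.
  have -> : psi k w * N - Ik k = \int[nu]_l (I1 k l * (psi k w - c' l)).
    transitivity (\int[nu]_l (psi k w * I1 k l - I1 k l * c' l)).
      by rewrite (ExB nuT (bdmM (bdm_cst _) (bI k)) (bIc k)) (ExZ nuT _ (bI k)) nk.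
    by apply: eq_Rintegral => l _; ring.
  apply: (normr_Ex_le nuT).
  - exact: (bdmM (bI k) (bdmB (bdm_cst _) bc')).
  - exact: (bdmM (bI k) (bdmD (bdm_cst _) (bdmM (bdmD (bdmB (bdm_cst _)
      (bdmM (bdm_cst _) bc')) (bdmX _ bc')) (bdm_cst _)))).
  - move=> l; rewrite normrM (ger0_norm (_ : 0 <= I1 k l)) ?ler_wpM2l//.
    rewrite (_ : _ - _ + _ = (psi k w - c' l) ^+ 2); last by ring.
    set x := _ - c' l; rewrite -[x ^+ 2]real_normK ?num_real//.
    have [xd|xd] := leP `|x| del; first by rewrite (le_trans xd)// lerDl divr_ge0 ?sqr_ge0// ltW.
    rewrite (@le_trans _ _ (0 + `|x| ^+ 2 / del))//; last by rewrite lerD// ltW.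
    by rewrite add0r ler_pdivlMr// expr2 ler_wpM2l// ltW.
have Equad k : (k < n)%N -> \int[P m]_w quad k (psi k w ^+ 2) (psi k w) =
    del * N + del^-1 * \int[nu]_l (I1 k l * e m l).
  move=> kn; transitivity (quad k (\int[P m]_w (psi k w ^+ 2)) (\int[P m]_w psi k w)).
    rewrite /quad.
    transitivity (\int[P m]_w ((del * N + IIk k / del) + ((N / del) * psi k w ^+ 2 +
      (- 2 * Ik k / del) * psi k w))).
      by apply: eq_Rintegral => w _; field; rewrite gt_eqF.
    have b1 := bdmM (bdm_cst (N / del)) (bdmX 2 (bpsi m k)).
    have b2 := bdmM (bdm_cst (- 2 * Ik k / del)) (bpsi m k).
    rewrite (ExD (PT m) (bdm_cst _) (bdmD b1 b2)) (ExD (PT m) b1 b2) (Ex_cst (PT m)).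
    rewrite (ExZ (PT m) _ (bdmX _ (bpsi m k))) (ExZ (PT m) _ (bpsi m k)).
    by field; rewrite gt_eqF.
  rewrite quadE//; transitivity (\int[nu]_l (del * I1 k l + del^-1 * (I1 k l * e m l))).
    apply: eq_Rintegral => l _; rewrite /I1 indicE.
    case: (boolP (l \in _)) => [/set_mem lc|_]; last by rewrite !mul0r !mulr0 addr0.
    have lD := cellD _ _ kn lc.
    have tk := cell_truncn m0 lc.
    rewrite /e indicE mem_set ?mul1r; last by rewrite /D/= in_itv.
    by rewrite mulr1n mulr1 /h /g tk; field; rewrite gt_eqF.
  have b1 := bdmM (bdm_cst del) (bI k).
  have b2 := bdmM (bdm_cst del^-1) (bdmM (bI k) (be m)).
  by rewrite (ExD nuT b1 b2) (ExZ nuT _ (bI k)) (ExZ nuT _ (bdmM (bI k) (be m))) nk.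
have sumI : `|\sum_(k < n) Ik k - \int[nu]_l c' l| <= B * (1 - n%:R * N).
  have bS : bdm (fun l => \sum_(k < n) I1 k l) by apply: bdm_sum => k _; exact: bI.
  have bSc : bdm (fun l => \sum_(k < n) I1 k l * c' l) by apply: bdm_sum => k _; exact: bIc.
  have -> : \sum_(k < n) Ik k = \int[nu]_l (\sum_(k < n) I1 k l * c' l).
    by rewrite (Ex_sum nuT)// => k _; exact: bIc.
  rewrite -(ExB nuT bSc bc').
  apply: (@le_trans _ _ (\int[nu]_l (B * (1 - \sum_(k < n) I1 k l)))).
    apply: (normr_Ex_le nuT (bdmB bSc bc') (bdmM (bdm_cst _) (bdmB (bdm_cst _) bS))) => l.
    rewrite -mulr_suml distrC -{1}[c' l]mul1r -mulrBl normrM mulrC.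
    have := disj l (fun=> 1) (fun=> ler01); under eq_bigr do rewrite mulr1.
    by move=> s1; rewrite [X in _ * X]ger0_norm ?subr_ge0// ler_wpM2r ?subr_ge0.
  rewrite (ExZ nuT _ (bdmB (bdm_cst _) bS)) (ExB nuT (bdm_cst _) bS) (Ex_cst nuT).
  rewrite (Ex_sum nuT); last by move=> k _; exact: bI.
  rewrite (eq_bigr (fun=> N)); last by move=> k _; rewrite nk.
  by rewrite sumr_const card_ord mulr_natl.
have bq (k : nat) : bdm (fun w => quad k (@psi m k w ^+ 2) (psi k w)).
  apply: bdmD; first exact: bdm_cst.
  apply: bdmM (bdm_cst _); apply: bdmD; last exact: bdm_cst.
  apply: bdmB; first exact: bdmM (bdmX _ _) (bdm_cst _).
  by apply: bdmM (bdm_cst _); apply: bdmM => //; exact: bdm_cst.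
apply: (@le_trans _ _ (\int[P m]_w (mu * \sum_(k < n) quad k (psi k w ^+ 2) (psi k w) +
    mu * (B * (1 - n%:R * N))))).
  apply: (le_Ex (PT m)).
  - apply: bdm_norm; apply: bdmB; last exact: bdm_cst.
    by apply: bdmM; [exact: bdm_cst|exact: bdm_sum].
  - apply: bdmD; last exact: bdm_cst.
    by apply: bdmM; [exact: bdm_cst|exact: bdm_sum].
  - move=> w; rewrite (_ : _ - _ = mu * \sum_(k < n) (psi k w * N - Ik k) +
       mu * (\sum_(k < n) Ik k - \int[nu]_l c' l)); last first.
      by rewrite sumrB -mulr_suml muN; ring.
    rewrite (le_trans (ler_normD _ _))// !normrM !(gtr0_norm mu0) lerD// ler_wpM2l ?(ltW mu0)//.
    rewrite (le_trans (ler_norm_sum _ _ _))// ler_sum// => k _; exact: pw.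
rewrite (ExD (PT m)); [|by apply: bdmM; [exact: bdm_cst|exact: bdm_sum]|exact: bdm_cst].
rewrite (Ex_cst (PT m)) (ExZ (PT m)); last exact: bdm_sum.
rewrite (Ex_sum (PT m))// lerD//; last first.
  rewrite le_eqVlt; apply/orP; left; apply/eqP; rewrite /N; field.
  by rewrite !gt_eqF.
rewrite -mulrA -mulrDr ler_wpM2l ?(ltW mu0)//.
rewrite (eq_bigr (fun k : 'I_n => del * N + del^-1 * \int[nu]_l (I1 k l * e m l))); last first.
  by move=> k _; rewrite Equad.
rewrite big_split/= sumr_const card_ord -[X in X + _]mulr_natl lerD//.
  by rewrite mulrCA ler_piMr// ltW.
rewrite -mulr_sumr ler_wpM2l ?invr_ge0 ?(ltW del0)// -(Ex_sum nuT); last first.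
  by move=> k _; exact: bdmM (bI k) (be m).
have bS : bdm (fun l => \sum_(k < n) I1 k l * e m l).
  by apply: bdm_sum => k _; exact: bdmM (bI k) (be m).
apply: (le_Ex nuT bS (be m)).
by move=> l; exact: (disj l (fun=> e m l) (fun=> e0 m l)).
Qed.

Let integral_c' : mu * \int[nu]_l c' l = \int[lebesgue_measure]_(l in `]0, mu[) c l.
Proof.
rewrite (@Rintegral_density _ _ R lebesgue_measure nu (uniform_pdf 0 mu))//; first last.
- exact: (bdm_integrable nuT bc').
- by case: bc'.
- by move=> l; exact: uniform_pdf_ge0.
- exact: measurable_uniform_pdf.
rewrite [RHS]Rintegral_mkcond -/c'.
have pE l : c' l * uniform_pdf 0 mu l = mu^-1 * c' l.
  rewrite mulrC /uniform_pdf subr0; case: ifPn => // /negP lD.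
  rewrite (_ : c' l = 0) ?mulr0// /c' patchE memNset// /D/= in_itv/= => /andP[l0 l1].
  by apply: lD; rewrite !ltW.
have ic : lebesgue_measure.-integrable setT (EFin \o c').
  have nuE A : measurable A -> nu A = (\int[lebesgue_measure]_(x in A) (uniform_pdf 0 mu x)%:E)%E by [].
  have := @integrable_density _ _ R lebesgue_measure nu (uniform_pdf 0 mu)
    (measurable_uniform_pdf _ _) (fun x => uniform_pdf_ge0 x mu0) nuE c' bc'.1 (bdm_integrable nuT bc').
  move=> /(integrable_EFinZ mu); congr (integrable _ _ _).
  by apply/funext => l /=; rewrite pE mulVKf// gt_eqF.
under eq_Rintegral do rewrite pE.
by rewrite RintegralZl// mulVKf// gt_eqF.
Qed.

Lemma law_of_large_numbers :
  \int[P m]_w `|m%:R^-1 * \sum_(k < ell m) psi k w -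
     \int[lebesgue_measure]_(l in `]0, mu[) c l| @[m --> \oo] --> 0.
Proof.
(* [n m] is the largest number of cells that fits into [0, mu]. Replacing [ell m] by it costs B |ell
   m - n m| / m, one of four errors of size eps / 4. *)
rewrite -integral_c'; pose n m := Num.truncn (mu * m%:R).
have cn := cvg_truncn_ratio (ltW mu0).
apply/cvgrPdist_le => eps eps0.
pose del := eps / (4 * mu).
have del0 : 0 < del by rewrite divr_gt0// mulr_gt0.
have e1 : \forall m \near \oo, mu / del * \int[nu]_l e m l <= eps / 4.
  have cv : mu / del * \int[nu]_l e m l @[m --> \oo] --> 0.
    by rewrite -[X in _ --> X](mulr0 (mu / del)); apply: cvgMr; exact: cvg_e.
  have e40 : 0 < eps / 4 by rewrite divr_gt0.
  move/cvgrPdist_le : cv => /(_ _ e40); apply: filterS => m.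
  by rewrite sub0r normrN => /(le_trans (ler_norm _)).
have e2 : \forall m \near \oo, B * (mu - (n m)%:R / m%:R) <= eps / 4.
  have cv : B * (mu - (n m)%:R / m%:R) @[m --> \oo] --> B * (mu - mu).
    by apply: cvgMr; apply: cvgB => //; exact: cvg_cst.
  rewrite subrr mulr0 in cv.
  have e40 : 0 < eps / 4 by rewrite divr_gt0.
  move/cvgrPdist_le : cv => /(_ _ e40); apply: filterS => m.
  by rewrite sub0r normrN => /(le_trans (ler_norm _)).
have e3 : \forall m \near \oo, B * `|(ell m)%:R / m%:R - (n m)%:R / m%:R| <= eps / 4.
  have cv : B * `|(ell m)%:R / m%:R - (n m)%:R / m%:R| @[m --> \oo] --> B * `|mu - mu|.
    by apply: cvgMr; apply: cvg_norm; exact: cvgB.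
  rewrite subrr normr0 mulr0 in cv.
  have e40 : 0 < eps / 4 by rewrite divr_gt0.
  move/cvgrPdist_le : cv => /(_ _ e40); apply: filterS => m.
  by rewrite sub0r normrN => /(le_trans (ler_norm _)).
near=> m.
have m0 : (0 < m)%N by near: m; exact: nbhs_infty_gt.
have mr0 : 0 < m%:R :> R by rewrite ltr0n.
have nm : (n m)%:R / m%:R <= mu.
  rewrite ler_pdivrMr//.
  by have /andP[] := @truncn_itv R (mu * m%:R) (mulr_ge0 (ltW mu0) (ltW mr0)).
rewrite sub0r normrN ger0_norm; last by apply: Rintegral_ge0.
have bS j : bdm (fun w => m%:R^-1 * \sum_(k < j) @psi m k w).
  by apply: bdmM (bdm_cst _) _; apply: bdm_sum => k _; exact: bpsi.
have bA j : bdm (fun w => `|m%:R^-1 * \sum_(k < j) @psi m k w - mu * \int[nu]_l c' l|).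
  by apply: bdm_norm; apply: bdmB => //; exact: bdm_cst.
apply: (@le_trans _ _ (\int[P m]_w (`|m%:R^-1 * \sum_(k < n m) psi k w - mu * \int[nu]_l c' l| + eps / 4))).
  apply: (le_Ex (PT m)) => //; first exact: bdmD (bA _) (bdm_cst _).
  move=> w; rewrite (_ : _ - _ = (m%:R^-1 * \sum_(k < n m) psi k w - mu * \int[nu]_l c' l) +
    m%:R^-1 * (\sum_(k < ell m) psi k w - \sum_(k < n m) psi k w)); last by ring.
  rewrite (le_trans (ler_normD _ _))// lerD2l normrM.
  rewrite (@le_trans _ _ (B * `|(ell m)%:R / m%:R - (n m)%:R / m%:R|))//; last by near: m.
  rewrite [leRHS](_ : _ = `|m%:R^-1| * (B * `|(ell m)%:R - (n m)%:R|)); last first.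
    by rewrite -mulrBl normrM; ring.
  by rewrite ler_wpM2l//; apply: (sum_dist_le (F := fun k => psi k w)).
rewrite (ExD (PT m))//; last exact: bdm_cst.
rewrite (Ex_cst (PT m)).
have mb := main_bound m0 nm del0.
have h1 : mu / del * \int[nu]_l e m l <= eps / 4 by near: m.
have h2 : B * (mu - (n m)%:R / m%:R) <= eps / 4 by near: m.
have h3 : mu * del = eps / 4 by rewrite /del; field; rewrite gt_eqF.
by move: mb; rewrite h3; move: h1 h2; lra.
Unshelve. all: end_near. Qed.

End law_of_large_numbers.

(** * Likelihood equations *)

Section sup_norm.
Context {R : realType} {n : nat}.
Implicit Types x : 'rV[R]_n.

Lemma le_coord_norm x i : `|x ord0 i| <= `|x|.
Proof.
rewrite [leRHS]/Num.norm/= mx_normrE.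
exact: (le_bigmax _ (fun ij => `|x ij.1 ij.2|) (ord0, i)).
Qed.

Lemma norm_le_coord x (a : R) : 0 <= a -> (forall i, `|x ord0 i| <= a) -> `|x| <= a.
Proof.
move=> a0 xa; rewrite [leLHS]/Num.norm/= mx_normrE.
by apply: bigmax_le => // -[i j] _ /=; rewrite ord1.
Qed.

Lemma continuous_sum_rV (I : Type) (s : seq I) (F : I -> 'rV[R]_n -> R) x :
  (forall i, {for x, continuous (F i)}) -> {for x, continuous (fun x => \sum_(i <- s) F i x)}.
Proof.
move=> cF; elim: s => [|i s ih].
  rewrite (_ : (fun _ => _) = cst 0); first exact: cst_continuous.
  by apply/funext => y; rewrite big_nil.
rewrite (_ : (fun _ => _) = F i \+ (fun y => \sum_(i <- s) F i y)).
  exact: (continuousD (cF i) ih).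
by apply/funext => y; rewrite big_cons.
Qed.

(** Minimum of the form over the unit sphere, which is compact. In dimension 0 the sphere is empty
    and any constant works. *)
Lemma posdef_coercive (S : 'M[R]_n) : posdef S ->
  exists2 c, 0 < c & forall x, c * `|x| ^+ 2 <= bilin S x x.
Proof.
move=> [_ pS]; pose A : set 'rV[R]_n := [set x | `|x| = 1].
have cS : continuous (fun x => - bilin S x x).
  suff cb : continuous (fun x => bilin S x x) by move=> x; exact: (continuousN (cb x)).
  rewrite [X in continuous X](_ : _ = fun x => \sum_i \sum_j x ord0 i * S i j * x ord0 j).
    move=> x; apply: continuous_sum_rV => i; apply: continuous_sum_rV => j.
    have ci k := @coord_continuous R 1 n ord0 k x.
    exact: (continuousM (continuousM (ci i) (@cst_continuous _ _ (S i j) x)) (ci j)).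
  by apply/funext => x; rewrite bilin_sum.
have [[x0 Ax0]|A0] := pselect (A !=set0); last first.
  exists 1 => // x; have [->|x0] := eqVneq x 0.
    rewrite normr0 expr0n/= mulr0 /bilin.
    by rewrite trmx0 mulmx0 mxE.
  exfalso; apply: A0; exists (`|x|^-1 *: x).
  by rewrite /A/= normrZ normfV normr_id mulVf// normr_eq0.
have compA : compact A.
  apply: bounded_closed_compact.
    exists 1; split => // M M1 x /= ->; exact: ltW.
  rewrite (_ : A = (fun x => `|x|) @^-1` [set 1]) //.
  apply: closed_comp => [x _|]; first exact: norm_continuous.
  exact: closed_eq.
have [|x1 /set_mem Ax1 max1] := EVT_max_rV (ex_intro _ x0 Ax0 : A !=set0) compA (f := fun x => - bilin S x x).
  exact: continuous_subspaceT.
have x1_neq0 : x1 != 0.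
  by apply/eqP => x10; move: Ax1; rewrite /A/= x10 normr0 => /esym/eqP; rewrite oner_eq0.
exists (bilin S x1 x1); first exact: pS.
move=> x; have [->|x_neq0] := eqVneq x 0.
  rewrite normr0 expr0n/= mulr0 /bilin.
  by rewrite trmx0 mulmx0 mxE.
have nx : 0 < `|x| by rewrite normr_gt0.
have Ax : A (`|x|^-1 *: x).
  by rewrite /A/= normrZ normfV normr_id mulVf// gt_eqF.
have := max1 _ (mem_set Ax); rewrite lerN2.
have -> : bilin S (`|x|^-1 *: x) (`|x|^-1 *: x) = `|x| ^- 2 * bilin S x x.
  by rewrite !bilin_sum mulr_sumr; apply: eq_bigr => i _; rewrite mulr_sumr;
    apply: eq_bigr => j _; rewrite !mxE -exprVn; ring.
by rewrite mulrC ler_pdivlMr ?exprn_gt0.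
Qed.

End sup_norm.

Section directional_derivative.
Context {R : realType} {n : nat}.

Lemma is_derive_line (f : 'rV[R]_n -> R) (x v : 'rV[R]_n) (df : R) :
  is_derive (0 : R) (1 : R) (fun h => f (h *: v + x)) df -> is_derive x v f df.
Proof.
have E : (fun h : R => h^-1 *: ((f \o shift x) (h *: v) - f x)) =
    (fun h => h^-1 *: (((fun h => f (h *: v + x)) \o shift 0) (h *: (1 : R)) - f (0 *: v + x))).
  by apply/funext => h /=; rewrite addr0 scale0r add0r [h *: 1]mulr1.
move=> [d1 d2]; apply: DeriveDef; first by rewrite /derivable E.
by rewrite /derive E -d2.
Qed.

Lemma is_derive_coord (x v : 'rV[R]_n) i :
  is_derive (0 : R) (1 : R) (fun h => (h *: v + x) ord0 i) (v ord0 i).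
Proof.
rewrite (_ : (fun h => _) = (fun h : R => h * v ord0 i + x ord0 i)); last first.
  by apply/funext => h; rewrite !mxE.
by apply: is_derive_eq; rewrite /GRing.scale/= ; ring.
Qed.

End directional_derivative.

(** * The likelihood as a function of arbitrary areas and counts *)

Section likelihood.
Context {R : realType} {N : nat}.
Local Notation param := 'rV[R]_N.
(** Data frozen along one trajectory: [L] is the number of observed points, [G k j] the area with j
    neighbours once k points are present, [t j] the number of points that had j neighbours on
    arrival. *)
Variables (L : nat) (G : nat -> nat -> R) (t : nat -> R).
Hypothesis G0 : forall k j, 0 <= G k j.
Variable b0 : param.
Hypothesis b0pos : positive b0.

Definition normalizer k (b : param) := G k 0%N + \sum_(i < N) b ord0 i * G k i.+1.

Hypothesis D0 : forall k, (k < L)%N -> 0 < normalizer k b0.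

Definition log_likelihood (b : param) := \sum_(i < N) t i.+1 * ln (b ord0 i) -
  \sum_(k < L) ln (normalizer k b).

Definition gradient (b : param) : param := \row_i
  (t i.+1 / b ord0 i - \sum_(k < L) G k i.+1 / normalizer k b).

(** A positive normalizer at [b0] means that one of the areas is positive, a property that does not
    involve the parameter. *)
Let D_gt0 k b : (k < L)%N -> positive b -> 0 < normalizer k b.
Proof.
move=> kL bp; have := D0 kL; rewrite !lt0r => /andP[n0 _].
have s0 (c : param) i : positive c -> 0 <= c ord0 i * G k i.+1.
  by move=> cp; rewrite mulr_ge0// ltW.
rewrite addr_ge0 ?sumr_ge0// ?andbT; last by move=> i _; exact: s0.
apply: contra n0; rewrite paddr_eq0//; last by rewrite sumr_ge0// => i _; exact: s0.
move=> /andP[/eqP g0]; rewrite psumr_eq0; last by move=> i _; exact: s0.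
move=> /allP h; rewrite /normalizer g0 add0r big1// => i _.
have := h i (mem_index_enum _); rewrite mulf_eq0 gt_eqF//= => /eqP ->.
by rewrite mulr0.
Qed.

Lemma is_derive_log_likelihood b v : positive b ->
  is_derive b v log_likelihood (dot v (gradient b)).
Proof.
move=> bp; apply: is_derive_line.
have cE i : (0 *: v + b) ord0 i = b ord0 i by rewrite scale0r add0r.
have nE k : normalizer k (0 *: v + b) = normalizer k b by rewrite scale0r add0r.
have d1 (i : 'I_N) : is_derive (0 : R) (1 : R) (fun h => t i.+1 * ln ((h *: v + b) ord0 i))
    (t i.+1 * ((b ord0 i)^-1 * v ord0 i)).
  have l1 : is_derive ((fun h => (h *: v + b) ord0 i) (0 : R)) (1 : R) (@ln R) (b ord0 i)^-1.
    by rewrite cE; exact: is_derive1_ln.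
  have := is_derive1_comp l1 (is_derive_coord b v i) => d.
  by apply: is_derive_eq; rewrite /GRing.scale/=; ring.
have d2 (k : 'I_L) : is_derive (0 : R) (1 : R) (fun h => ln (normalizer k (h *: v + b)))
    ((normalizer k b)^-1 * \sum_(i < N) v ord0 i * G k i.+1).
  have l1 : is_derive ((fun h => normalizer k (h *: v + b)) (0 : R)) (1 : R) (@ln R)
      (normalizer k b)^-1.
    by rewrite nE; apply: is_derive1_ln; exact: D_gt0.
  apply: (@is_derive1_comp R (@ln R) (fun h => normalizer k (h *: v + b)) 0 _ _ l1).
  rewrite (_ : (fun h => _) = cst (G k 0%N) +
      \sum_(i < N) (fun h : R => (h *: v + b) ord0 i * G k i.+1)); last first.
    by apply/funext => h; rewrite /normalizer fctE fct_sumE.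
  have d i : is_derive (0 : R) (1 : R) (fun h : R => (h *: v + b) ord0 i * G k i.+1)
      (v ord0 i * G k i.+1).
    have ? := is_derive_coord b v i.
    by apply: is_derive_eq; rewrite /GRing.scale/=; ring.
  have ? := is_derive_sum d.
  by apply: is_derive_eq; rewrite add0r.
rewrite (_ : (fun h => _) = \sum_(i < N) (fun h : R => t i.+1 * ln ((h *: v + b) ord0 i)) -
    \sum_(k < L) (fun h : R => ln (normalizer k (h *: v + b)))); last first.
  by apply/funext => h; rewrite /log_likelihood fctE/= !fct_sumE.
have ? := is_derive_sum d1.
have ? := is_derive_sum d2.
apply: is_derive_eq.
rewrite /dot; under [RHS]eq_bigr do rewrite mxE mulrBr mulr_sumr.
rewrite sumrB exchange_big/=; congr (_ - _).
  by apply: eq_bigr => i _; ring.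
by apply: eq_bigr => k _; rewrite mulr_sumr; apply: eq_bigr => i _; ring.
Qed.

Lemma gradient_eq0 b : positive b ->
  (forall i, is_derive b (delta_mx ord0 i) log_likelihood 0) <-> gradient b = 0.
Proof.
move=> bp; split=> [h|h i]; last first.
  by have := is_derive_log_likelihood (delta_mx ord0 i) bp; rewrite h dot0r.
apply/rowP => i; have [_] := is_derive_log_likelihood (delta_mx ord0 i) bp.
have [_ ->] := h i.
by rewrite -[delta_mx _ _]scale1r dot_delta mul1r => <-; rewrite mxE.
Qed.

(* With u_j = b_j / D(b), each step k contributes
   sum_j G_j (u'_j - u_j) (ln u'_j - ln u_j) >= 0 to the difference of the likelihood
   equations at b' and b tested against ln b' - ln b. *)
Lemma gradient_unique b b' : positive b -> positive b' ->
  gradient b = 0 -> gradient b' = 0 ->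
  (exists2 k, (k < L)%N & forall j, (j <= N)%N -> 0 < G k j) -> b = b'.
Proof.
move=> bp bp' gb gb' [k0 k0L Gk0].
pose u k (c : param) i := c ord0 i / normalizer k c.
pose T k := \sum_(i < N) G k i.+1 * (u k b' i - u k b i) * (ln (b' ord0 i) - ln (b ord0 i)).
(* Multiplied by b_i, the likelihood equation reads sum_k G_i u_i = t_i at both points, so the
   difference cancels for each i. *)
have sumT : \sum_(k < L) T k = 0.
  rewrite exchange_big/= big1// => i _; rewrite -mulr_suml.
  have gE c : positive c -> gradient c = 0 -> \sum_(k < L) G k i.+1 * u k c i = t i.+1.
    move=> cp /rowP/(_ i); rewrite !mxE => /eqP; rewrite subr_eq0 => /eqP h.
    have -> : t i.+1 = c ord0 i * (t i.+1 / c ord0 i) by field; rewrite gt_eqF.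
    by rewrite h mulr_sumr; apply: eq_bigr => k _; rewrite /u; ring.
  under eq_bigr do rewrite mulrBr.
  by rewrite sumrB !gE// subrr mul0r.
have ln_diff (x y : R) : 0 < x -> 0 < y -> 0 <= (x - y) * (ln x - ln y) ?= iff (x == y).
  move=> x0 y0; split; last first.
    rewrite eq_sym mulf_eq0 !subr_eq0; apply/orP/idP => [[//|]|->]; last by left.
    by move=> /eqP/ln_inj -> //; rewrite posrE.
  have [xy|yx] := leP x y.
    by rewrite mulr_le0// subr_le0// ler_ln.
  by rewrite mulr_ge0// subr_ge0 ?ler_ln// ltW.
(* Passing from ln b to ln u brings in ln D. Together with sum_j G_j u_j = 1 this becomes the term
   of index 0, where u_0 = 1 / D because beta_0 = 1. *)
have TE k : (k < L)%N -> T k =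
    \sum_(i < N) G k i.+1 * ((u k b' i - u k b i) * (ln (u k b' i) - ln (u k b i))) +
    G k 0%N * (((normalizer k b')^-1 - (normalizer k b)^-1) *
       (ln (normalizer k b')^-1 - ln (normalizer k b)^-1)).
  move=> kL; have Db := D_gt0 kL bp; have Db' := D_gt0 kL bp'.
  rewrite !lnV ?posrE//.
  have z : \sum_(i < N) G k i.+1 * (u k b' i - u k b i) =
      - (G k 0%N * ((normalizer k b')^-1 - (normalizer k b)^-1)).
    have one c : 0 < normalizer k c ->
        \sum_(i < N) G k i.+1 * u k c i = 1 - G k 0%N * (normalizer k c)^-1.
      move=> c0; rewrite -{1}(divff (lt0r_neq0 c0)) -mulrBl.
      rewrite (_ : _ - G k 0%N = \sum_(i < N) c ord0 i * G k i.+1); last first.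
        by rewrite /normalizer addrC addKr.
      by rewrite mulr_suml; apply: eq_bigr => i _; rewrite /u; ring.
    under eq_bigr do rewrite mulrBr.
    by rewrite sumrB !one//; ring.
  have -> : T k = \sum_(i < N) (G k i.+1 * ((u k b' i - u k b i) * (ln (u k b' i) - ln (u k b i))) +
      G k i.+1 * (u k b' i - u k b i) * (ln (normalizer k b') - ln (normalizer k b))).
    apply: eq_bigr => i _; rewrite /u !ln_div ?posrE//; ring.
  by rewrite big_split/= -mulr_suml z; ring.
have up k c i : (k < L)%N -> positive c -> 0 < u k c i.
  by move=> kL cp; rewrite divr_gt0// D_gt0.
have T_ge0 k : (k < L)%N -> 0 <= T k.
  move=> kL; rewrite TE// addr_ge0// ?sumr_ge0// => [i _|]; rewrite mulr_ge0//.
    by rewrite ln_diff// up.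
  by rewrite ln_diff// invr_gt0 D_gt0.
have Tk0 : T k0 = 0.
  apply/eqP; move/eqP : sumT; rewrite psumr_eq0; last by move=> k _; exact: T_ge0.
  by move=> /allP/(_ (Ordinal k0L) (mem_index_enum _)).
have s0 (i : 'I_N) : 0 <= G k0 i.+1 * ((u k0 b' i - u k0 b i) * (ln (u k0 b' i) - ln (u k0 b i))).
  by rewrite mulr_ge0// ln_diff// up.
have i0 k c : (k < L)%N -> positive c -> 0 < (normalizer k c)^-1.
  by move=> kL cp; rewrite invr_gt0 D_gt0.
have := Tk0; rewrite TE// => /eqP; rewrite paddr_eq0; first last.
- by rewrite mulr_ge0// ln_diff// i0.
- by rewrite sumr_ge0.
move=> /andP[]; rewrite psumr_eq0// => /allP h.
(* At [k0] all areas are positive: the term of index 0 equates the normalizers, the other terms then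
   equate the coordinates. *)
rewrite mulf_eq0 gt_eqF ?Gk0//= eq_sym ln_diff ?i0// => /eqP nn.
apply/rowP => i; have := h i (mem_index_enum _); rewrite mulf_eq0 gt_eqF ?Gk0//=.
rewrite eq_sym ln_diff ?up// /u nn => /eqP/mulIf -> //.
by rewrite gt_eqF// i0.
Qed.

Lemma dot_gradient_le0 b v : positive b ->
  (\forall h \near 0^'+, log_likelihood (h *: v + b) <= log_likelihood b) ->
  dot v (gradient b) <= 0.
Proof.
move=> bp le; have [dv dE] := is_derive_log_likelihood v bp.
rewrite -dE /derive.
have cv : h^-1 *: ((log_likelihood \o shift b) (h *: v) - log_likelihood b) @[h --> 0^'+] -->
    'D_v log_likelihood b.
  exact: (cvg_dnbhs_at_right dv).
apply: (cvgr_to_le cv); near=> h.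
have h0 : 0 < h by near: h; exact: nbhs_right_gt.
rewrite /= /GRing.scale/= mulr_ge0_le0 ?invr_ge0 ?(ltW h0)// subr_le0.
by near: h.
Unshelve. all: end_near. Qed.

Lemma continuous_log_likelihood b : positive b -> {for b, continuous log_likelihood}.
Proof.
move=> bp; have cc i : {for b, continuous (fun x : param => x ord0 i)}.
  exact: (@coord_continuous R 1 N ord0 i b).
have cln (f : param -> R) : {for b, continuous f} -> 0 < f b ->
    {for b, continuous (fun x => ln (f x))}.
  by move=> cf fb; apply: (continuous_comp cf); exact: continuous_ln.
have cst_ (c : R) := @cst_continuous param R c b.
have c1 : {for b, continuous (fun b : param => \sum_(i < N) t i.+1 * ln (b ord0 i))}.
  by apply: continuous_sum_rV => i; apply: (continuousM (cst_ _)); exact: cln.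
suff c2 : {for b, continuous (fun b : param => \sum_(k < L) ln (normalizer k b))}.
  exact: (continuousB c1 c2).
apply: continuous_sum_rV => k; apply: cln; last exact: D_gt0.
apply: (continuousD (cst_ _)); apply: continuous_sum_rV => i.
exact: (continuousM (cc i) (cst_ _)).
Qed.

Variable a : R.
Hypothesis ba : forall i, (b0 ord0 i)^-1 <= a.

(** The sum of conditional covariances rather than minus the Hessian: the count t_i is replaced by
    its compensator, the sum over k of b0_i G_i / D. *)
Definition information : 'M[R]_N := \matrix_(i, j) \sum_(k < L)
  (G k i.+1 / (b0 ord0 i * normalizer k b0) * (i == j)%:R -
   G k i.+1 * G k j.+1 / normalizer k b0 ^+ 2).

(** Product of two bounds in the linearisation: a^2 (1 + N) for the first order terms and 2 a N for
    e / (1 + e) with |e| <= 1/2. *)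
Definition lin_const := 2 * a ^+ 2 * (1 + N%:R) * (a * N%:R).

(** With the weight b_j / b0_j the counts cancel, so the remainder depends on the areas only. The
    relative change e_k of the normalizer is linear in b - b0, and each first order term is
    multiplied by - e_k / (1 + e_k), hence the quadratic error. *)
Lemma gradient_linearization b j : positive b -> a * N%:R * `|b - b0| <= 2^-1 ->
  `|gradient b0 ord0 j - b ord0 j / b0 ord0 j * gradient b ord0 j -
    ((b - b0) *m information) ord0 j| <= L%:R * lin_const * `|b - b0| ^+ 2.
Proof.
move=> bp small; pose q k i := G k i / normalizer k b0.
pose D := b - b0; pose e k := \sum_(i < N) D ord0 i * q k i.+1.
have bi0 i : b0 ord0 i != 0 by rewrite gt_eqF.
have a0 : 0 <= a by apply: le_trans (ba j); rewrite invr_ge0 ltW.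
have q0 k i : (k < L)%N -> 0 <= q k i by move=> kL; rewrite divr_ge0// ltW// D0.
have qa k (i : 'I_N) : (k < L)%N -> q k i.+1 <= a.
  move=> kL; apply: le_trans (ba i).
  rewrite /q ler_pdivrMr ?D0// ler_pdivlMl// /normalizer.
  rewrite (bigD1 i)//= addrCA lerDl addr_ge0// sumr_ge0// => l _.
  by rewrite mulr_ge0// ltW.
have Dn i : `|D ord0 i| <= `|D| by exact: le_coord_norm.
have eB k : (k < L)%N -> `|e k| <= a * N%:R * `|D|.
  move=> kL; rewrite (le_trans (ler_norm_sum _ _ _))//.
  rewrite (@le_trans _ _ (\sum_(i < N) `|D| * a))//.
    apply: ler_sum => i _; rewrite normrM ler_pM//.
    by rewrite ger0_norm ?q0// qa.
  by rewrite sumr_const card_ord [leLHS](_ : _ = a * N%:R * `|D|)// -[LHS]mulr_natl; ring.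
have e1 k : (k < L)%N -> 2^-1 <= 1 + e k.
  move=> kL; have := le_trans (eB k kL) small.
  by rewrite ler_norml => /andP[h _]; lra.
have DE k : (k < L)%N -> normalizer k b = normalizer k b0 * (1 + e k).
  move=> kL; have := D0 kL; rewrite lt0r => /andP[n0 _].
  rewrite mulrDr mulr1 /e mulr_sumr {1 2}/normalizer -addrA -big_split/=; congr (_ + _).
  by apply: eq_bigr => i _; rewrite /q /D !mxE; field.
have -> : gradient b0 ord0 j - b ord0 j / b0 ord0 j * gradient b ord0 j -
    ((b - b0) *m information) ord0 j =
    \sum_(k < L) (D ord0 j * q k j.+1 / b0 ord0 j - q k j.+1 * e k) * (- e k / (1 + e k)).
  transitivity (\sum_(k < L) (b ord0 j / b0 ord0 j * (G k j.+1 / normalizer k b) - q k j.+1 -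
      (D ord0 j * q k j.+1 / b0 ord0 j - q k j.+1 * e k))); last first.
    apply: eq_bigr => k _; rewrite DE ?ltn_ord//.
    have n0 : normalizer k b0 != 0 by rewrite gt_eqF ?D0.
    have e0 : 1 + e k != 0 by rewrite gt_eqF// (lt_le_trans _ (e1 _ (ltn_ord k)))// invr_gt0.
    by rewrite /q /D !mxE; field; rewrite n0 e0 bi0.
  rewrite !sumrB -!mulr_sumr; congr (_ - _).
    rewrite !mxE; have bj : b ord0 j != 0 by rewrite gt_eqF.
    by field; rewrite bi0 bj.
  rewrite -/D mxE; under eq_bigr do rewrite [information _ _]mxE mulr_sumr.
  rewrite exchange_big -sumrB/=; apply: eq_bigr => k _.
  have n0 : normalizer k b0 != 0 by rewrite gt_eqF ?D0.
  under eq_bigr do rewrite mulrBr.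
  rewrite sumrB; congr (_ - _).
    rewrite (bigD1 j)//= eqxx mulr1 big1 ?addr0 => [|i /negPf ->]; last by rewrite !mulr0.
    by rewrite /q /D !mxE; field; rewrite n0 bi0.
  rewrite /e mulr_sumr; apply: eq_bigr => i _.
  by rewrite /q /D; field.
rewrite (le_trans (ler_norm_sum _ _ _))//.
rewrite (@le_trans _ _ (\sum_(k < L) lin_const * `|D| ^+ 2))//; last first.
  by rewrite sumr_const card_ord -[leLHS]mulr_natl mulrA.
apply: ler_sum => k _; have kL := ltn_ord k.
have e0 : 0 < 1 + e k by rewrite (lt_le_trans _ (e1 k kL))// invr_gt0.
rewrite normrM (_ : _ * _ ^+ 2 = (a ^+ 2 * (1 + N%:R) * `|D|) * (a * N%:R * `|D| * 2)); last first.
  by rewrite /lin_const; ring.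
rewrite ler_pM//.
  have qn : `|q k j.+1| <= a by rewrite ger0_norm ?q0// qa.
  move: (q k j.+1) qn => x xa.
  rewrite (le_trans (ler_normB _ _))// mulrDr mulrDl lerD//.
    rewrite !normrM mulr1 expr2 -mulrA [leRHS]mulrC ler_pM//.
    by rewrite normfV ler_pM// ger0_norm ?ba// ltW.
  by rewrite normrM expr2 -!mulrA ler_pM// mulrA eB.
rewrite normrM normrN normfV ler_pM// ?eB//.
by rewrite gtr0_norm// -[leRHS]invrK lef_pV2 ?posrE ?invr_gt0// e1.
Qed.

(* At the maximum b over the box |b - b0| <= rho, the direction
   v_j = - (b - b0)_j b_j / b0_j points into the box; this weight makes the
   linearisation of the gradient exact up to the factor 1 / (1 + e). *)
Lemma exists_critical_point (c rho : R) : 0 < c ->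
  (forall x, c * `|x| ^+ 2 <= bilin information x x) ->
  0 < rho -> a * N%:R * rho <= 2^-1 ->
  L%:R * lin_const * N%:R * rho <= c / 2 ->
  N%:R * `|gradient b0| < c / 2 * rho ->
  exists b, [/\ positive b, gradient b = 0, `|b - b0| < rho &
                c / 2 * `|b - b0| <= N%:R * `|gradient b0|].
Proof.
move=> c0 coer rho0 rho1 rho2 small.
have a_gt0 : (0 < N)%N -> 0 < a.
  by move=> N0; apply: lt_le_trans (ba (Ordinal N0)); rewrite invr_gt0.
have aN0 : 0 <= a * N%:R.
  have [N0|N0] := posnP N; last by rewrite mulr_ge0// ltW// a_gt0.
  by rewrite (_ : N%:R = 0) ?mulr0// N0.
(* The box then stays inside the positive orthant, with weights b_i / b0_i between 1/2 and 2. The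
   presence of an index i ensures N > 0. *)
have rb i : rho <= b0 ord0 i / 2.
  have N0 : (0 < N)%N by exact: leq_ltn_trans (ltn_ord i).
  have N1 : 1 <= N%:R :> R by rewrite ler1n.
  have := rho1; rewrite -ler_pdivlMl ?mulr_gt0 ?(a_gt0 N0) ?(lt_le_trans ltr01 N1)//.
  move=> /le_trans -> //; rewrite ler_pM2r ?invr_gt0// -[leRHS]invrK lef_pV2 ?posrE ?invr_gt0//.
    by rewrite (le_trans (ba i))// ler_peMr ?N1// ltW// (a_gt0 N0).
  by rewrite mulr_gt0 ?(a_gt0 N0)// (lt_le_trans ltr01 N1).
pose A := [set b | `|b - b0| <= rho].
have Apos b : A b -> positive b.
  move=> Ab i; have := le_trans (le_coord_norm (b - b0) i) Ab.
  rewrite !mxE ler_norml => /andP[h _]; have := rb i; have := b0pos i; lra.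
have compA : compact A.
  apply: bounded_closed_compact.
    exists (rho + `|b0|); split => [|M M1]; first exact: num_real.
    move=> x /= Ax.
    by rewrite -[x](subrK b0) (le_trans (ler_normD _ _))// ltW// (le_lt_trans _ M1)// lerD2r.
  apply: (@closed_comp _ _ (fun b : param => `|b - b0|) [set x | x <= rho]); last exact: closed_le.
  move=> x _; apply: (continuous_comp (f := fun b : param => b - b0)); last exact: norm_continuous.
  apply: (@continuousB _ _ _ id (cst b0) x) => //; exact: cst_continuous.
have [|||b /set_mem Ab bmax] := @EVT_max_rV R N log_likelihood A.
- by exists b0; rewrite /A/= subrr normr0 ltW.
- exact: compA.
- apply: continuous_in_subspaceT => x /set_mem Ax; exact: continuous_log_likelihood (Apos _ Ax).
have bp := Apos _ Ab.
have le0 v : (\forall h \near 0^'+, A (h *: v + b)) -> dot v (gradient b) <= 0.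
  move=> hv; apply: dot_gradient_le0 => //.
  by apply: filterS hv => h /mem_set; exact: bmax.
pose D := b - b0; pose v : param := \row_i (- (D ord0 i * (b ord0 i / b0 ord0 i))).
have bb i : 2^-1 <= b ord0 i / b0 ord0 i <= 2.
  rewrite ler_pdivlMr// ler_pdivrMr//.
  have := le_trans (le_coord_norm D i) Ab; rewrite /D !mxE ler_norml => /andP[h1 h2].
  by apply/andP; split; have := rb i; lra.
have vle : dot v (gradient b) <= 0.
  apply: le0; near=> h.
  have h0 : 0 < h by near: h; exact: nbhs_right_gt.
  have h1 : h <= 2^-1 by near: h; apply: nbhs_right_ltW; rewrite invr_gt0.
  apply: (le_trans _ Ab); apply: norm_le_coord => // i.
  rewrite (_ : _ ord0 i = D ord0 i * (1 - h * (b ord0 i / b0 ord0 i))); last first.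
    by rewrite /v /D !mxE; ring.
  have /andP[b1 b2] := bb i.
  rewrite normrM (le_trans _ (le_coord_norm D i))// ler_piMr// ler_norml; apply/andP; split; nra.
(* By maximality along v, sum_i D_i g_i is at most the pairing of D with the gradient at [b0].
   Coercivity bounds it below by c |D|^2 minus a cubic remainder that the choice of [rho] keeps
   under c / 2 |D|^2. *)
have key : c / 2 * `|D| <= N%:R * `|gradient b0|.
  have [->|D_neq0] := eqVneq D 0; first by rewrite normr0 mulr0 mulr_ge0.
  have D0' : 0 < `|D| by rewrite normr_gt0.
  rewrite -(ler_pM2r D0').
  pose g := fun i => gradient b0 ord0 i - b ord0 i / b0 ord0 i * gradient b ord0 i.
  have s1 : \sum_i D ord0 i * g i <= \sum_i D ord0 i * gradient b0 ord0 i.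
    rewrite -subr_ge0 -sumrB; move: vle; rewrite -oppr_ge0 /dot -sumrN.
    congr (0 <= _); apply: eq_bigr => i _; rewrite /g [v _ _]mxE; ring.
  have s2 : \sum_i D ord0 i * gradient b0 ord0 i <= N%:R * `|gradient b0| * `|D|.
    rewrite (le_trans (ler_norm _))// (le_trans (ler_norm_sum _ _ _))//.
    rewrite (@le_trans _ _ (\sum_(i < N) `|D| * `|gradient b0|))//.
      by apply: ler_sum => i _; rewrite normrM ler_pM// le_coord_norm.
    by rewrite sumr_const card_ord [leLHS](_ : _ = N%:R * `|gradient b0| * `|D|)// -[LHS]mulr_natl; ring.
  have DS : a * N%:R * `|D| <= 2^-1.
    by rewrite (le_trans _ rho1)// ler_wpM2l.
  have s3 : bilin information D D - N%:R * (L%:R * lin_const * `|D| ^+ 3) <= \sum_i D ord0 i * g i.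
    rewrite bilinE /dot lerBlDl -lerBlDr -sumrB.
    rewrite (le_trans (ler_norm _))// (le_trans (ler_norm_sum _ _ _))//.
    rewrite (@le_trans _ _ (\sum_(i < N) L%:R * lin_const * `|D| ^+ 3))//; last first.
      by rewrite sumr_const card_ord -[leLHS]mulr_natl.
    apply: ler_sum => i _; rewrite (_ : _ - _ = - (D ord0 i * (g i - (D *m information) ord0 i))); last by ring.
    rewrite normrN normrM exprS mulrCA ler_pM ?le_coord_norm//.
    exact: gradient_linearization.
  apply: (le_trans _ s2); apply: (le_trans _ s1); apply: (le_trans _ s3).
  have cD := coer D.
  have rD : L%:R * lin_const * N%:R * `|D| ^+ 3 <= c / 2 * `|D| ^+ 2.
    rewrite exprS mulrA ler_wpM2r ?sqr_ge0//; apply: le_trans rho2.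
    have lc : 0 <= lin_const.
      by rewrite /lin_const mulr_ge0 // mulr_ge0 ?addr_ge0 // mulr_ge0 ?sqr_ge0.
    apply: ler_wpM2l Ab; apply: mulr_ge0 => //; exact: mulr_ge0.
  move: cD rD; rewrite !exprS expr0; lra.
have Dlt : `|D| < rho.
  by rewrite -(ltr_pM2l (_ : 0 < c / 2)) ?divr_gt0// (le_lt_trans key).
exists b; split => //.
apply/rowP => i; rewrite [RHS]mxE.
(* The maximum lies strictly inside the box, so both signs of each basis direction are
   admissible. *)
have near_in u : `|u| <= 1 -> \forall h \near 0^'+, A (h *: u + b).
  move=> u1; near=> h.
  have h0 : 0 < h by near: h; exact: nbhs_right_gt.
  have h1 : h <= rho - `|D| by near: h; apply: nbhs_right_ltW; rewrite subr_gt0.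
  rewrite /A/= -addrA (le_trans (ler_normD _ _))// -lerBrDr (le_trans _ h1)//.
  by rewrite normrZ gtr0_norm// ler_piMr// ltW.
have de1 (s : R) : `|s| <= 1 -> `|s *: delta_mx ord0 i : param| <= 1.
  move=> s1; apply: norm_le_coord => // j; rewrite !mxE eqxx/=.
  by case: (j == i); rewrite ?mulr1 ?mulr0 ?normr0.
have := le0 _ (near_in _ (de1 1 _)); rewrite normr1 dot_delta mul1r => /(_ (lexx _)) g1.
have := le0 _ (near_in _ (de1 (-1) _)); rewrite normrN1 dot_delta mulN1r oppr_le0 => /(_ (lexx _)) g2.
by apply/eqP; rewrite eq_le g1 g2.
Unshelve. all: end_near. Qed.

End likelihood.

(** * Asymptotics of the critical point for given data *)

Section estimator.
Context {R : realType}.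

Lemma near_le_sqrt (M : R) : \forall m \near \oo, M <= Num.sqrt (m%:R : R).
Proof.
near=> m; apply: (le_trans (ler_norm M)); rewrite -sqrtr_sqr ler_wsqrtr//.
by near: m; exact: nbhs_infty_ger.
Unshelve. all: end_near. Qed.

Lemma norm_mulmx_le n (x : 'rV[R]_n) (A : 'M[R]_n) (eta : R) i :
  (forall i j, `|A i j| <= eta) -> `|(x *m A) ord0 i| <= n%:R * (`|x| * eta).
Proof.
move=> Aeta; rewrite mxE (le_trans (ler_norm_sum _ _ _))//.
rewrite (@le_trans _ _ (\sum_(i < n) `|x| * eta))//.
  by apply: ler_sum => j _; rewrite normrM ler_pM// le_coord_norm.
by rewrite sumr_const card_ord -[leLHS]mulr_natl.
Qed.

Lemma critical_point_asymptotics N (S : 'M[R]_N) (b0 : 'rV[R]_N) (M K del : R) :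
  posdef S -> positive b0 -> 0 <= M -> 0 <= K -> 0 < del ->
  exists2 eta, 0 < eta & \forall m \near \oo,
    forall L (G : nat -> nat -> R) t, (forall k j, 0 <= G k j) ->
    (forall k, (k < L)%N -> 0 < normalizer G k b0) ->
    (exists2 k, (k < L)%N & forall j, (j <= N)%N -> 0 < G k j) ->
    L%:R <= M * m%:R ->
    `|(Num.sqrt m%:R)^-1 *: gradient L G t b0| <= K ->
    (forall i j, `|m%:R^-1 * information L G b0 i j - S i j| <= eta) ->
    exists b, [/\ positive b, gradient L G t b = 0,
      forall b', positive b' -> gradient L G t b' = 0 -> b = b' &
      forall i, `|((Num.sqrt m%:R)^-1 *: gradient L G t b0 *m invmx S -
          Num.sqrt m%:R *: (b - b0)) ord0 i| < del].
Proof.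
move=> pS b0p M0 K0 del0; have [c c0 coer] := posdef_coercive pS.
pose a := \sum_i (b0 ord0 i)^-1.
have ba i : (b0 ord0 i)^-1 <= a.
  by rewrite /a (bigD1 i)//= lerDl sumr_ge0// => j _; rewrite invr_ge0 ltW.
have a0 : 0 <= a by apply: sumr_ge0 => j _; rewrite invr_ge0 ltW.
pose C := @lin_const R N a.
have C0 : 0 <= C.
  by rewrite /C /lin_const mulr_ge0 ?mulr_ge0 ?addr_ge0 ?exprn_ge0.
(* Each of the first two summands secures one of the bounds [rho1] and [rho2]. The size of the box
   does not depend on m. *)
pose rho : R := (2 * (a * N%:R) + 4 * (M * C * N%:R) / c + 1)^-1.
have t1 : 0 <= 2 * (a * N%:R) by rewrite !mulr_ge0.
have t2 : 0 <= 4 * (M * C * N%:R) / c by rewrite !mulr_ge0// invr_ge0 ltW.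
have rho0 : 0 < rho by rewrite invr_gt0 ltr_wpDl// addr_ge0.
have rho1 : a * N%:R * rho <= 2^-1.
  rewrite /rho ler_pdivrMr; last by rewrite -invr_gt0.
  by rewrite -ler_pdivrMl ?invr_gt0// invrK; lra.
have rho2 : M * C * N%:R * rho <= c / 4.
  rewrite /rho ler_pdivrMr; last by rewrite -invr_gt0.
  rewrite -ler_pdivrMl ?divr_gt0//.
  rewrite [leLHS](_ : _ = 4 * (M * C * N%:R) / c); last by field; rewrite gt_eqF.
  by lra.
pose K2 : R := 4 * N%:R * K / c.
have K20 : 0 <= K2 by rewrite !mulr_ge0// invr_ge0 ltW.
pose s : R := \sum_i \sum_j `|invmx S i j| + 1.
have s0 : 0 < s by rewrite ltr_wpDl// sumr_ge0// => i _; exact: sumr_ge0.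
have sE i j : `|invmx S i j| <= s.
  rewrite /s (bigD1 i)//= (bigD1 j)//= -!addrA lerDl.
  by rewrite !addr_ge0// ?sumr_ge0// => k _; exact: sumr_ge0.
pose Ns : R := N%:R * s + 1.
have Ns0 : 0 < Ns by rewrite ltr_wpDl// mulr_ge0// ltW.
(* The first summand preserves half of the coercivity of S, the second limits the effect of the
   information error on the final distance to del / 4. *)
pose eta : R := (2 * (N%:R * N%:R) / c + 4 * (N%:R * K2 * Ns) / del + 1)^-1.
have t3 : 0 <= 2 * (N%:R * N%:R) / c by rewrite !mulr_ge0// invr_ge0 ltW.
have t4 : 0 <= 4 * (N%:R * K2 * Ns) / del.
  by rewrite !mulr_ge0 ?invr_ge0// ltW.
have eta0 : 0 < eta by rewrite invr_gt0 ltr_wpDl// addr_ge0.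
have eta1 : N%:R * N%:R * eta <= c / 2.
  rewrite /eta ler_pdivrMr; last by rewrite -invr_gt0.
  rewrite -ler_pdivrMl ?divr_gt0//.
  rewrite [leLHS](_ : _ = 2 * (N%:R * N%:R) / c); last by field; rewrite gt_eqF.
  by lra.
have eta2 : N%:R * K2 * Ns * eta <= del / 4.
  rewrite /eta ler_pdivrMr; last by rewrite -invr_gt0.
  rewrite -ler_pdivrMl ?divr_gt0//.
  rewrite [leLHS](_ : _ = 4 * (N%:R * K2 * Ns) / del); last by field; rewrite gt_eqF.
  by lra.
exists eta; first exact: eta0.
near=> m.
have q1 : 1 <= Num.sqrt (m%:R : R) by near: m; exact: near_le_sqrt.
(* Makes the gradient, of order sqrt m, small against the coercive term, of order m, on the boundary
   of the box. *)
have q2 : N%:R * K / (c / 4 * rho) + 1 <= Num.sqrt (m%:R : R) by near: m; exact: near_le_sqrt.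
(* Brings the quadratic remainder of the linearisation down to del / 4. *)
have q3 : 4 * (M * C * K2 ^+ 2 * Ns) / del <= Num.sqrt (m%:R : R) by near: m; exact: near_le_sqrt.
set q : R := Num.sqrt _ in q1 q2 q3 *.
have q0 : 0 < q by rewrite (lt_le_trans ltr01).
have qq : q ^+ 2 = m%:R by rewrite sqr_sqrtr.
move=> L G t G0 D0 Gk LM WK infoS.
set W := _ *: gradient L G t b0 in WK *.
have gW : gradient L G t b0 = q *: W by rewrite /W scalerA divff ?scale1r// gt_eqF.
have ng : `|gradient L G t b0| <= q * K by rewrite gW normrZ gtr0_norm// ler_pM2l.
have coer' x : q ^+ 2 * (c / 2) * `|x| ^+ 2 <= bilin (information L G b0) x x.
  pose E := q ^- 2 *: information L G b0 - S.
  have EE : information L G b0 = q ^+ 2 *: (S + E).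
    by rewrite /E addrC subrK scalerA divff ?scale1r// expf_neq0 ?gt_eqF.
  have Eeta i j : `|E i j| <= eta by rewrite /E !mxE qq; move: (infoS i j); rewrite mxE.
  rewrite EE /bilin -scalemxAr -scalemxAl mxE -mulrA ler_pM2l ?exprn_gt0//.
  rewrite mulmxDr mulmxDl mxE -/(bilin S x x).
  have bE : `|(x *m E *m x^T) ord0 ord0| <= c / 2 * `|x| ^+ 2.
    rewrite -dotE /dot (le_trans (ler_norm_sum _ _ _))//.
    rewrite (@le_trans _ _ (\sum_(i < N) N%:R * (`|x| * eta) * `|x|))//.
      by apply: ler_sum => i _; rewrite normrM ler_pM ?le_coord_norm// norm_mulmx_le.
    rewrite sumr_const card_ord [leLHS](_ : _ = N%:R * N%:R * eta * `|x| ^+ 2).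
      by rewrite ler_wpM2r// sqr_ge0.
    by rewrite -[LHS]mulr_natl; ring.
  by have := coer x; move: bE; rewrite ler_norml => /andP[bE _]; lra.
have L1 : L%:R * C * N%:R * rho <= q ^+ 2 * (c / 2) / 2.
  rewrite (@le_trans _ _ (m%:R * (M * C * N%:R * rho)))//.
    by rewrite !mulrA [m%:R * M]mulrC !ler_wpM2r// ltW.
  rewrite -qq [leRHS](_ : _ = q ^+ 2 * (c / 4)); last by field.
  by rewrite ler_wpM2l// sqr_ge0.
have small : N%:R * `|gradient L G t b0| < q ^+ 2 * (c / 2) / 2 * rho.
  apply: (@le_lt_trans _ _ (N%:R * (q * K))); first by rewrite ler_wpM2l.
  rewrite [ltRHS](_ : _ = q * (q * (c / 4 * rho))); last by field.
  rewrite mulrCA ltr_pM2l// -ltr_pdivrMr; last by rewrite mulr_gt0// divr_gt0.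
  by apply: lt_le_trans q2; rewrite ltrDl.
have [|b [bp gb brho bK]] := exists_critical_point G0 b0p D0 ba _ coer' rho0 rho1 L1 small.
  by rewrite mulr_gt0 ?exprn_gt0 ?divr_gt0.
exists b; split => // [b' b'p gb'|i]; first exact: (gradient_unique G0 D0 bp b'p gb gb' Gk).
pose h := q *: (b - b0).
have hK : `|h| <= K2.
  rewrite /h normrZ gtr0_norm// /K2 ler_pdivlMr//.
  have : q * (q * `|b - b0| * c) <= q * (4 * N%:R * K).
    rewrite [leLHS](_ : _ = 4 * (q ^+ 2 * (c / 2) / 2 * `|b - b0|)); last by field.
    rewrite [leRHS](_ : _ = 4 * (N%:R * (q * K))); last by ring.
    by rewrite ler_pM2l// (le_trans bK)// ler_wpM2l.
  by rewrite ler_pM2l.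
(* As the gradient vanishes at b, W - h S is the scaled remainder of the linearisation plus h times
   the deviation of the normalised information from S. *)
have WhS j : `|(W - h *m S) ord0 j| <= M * C * K2 ^+ 2 / q + N%:R * (K2 * eta).
  have -> : W - h *m S = q^-1 *: (gradient L G t b0 - (b - b0) *m information L G b0) +
      h *m (m%:R^-1 *: information L G b0 - S).
    rewrite gW scalerBr scalerA mulVf ?gt_eqF// scale1r mulmxBr addrA; congr (_ - _).
    rewrite -addrA addrC -[LHS]add0r; congr (_ + _).
    rewrite /h -scalemxAr -!scalemxAl scalerA -qq -[X in _ + X]/(_) addrC.
    rewrite (_ : q ^- 2 * q = q^-1); last by field; rewrite gt_eqF.
    by rewrite subrr.
  rewrite mxE (le_trans (ler_normD _ _))// lerD//; last first.
    rewrite (le_trans (norm_mulmx_le (eta := eta) _ _ _)) => [//|k l|].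
      by rewrite !mxE; move: (infoS k l); rewrite mxE.
    by rewrite ler_wpM2l// ler_wpM2r// ltW.
  have := gradient_linearization t G0 b0p D0 ba j bp _.
  rewrite gb [(0 : 'rV_N) _ _]mxE mulr0 subr0 => lin.
  rewrite mxE normrM normfV (gtr0_norm q0) mulrC ler_pM2r ?invr_gt0//.
  rewrite !mxE in lin *; apply: le_trans (lin _) _.
    by apply: le_trans rho1; rewrite ler_wpM2l ?mulr_ge0// ltW.
  rewrite -/C (@le_trans _ _ (M * q ^+ 2 * C * `|b - b0| ^+ 2))//.
    by rewrite ler_wpM2r ?sqr_ge0// ler_wpM2r// qq.
  rewrite [leLHS](_ : _ = M * C * `|h| ^+ 2); last first.
    by rewrite /h normrZ (gtr0_norm q0); ring.
  by rewrite ler_wpM2l ?mulr_ge0// lerXn2r ?nnegrE.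
have -> : W *m invmx S - h = (W - h *m S) *m invmx S.
  by rewrite mulmxBl mulmxK// posdef_unitmx.
have WhS' : `|W - h *m S| <= M * C * K2 ^+ 2 / q + N%:R * (K2 * eta).
  apply: norm_le_coord => //; rewrite addr_ge0//.
    by apply: divr_ge0 _ (ltW q0); apply: mulr_ge0 _ (sqr_ge0 _); exact: mulr_ge0.
  by apply: mulr_ge0 => //; apply: mulr_ge0 _ (ltW eta0).
apply: (le_lt_trans (norm_mulmx_le _ _ (eta := s) _)) => //.
apply: (@le_lt_trans _ _ (Ns * (M * C * K2 ^+ 2 / q + N%:R * (K2 * eta)))).
  rewrite mulrCA mulrC ler_pM ?mulr_ge0 ?(ltW s0)//.
  by rewrite /Ns lerDl.
apply: (@le_lt_trans _ _ (del / 4 + del / 4)); last by lra.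
rewrite mulrDr lerD//; last by rewrite (le_trans _ eta2)// le_eqVlt; apply/orP; left; apply/eqP; ring.
rewrite mulrA ler_pdivrMr// -ler_pdivrMl ?divr_gt0//.
by apply: le_trans q3; rewrite le_eqVlt; apply/orP; left; apply/eqP; field; rewrite gt_eqF.
Unshelve. all: end_near. Qed.

End estimator.

(** * Limit of the score and of the information *)

Section fisher_matrix.
Context {R : realType} {N : nat}.
Variable b : 'rV[R]_N.
Hypothesis b0 : positive b.
Implicit Type x : 'rV[R]_N.+1.

Lemma rate_lift (i : 'I_N) : rate b (lift ord0 i) = b ord0 i.
Proof. by rewrite /rate/= valK. Qed.

(** Conditional probability of j neighbours as a function of the areas. It is homogeneous of degree
    0, so areas and areas per unit volume give the same value, and its value 0 at a zero denominator
    agrees with [type_prob] after jamming. *)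
Definition share x (j : 'I_N.+1) :=
  rate b j * x ord0 j / \sum_(i < N.+1) rate b i * x ord0 i.

(** The matrix Q in terms of shares: covariance of the type indicators, scaled by the parameters. In
    this form it is visibly bounded and defined for jammed configurations too. *)
Definition fisher x : 'M[R]_N := \matrix_(i, j)
  ((share x (lift ord0 i) * (i == j)%:R - share x (lift ord0 i) * share x (lift ord0 j)) /
   (b ord0 i * b ord0 j)).

Lemma share_ge0 x j : (forall i, 0 <= x ord0 i) -> 0 <= share x j.
Proof.
move=> x0; have r0 (i : 'I_N.+1) : 0 <= rate b i * x ord0 i by rewrite mulr_ge0 ?rate_ge0.
by rewrite /share divr_ge0 ?sumr_ge0.
Qed.

Lemma sum_share x : \sum_(i < N.+1) rate b i * x ord0 i != 0 ->
  \sum_(j < N.+1) share x j = 1.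
Proof. by move=> s0; rewrite -mulr_suml divff. Qed.

Lemma share_le1 x j : (forall i, 0 <= x ord0 i) -> share x j <= 1.
Proof.
move=> x0; have [s0|s0] := eqVneq (\sum_(i < N.+1) rate b i * x ord0 i) 0.
  by rewrite /share s0 invr0 mulr0.
rewrite -(sum_share s0) (bigD1 j)//= lerDl sumr_ge0// => i _; exact: share_ge0.
Qed.

Definition fisher_bound := \sum_i \sum_j (b ord0 i * b ord0 j)^-1.

Lemma fisher_le x i j : (forall i, 0 <= x ord0 i) -> `|fisher x i j| <= fisher_bound.
Proof.
move=> x0; have bb k l : 0 <= (b ord0 k * b ord0 l)^-1.
  by rewrite invr_ge0 mulr_ge0// ltW.
rewrite mxE normrM (ger0_norm (bb _ _)).
apply: (@le_trans _ _ (b ord0 i * b ord0 j)^-1).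
  rewrite ler_piMl// -mulrBr normrM.
  have := share_ge0 (lift ord0 i) x0; have := share_ge0 (lift ord0 j) x0.
  have := share_le1 (lift ord0 i) x0; have := share_le1 (lift ord0 j) x0.
  move: (share _ _) (share _ _) => p q p1 q1 p0 q0.
  rewrite (ger0_norm q0) mulr_ile1// ler_norml.
  by case: (i == j) => /=; apply/andP; split; lra.
rewrite /fisher_bound (bigD1 i)//= (bigD1 j)//= -!addrA lerDl.
by rewrite addr_ge0 ?sumr_ge0// => k _; exact: sumr_ge0.
Qed.

Lemma continuous_share x j : \sum_(i < N.+1) rate b i * x ord0 i != 0 ->
  {for x, continuous (share^~ j)}.
Proof.
move=> s0; have cx (i : 'I_N.+1) : {for x, continuous (fun x => rate b i * x ord0 i)}.
  apply: (@continuousM _ _ (cst (rate b i))); first exact: cst_continuous.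
  exact: (@coord_continuous R 1 N.+1 ord0 i x).
apply: (continuousM (cx j)); apply: (continuousV s0).
exact: continuous_sum_rV.
Qed.

Lemma continuous_fisher x i j : \sum_(i < N.+1) rate b i * x ord0 i != 0 ->
  {for x, continuous (fun x => fisher x i j)}.
Proof.
move=> s0; rewrite (_ : (fun x => _) = fun x =>
  (share x (lift ord0 i) * (i == j)%:R - share x (lift ord0 i) * share x (lift ord0 j)) *
   (b ord0 i * b ord0 j)^-1); last by apply/funext => y; rewrite mxE.
have cs (k : 'I_N) := @continuous_share x (lift ord0 k) s0.
have cst_ (c : R) := @cst_continuous 'rV[R]_N.+1 R c x.
exact: (continuousM (continuousB (continuousM (cs i) (cst_ _)) (continuousM (cs i) (cs j))) (cst_ _)).
Qed.

(** The variance of a variable with value v_i / b_i on type i and 0 on type 0; [A] is its mean. *)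
Lemma bilin_fisher x (v : 'rV[R]_N) (A : R) : \sum_(i < N.+1) rate b i * x ord0 i != 0 ->
  A = \sum_i v ord0 i / b ord0 i * share x (lift ord0 i) ->
  bilin (fisher x) v v =
    A ^+ 2 * share x ord0 + \sum_i (v ord0 i / b ord0 i - A) ^+ 2 * share x (lift ord0 i).
Proof.
move=> s0 AE; have := sum_share s0; rewrite big_ord_recl => s1.
pose u i := v ord0 i / b ord0 i.
have -> : bilin (fisher x) v v = \sum_i u i ^+ 2 * share x (lift ord0 i) - A ^+ 2.
  rewrite bilin_sum expr2 {1}AE mulr_suml -sumrB; apply: eq_bigr => i _.
  transitivity (\sum_j u i * u j * (share x (lift ord0 i) * (i == j)%:R) -
      u i * share x (lift ord0 i) * A).
    rewrite AE mulr_sumr -sumrB; apply: eq_bigr => j _; rewrite mxE /u.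
    by field; rewrite !gt_eqF.
  congr (_ - _); rewrite (bigD1 i)//= eqxx mulr1 big1 ?addr0 => [|j ji]; first by ring.
  by rewrite eq_sym (negPf ji) !mulr0.
transitivity (\sum_i u i ^+ 2 * share x (lift ord0 i) - 2 * A * A +
    A ^+ 2 * (share x ord0 + \sum_(i < N) share x (lift ord0 i))).
  by rewrite s1; ring.
rewrite {2}AE mulr_sumr mulrDr mulr_sumr addrCA -sumrB -big_split/=; congr (_ + _).
by apply: eq_bigr => i _; rewrite -/(u i); ring.
Qed.

(** The value 0 on type 0, which has positive probability, excludes a nonzero constant variable:
    here the normalisation beta_0 = 1 makes the parameter identifiable. *)
Lemma bilin_fisher_gt0 x v : (forall i, 0 < x ord0 i) -> v != 0 -> 0 < bilin (fisher x) v v.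
Proof.
move=> x0 v0; have r0 (i : 'I_N.+1) : 0 < rate b i.
  by case: (unliftP ord0 i) => [j ->|->]; rewrite ?rate_lift ?b0.
have S0 : 0 < \sum_(i < N.+1) rate b i * x ord0 i.
  rewrite big_ord_recl ltr_pwDl ?mulr_gt0// sumr_ge0// => i _.
  by rewrite mulr_ge0// ltW// r0.
have s0 i : 0 < share x i by rewrite divr_gt0// mulr_gt0.
pose A := \sum_i v ord0 i / b ord0 i * share x (lift ord0 i).
rewrite (bilin_fisher _ (erefl A)) ?gt_eqF//.
have t0 i : 0 <= (v ord0 i / b ord0 i - A) ^+ 2 * share x (lift ord0 i).
  by rewrite mulr_ge0 ?sqr_ge0// ltW.
have [A0|A0] := eqVneq A 0; last first.
  by rewrite ltr_pwDl ?sumr_ge0// mulr_gt0// exprn_even_gt0.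
have [i vi] : exists i, v ord0 i != 0.
  apply: contrapT => h; move: v0; apply/negP; rewrite negbK; apply/eqP/rowP => i.
  by rewrite mxE; apply/eqP/negPn/negP => vi; apply: h; exists i.
apply: ltr_wpDl; first by rewrite mulr_ge0 ?sqr_ge0// ltW.
rewrite (bigD1 i)//=; apply: ltr_pwDl; last by rewrite sumr_ge0.
by rewrite mulr_gt0// exprn_even_gt0//= A0 subr0 mulf_neq0// invr_eq0 gt_eqF.
Qed.

Variables (gamma : nat -> R -> R) (mu : R).
Hypothesis mu0 : 0 < mu.
Hypothesis gamma0 : forall (j : nat) l, (j <= N)%N -> 0 < l < mu -> 0 < gamma j l.
Hypothesis gammac : forall (j : nat) l, (j <= N)%N -> 0 < l < mu -> {for l, continuous (gamma j)}.

Definition density_row l : 'rV[R]_N.+1 := \row_j gamma j l.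

Let D : set R := `]0, mu[%classic.

Lemma density_row_gt0 l i : 0 < l < mu -> 0 < density_row l ord0 i.
Proof. by move=> lD; rewrite mxE gamma0// -ltnS. Qed.

Lemma sum_density_row l : \sum_(i < N.+1) rate b i * density_row l ord0 i = Z gamma b l.
Proof.
rewrite big_ord_recl mxE mul1r /Z; congr (_ + _).
by apply: eq_bigr => i _; rewrite mxE rate_lift.
Qed.

Lemma Z_gt0 l : 0 < l < mu -> 0 < Z gamma b l.
Proof.
move=> lD; rewrite ltr_pwDl ?gamma0// sumr_ge0// => i _.
by rewrite mulr_ge0 ?ltW ?gamma0.
Qed.

Lemma Q_fisher l : 0 < l < mu -> Q gamma b l = fisher (density_row l).
Proof.
move=> lD; have Z0 := Z_gt0 lD.
apply/matrixP => i j; rewrite !mxE /share sum_density_row !mxE !rate_lift !lift0.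
case: eqVneq => [<-|_]; rewrite ?mulr1 ?mulr0; field; by rewrite !gt_eqF ?b0.
Qed.

Lemma Q_le l i j : 0 < l < mu -> `|Q gamma b l i j| <= fisher_bound.
Proof.
by move=> lD; rewrite Q_fisher// fisher_le// => k; rewrite ltW// density_row_gt0.
Qed.

Let measurable_Q i j : measurable_fun D (fun l => Q gamma b l i j).
Proof.
apply: open_continuous_measurable_fun; first exact: interval_open.
move=> l; rewrite inE /D/= in_itv/= => lD.
have cg (k : nat) : (k <= N)%N -> {for l, continuous (gamma k)} by move=> kN; exact: gammac.
have cst_ (c : R) := @cst_continuous R R c l.
have cZ : {for l, continuous (Z gamma b)}.
  apply: (continuousD (cg 0%N _)) => //.
  have : forall s : seq 'I_N, {for l, continuous (fun l => \sum_(i <- s) b ord0 i * gamma i.+1 l)}.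
    elim=> [|k s ih].
      rewrite (_ : (fun _ => _) = cst 0); first exact: cst_continuous.
      by apply/funext => y; rewrite big_nil.
    rewrite (_ : (fun _ => _) = (fun l => b ord0 k * gamma k.+1 l) \+
        (fun l => \sum_(i <- s) b ord0 i * gamma i.+1 l)).
      exact: (continuousD (continuousM (cst_ _) (cg _ _)) ih).
    by apply/funext => y; rewrite big_cons.
  exact.
have Z0 : Z gamma b l != 0 by rewrite gt_eqF// Z_gt0.
rewrite (_ : (fun l => _) = fun l =>
  (gamma i.+1 l / (b ord0 i * Z gamma b l) * (i == j)%:R -
   gamma i.+1 l * gamma j.+1 l / Z gamma b l ^+ 2)); last by apply/funext => y; rewrite mxE.
have bZ : ((fun=> b ord0 i) \* Z gamma b) l != 0 by rewrite mulf_neq0// gt_eqF.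
have ZZ : (Z gamma b \* Z gamma b) l != 0 by rewrite mulf_neq0.
have gi := cg _ (ltn_ord i); have gj := cg _ (ltn_ord j).
have c1 := continuousM (continuousM gi (continuousV bZ (continuousM (cst_ (b ord0 i)) cZ)))
  (cst_ (i == j)%:R).
have c2 := continuousM (continuousM gi gj) (continuousV ZZ (continuousM cZ cZ)).
exact: (continuousB c1 c2).
Qed.

Let mD : measurable D. Proof. exact: measurable_itv. Qed.

Let lebesgue_D : lebesgue_measure D = mu%:E.
Proof. by rewrite /D lebesgue_measure_itv/= lte_fin mu0 -EFinB subr0. Qed.

Let integrable_Q i j : lebesgue_measure.-integrable D (EFin \o (fun l => Q gamma b l i j)).
Proof.
apply: measurable_bounded_integrable => //.
  by rewrite [X in (X < _)%E]lebesgue_D ltry.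
  exact: measurable_Q.
exists fisher_bound; split => [|M BM l]; first exact: num_real.
rewrite /D/= in_itv/= => lD; apply: le_trans (ltW BM); exact: Q_le.
Qed.

(** The quadratic form of Q is positive on all of ]0, mu[; a zero integral would make it vanish
    almost everywhere there, against the positive length of the interval. *)
Lemma posdef_J : posdef (J gamma b mu).
Proof.
split.
  apply/matrixP => i j; rewrite !mxE; apply: eq_Rintegral => l _.
  rewrite !mxE [gamma j.+1 l * gamma _ _]mulrC; congr (_ - _).
  by case: eqVneq => [->|_]; rewrite ?mulr0.
move=> v v0.
pose f l := bilin (Q gamma b l) v v.
have fE : f = fun l => \sum_i \sum_j v ord0 i * v ord0 j * Q gamma b l i j.
  by apply/funext => l; rewrite /f bilin_sum; apply: eq_bigr => i _; apply: eq_bigr => j _; ring.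
have mf : measurable_fun D f.
  rewrite fE; apply: measurable_sum => i; apply: measurable_sum => j.
  by apply: measurable_funM => //; exact: measurable_Q.
have int_sum (s : seq 'I_N) (F : 'I_N -> R -> R) :
    (forall i, lebesgue_measure.-integrable D (EFin \o F i)) ->
    lebesgue_measure.-integrable D (EFin \o (fun l => \sum_(i <- s) F i l)) /\
    \int[lebesgue_measure]_(l in D) \sum_(i <- s) F i l =
    \sum_(i <- s) \int[lebesgue_measure]_(l in D) F i l.
  move=> iF; elim: s => [|i s [ih1 ih2]].
    have E0 : (fun l => \sum_(i <- [::]) F i l) = cst 0 by apply/funext => l; rewrite big_nil.
    rewrite big_nil E0 /Rintegral; split; last by rewrite integral0.
    exact: integrable0.
  have ES : (fun l => \sum_(i <- i :: s) F i l) = F i \+ (fun l => \sum_(i <- s) F i l).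
    by apply/funext => l; rewrite big_cons.
  rewrite big_cons ES -ih2; split; last exact: RintegralD.
  rewrite (_ : EFin \o _ = ((EFin \o F i) \+ (EFin \o (fun l => (\sum_(i <- s) F i l)%R)))%E)//.
  exact: integrableD.
have iQ i j : lebesgue_measure.-integrable D
    (EFin \o (fun l => v ord0 i * v ord0 j * Q gamma b l i j)).
  rewrite (_ : EFin \o _ = (fun l => (v ord0 i * v ord0 j)%:E *
    (EFin \o (fun l => Q gamma b l i j)) l)%E)//.
  exact: (integrableZl _ _ (integrable_Q i j)).
have ij i := int_sum (index_enum 'I_N) (fun j l => v ord0 i * v ord0 j * Q gamma b l i j) (iQ i).
have [intf If] := int_sum (index_enum 'I_N)
  (fun i l => \sum_j v ord0 i * v ord0 j * Q gamma b l i j) (fun i => (ij i).1).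
have -> : bilin (J gamma b mu) v v = \int[lebesgue_measure]_(l in D) f l.
  rewrite bilin_sum fE If; apply: eq_bigr => i _; rewrite (ij i).2; apply: eq_bigr => j _.
  rewrite RintegralZl//.
  by rewrite mxE; ring.
have f0 l : D l -> 0 < f l.
  rewrite /D/= in_itv/= => lD; rewrite /f Q_fisher// bilin_fisher_gt0// => i.
  exact: density_row_gt0.
rewrite lt_neqAle; apply/andP; split; last by apply: Rintegral_ge0 => l /f0/ltW.
apply/negP => /eqP I0.
have : (\int[lebesgue_measure]_(l in D) `|(f l)%:E|)%E = 0%E.
  transitivity (\int[lebesgue_measure]_(l in D) (f l)%:E)%E.
    by apply: eq_integral => l /set_mem/f0/ltW fl; rewrite gee0_abs// lee_fin.
  rewrite -[LHS]fineK; first by rewrite -[X in X%:E]I0.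
  by apply: integrable_fin_num; [exact: mD|rewrite fE].
have mfE : measurable_fun D (EFin \o f) by exact/measurable_EFinP.
have /iffLR/[apply] := @ae_eq_integral_abs _ _ R lebesgue_measure D mD (EFin \o f) mfE.
move=> [A [mA A0 sub]].
have : (lebesgue_measure D <= lebesgue_measure A)%E.
  apply: le_measure; rewrite ?inE//.
  apply: subset_trans sub => l Dl /= /(_ Dl)[] fl.
  by have := f0 _ Dl; rewrite fl ltxx.
by rewrite A0 lebesgue_D lee_fin leNgt mu0.
Qed.

End fisher_matrix.

(** * Law of large numbers for the information *)

Section information_limit.
Context {R : realType} (d N : nat) (r : R).
Context {disp : nat -> measure_display} {Omega : forall m, measurableType (disp m)}
  (P : forall m, probability (Omega m) R).
Variable X : forall m, nat -> {RV (P m) >-> 'rV[R]_d}.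
Variable b : 'rV[R]_N.
Hypothesis b0 : positive b.

Let PT m := probability_setT (P m).

Lemma near_prob_le (Y : forall m, Omega m -> R) (c : R) :
  cvg_in_probability P (fun m w => (Y m w)%:E) c ->
  forall e del : R, 0 < e -> 0 < del ->
  \forall m \near \oo, fine (P m [set w | e <= `|Y m w - c|]) <= del.
Proof.
move=> cY e del e0 del0; have := cY e e0 => /fine_cvg/cvgrPdist_le/(_ _ del0).
apply: filterS => m; rewrite sub0r normrN => /(le_trans (ler_norm _)).
apply: le_trans; rewrite le_eqVlt; apply/orP; left; apply/eqP; congr (fine (P m _)).
Qed.

Definition Gamma_row m k (w : Omega m) : 'rV[R]_N.+1 :=
  \row_j Gamma r m j (first_points (X m) k w).

Lemma Gamma_row_ge0 m k (w : Omega m) i : 0 <= Gamma_row k w ord0 i.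
Proof. by rewrite mxE Gamma_ge0. Qed.

Lemma total_rate_row m k (w : Omega m) :
  total_rate r m b (first_points (X m) k w) = \sum_(j < N.+1) rate b j * Gamma_row k w ord0 j.
Proof. by rewrite total_rateE; apply: eq_bigr => j _; rewrite mxE. Qed.

Lemma share_type_prob m k (w : Omega m) (j : 'I_N.+1) :
  share b (Gamma_row k w) j = type_prob r m b j (first_points (X m) k w).
Proof.
rewrite /share /type_prob -total_rate_row mxE.
case: ifPn => // h; have := total_rate_ge0 r m (first_points (X m) k w) b0.
by rewrite le_eqVlt (negPf h) orbF => /eqP <-; rewrite invr0 mulr0.
Qed.

Lemma shareZ (a : R) (x : 'rV[R]_N.+1) j : a != 0 -> share b (a *: x) j = share b x j.
Proof.
move=> a0; rewrite /share; under eq_bigr do rewrite mxE mulrCA.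
by rewrite -mulr_sumr mxE mulrCA invfM mulrACA divff// mul1r.
Qed.

Lemma fisherZ (a : R) (x : 'rV[R]_N.+1) : a != 0 -> fisher b (a *: x) = fisher b x.
Proof. by move=> a0; apply/matrixP => i j; rewrite !mxE !shareZ. Qed.

Lemma bdm_fisher m k i j : bdm (fun w : Omega m => fisher b (Gamma_row k w) i j).
Proof.
have bs (l : 'I_N.+1) : bdm (fun w : Omega m => share b (Gamma_row k w) l).
  under eq_fun do rewrite share_type_prob.
  apply: (bdm_first_points (X m) (a := fun y : k.-tuple _ => type_prob r m b l y)).
  by apply: bdm_type_prob => //; rewrite -ltnS.
under eq_fun do rewrite mxE.
apply: bdmM (bdm_cst _); apply: bdmB (bdmM (bs _) (bs _)).
exact: bdmM (bs _) (bdm_cst _).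
Qed.

Variables (gamma : nat -> R -> R) (mu : R).
Hypothesis mu0 : 0 < mu.
Hypothesis gamma0 : forall (j : nat) l, (j <= N)%N -> 0 < l < mu -> 0 < gamma j l.
Hypothesis gammac : forall (j : nat) l, (j <= N)%N -> 0 < l < mu -> {for l, continuous (gamma j)}.
Hypothesis hgamma : forall j (l : R) (k : nat -> nat), (j <= N)%N ->
    0 < l < mu -> (k m)%:R / m%:R @[m --> \oo] --> l ->
    cvg_in_probability P
      (fun m w => (Gamma r m j (first_points (X m) (k m) w) / m%:R)%:E) (gamma j l).

Lemma measurable_Gamma_dist m j k (c e : R) :
  measurable [set w : Omega m | e <= `|Gamma r m j (first_points (X m) k w) / m%:R - c|].
Proof.
have mf : measurable_fun setT
    (fun w : Omega m => `|Gamma r m j (first_points (X m) k w) / m%:R - c|).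
  apply: measurableT_comp => //; apply: measurable_funB => //; apply: measurable_funM => //.
  apply: (measurableT_comp (f := fun y : k.-tuple _ => Gamma r m j y)); first exact: measurable_Gamma.
  exact: measurable_first_points.
have := mf measurableT _ (measurable_itv `[e, +oo[); rewrite setTI.
by congr measurable; apply/seteqP; split => w /=; rewrite in_itv/= andbT.
Qed.

(** Continuous mapping at the limiting densities, where the normalizer is positive; boundedness of
    [fisher] upgrades convergence in probability to convergence in mean. *)
Lemma cvg_fisher l i j : 0 < l < mu ->
  \int[P m]_w `|fisher b (Gamma_row (Num.truncn (l * m%:R)) w) i j - Q gamma b l i j|
    @[m --> \oo] --> 0.
Proof.
move=> lD; have l0 : 0 <= l by case/andP: lD => /ltW.
have hg k (kN : (k <= N)%N) := near_prob_le (hgamma kN lD (cvg_truncn_ratio l0)).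
have Z0 := Z_gt0 b0 gamma0 lD.
apply/cvgrPdist_le => e e0; pose B := fisher_bound b.
have B0 : 0 <= B.
  apply: sumr_ge0 => i' _; apply: sumr_ge0 => j' _.
  by rewrite invr_ge0 mulr_ge0// ltW.
have S0 : \sum_(i < N.+1) rate b i * density_row gamma l ord0 i != 0.
  by rewrite sum_density_row gt_eqF.
have e20 : 0 < e / 2 by rewrite divr_gt0.
have := @continuous_fisher _ _ b _ i j S0 => /cvgrPdist_lt/(_ _ e20)/nbhs_normP[eta eta0 heta].
(* With this choice the N + 1 exceptional events, on which the error is at most 2 B, contribute at
   most e / 2. *)
pose del := e / (4 * B * N.+1%:R + 1).
have den0 : 0 < 4 * B * N.+1%:R + 1 by rewrite ltr_wpDl ?mulr_ge0.
have del0 : 0 < del by rewrite divr_gt0.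
pose T m k := [set w : Omega m | eta / 2 <= `|Gamma r m k (first_points (X m) (Num.truncn (l * m%:R)) w) / m%:R - gamma k l|].
have hT : \forall m \near \oo, forall k : 'I_N.+1, fine (P m (T m k)) <= del.
  by apply: filter_forall => k; apply: (hg k _ (eta / 2) del) => //; rewrite ?divr_gt0// -ltnS.
near=> m.
have m0 : (0 < m)%N by near: m; exact: nbhs_infty_gt.
have hTm : forall k : 'I_N.+1, fine (P m (T m k)) <= del by near: m.
have mT k : measurable (T m k) by exact: measurable_Gamma_dist.
have bI (k : nat) : bdm (\1_(T m k) : Omega m -> R) by exact: bdm_indic.
have bS : bdm (fun w : Omega m => \sum_(k < N.+1) \1_(T m k) w : R) by apply: bdm_sum => k _.
rewrite sub0r normrN ger0_norm; last exact: Rintegral_ge0.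
apply: (@le_trans _ _ (\int[P m]_w (e / 2 + 2 * B * \sum_(k < N.+1) \1_(T m k) w))).
  apply: (le_Ex (PT m)).
  - by apply: bdm_norm; apply: bdmB (bdm_cst _); exact: bdm_fisher.
  - exact: bdmD (bdm_cst _) (bdmM (bdm_cst _) bS).
  - move=> w; set x := Gamma_row _ w.
    have [[k Tk]|nT] := pselect (exists k : 'I_N.+1, T m k w).
      rewrite -[leLHS]add0r lerD ?(ltW e20)// (@le_trans _ _ (2 * B * 1))//.
        rewrite mulr1 (le_trans (ler_normB _ _))// mulr_natl mulr2n lerD//.
          by apply: fisher_le => // k'; exact: Gamma_row_ge0.
        exact: (Q_le b0 gamma0).
      rewrite ler_wpM2l ?mulr_ge0// (bigD1 k)//= indicE mem_set// lerDl.
      by rewrite sumr_ge0// => k' _.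
    rewrite -[leLHS]addr0 lerD//; last by rewrite !mulr_ge0// sumr_ge0.
    (* By homogeneity the areas may be divided by m, the scale on which they converge. *)
    rewrite distrC (Q_fisher b0 gamma0)// -(fisherZ x (_ : m%:R^-1 != 0)) ?invr_eq0 ?pnatr_eq0 -?lt0n//.
    apply/ltW/heta; rewrite /= distrC.
    apply: (@le_lt_trans _ _ (eta / 2)); last by rewrite ltr_pdivrMr// ltr_pMr// ltr1n.
    apply: norm_le_coord => [|k]; first by rewrite divr_ge0 ?ltW.
    rewrite leNgt; apply/negP => hk; apply: nT; exists k.
    by rewrite /T /= (le_trans (ltW hk))// !mxE mulrC.
rewrite (ExD (PT m) (bdm_cst _) (bdmM (bdm_cst _) bS)) (Ex_cst (PT m)) (ExZ (PT m) _ bS).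
rewrite (Ex_sum (PT m)) => [|k _]; last exact: bI.
apply: (@le_trans _ _ (e / 2 + 2 * B * \sum_(k < N.+1) del)).
  rewrite lerD2l ler_wpM2l ?mulr_ge0//; apply: ler_sum => k _.
  rewrite (Ex_indic _ (mT k)); exact: hTm.
rewrite sumr_const card_ord -[del *+ _]mulr_natl.
have : 4 * B * N.+1%:R * del <= e.
  by rewrite /del mulrCA ler_piMr ?(ltW e0)// ler_pdivrMr// mul1r lerDl.
lra.
Unshelve. all: end_near. Qed.

Lemma information_lln ell i j : (ell m)%:R / m%:R @[m --> \oo] --> mu ->
  \int[P m]_w `|m%:R^-1 * \sum_(k < ell m) fisher b (Gamma_row k w) i j - J gamma b mu i j|
    @[m --> \oo] --> 0.
Proof.
move=> hell; rewrite mxE.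
apply: (@law_of_large_numbers _ _ _ P (fun m k w => fisher b (Gamma_row k w) i j) (fisher_bound b)
   (fun l => Q gamma b l i j) mu) => //.
- by move=> m k; exact: bdm_fisher.
- by move=> m k w; apply: fisher_le => // l; exact: Gamma_row_ge0.
- by move=> l lD; exact: (Q_le b0 gamma0).
- by move=> l lD; exact: cvg_fisher.
Qed.

End information_limit.

(** * Asymptotic normality of the score *)

Section score_limit.
Context {R : realType} (d N : nat) (r : R).
Context {disp : nat -> measure_display} {Omega : forall m, measurableType (disp m)}
  (P : forall m, probability (Omega m) R).
Variable X : forall m, nat -> {RV (P m) >-> 'rV[R]_d}.
Variable b : 'rV[R]_N.
Hypothesis b0 : positive b.
Local Notation Grow := (Gamma_row N r X).

Let PT m := probability_setT (P m).

(** The coefficients c_j of the direction v. The indexing of [rate] is reused for v_i / b_i; its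
    value 1 at j = 0 is replaced by 0, since beta_0 is not a parameter. *)
Definition contrast (v : 'rV[R]_N) (j : nat) : R :=
  if j is 0%N then 0 else rate (\row_i (v ord0 i / b ord0 i)) j.

Lemma contrast_lift v (i : 'I_N) : contrast v (lift ord0 i) = v ord0 i / b ord0 i.
Proof. by rewrite /contrast lift0 -[i.+1]/(nat_of_ord (lift ord0 i)) rate_lift mxE. Qed.

Definition contrast_bound (v : 'rV[R]_N) := \sum_i `|v ord0 i / b ord0 i|.

Lemma contrast_bound_ge0 v : 0 <= contrast_bound v.
Proof. exact: sumr_ge0. Qed.

Lemma contrast_le v j : `|contrast v j| <= contrast_bound v.
Proof.
case: j => [|j]; first by rewrite normr0 contrast_bound_ge0.
rewrite /contrast /rate; case: insubP => [i _ _|_] /=; last by rewrite normr0 contrast_bound_ge0.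
by rewrite mxE /contrast_bound (bigD1 i)//= lerDl sumr_ge0.
Qed.

Definition score_row m n (w : Omega m) : 'rV[R]_N := (Num.sqrt m%:R)^-1 *:
  \row_i score r m b (X m) (contrast (delta_mx ord0 i)) n w.

Lemma dot_score_row m n (w : Omega m) v :
  dot v (score_row n w) = (Num.sqrt m%:R)^-1 * score r m b (X m) (contrast v) n w.
Proof.
rewrite dotC [LHS]/dot; under eq_bigr do rewrite !mxE -mulrA.
rewrite -mulr_sumr; congr (_ * _); rewrite /score.
under eq_bigr do rewrite mulr_suml.
rewrite exchange_big/=; apply: eq_bigr => k _; rewrite /increment.
under eq_bigr do rewrite mulr_suml.
rewrite exchange_big/=; apply: eq_bigr => j _.
under eq_bigr do rewrite mulrAC.
rewrite -mulr_suml; congr (_ * _).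
case: (unliftP ord0 j) => [l ->|->]; last by rewrite big1// => i _; rewrite mul0r.
rewrite contrast_lift (bigD1 l)// contrast_lift big1 => [|i il].
  by rewrite [LHS]addr0 mxE !eqxx mul1r mulrC.
by rewrite contrast_lift mxE eqxx eq_sym (negPf il)/= mul0r mul0r.
Qed.

(** Two expressions of one variance; after jamming both are 0. *)
Lemma cond_var_fisher m k (w : Omega m) v :
  cond_var r m b (X m) (contrast v) k w = bilin (fisher b (Grow k w)) v v.
Proof.
pose x := Grow k w.
have shareE (j : 'I_N.+1) : type_prob r m b j (first_points (X m) k w) = share b x j.
  by rewrite share_type_prob.
have driftE : drift r m b (X m) (contrast v) k w =
    \sum_i v ord0 i / b ord0 i * share b x (lift ord0 i).
  rewrite /drift big_ord_recl mul0r add0r; apply: eq_bigr => i _.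
  by rewrite contrast_lift shareE.
have [s0|s0] := eqVneq (\sum_(i < N.+1) rate b i * x ord0 i) 0.
  have sh0 j : share b x j = 0 by rewrite /share s0 invr0 mulr0.
  rewrite /cond_var big1 => [|j _]; last by rewrite shareE sh0 mulr0.
  rewrite bilin_sum big1// => i _; rewrite big1// => j _.
  by rewrite mxE !sh0 !mul0r subr0 mul0r mulr0 mul0r.
rewrite (bilin_fisher b0 s0 (erefl _)) -driftE /cond_var big_ord_recl shareE.
rewrite [contrast v _]/(0 : R) sub0r sqrrN; congr (_ + _).
by apply: eq_bigr => i _; rewrite contrast_lift shareE.
Qed.

Variable ell : nat -> nat.
Variable mu : R.
Hypothesis mu0 : 0 < mu.
Hypothesis hell : (ell m)%:R / m%:R @[m --> \oo] --> mu.
Hypothesis hX : forall m, (0 < m)%N -> is_csa r m b (X m).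
Variable S : 'M[R]_N.
Hypothesis info_lln : forall i j,
  \int[P m]_w `|m%:R^-1 * \sum_(k < ell m) fisher b (Grow k w) i j - S i j| @[m --> \oo] --> 0.

Let bdm_score m n c : bdm (score r m b (X m) c n).
Proof. exact: (adapted_bdm (adapted_score r m (X m) b0 c n)). Qed.

Let near_ell : \forall m \near \oo, (ell m)%:R / m%:R <= mu + 1.
Proof.
have := hell => /cvgrPdist_le/(_ _ ltr01); apply: filterS => m.
rewrite distrC ler_norml => /andP[_]; lra.
Qed.

Lemma score_row_sq v : \forall m \near \oo,
  \int[P m]_w (dot v (score_row (ell m) w) ^+ 2) <= (mu + 1) * (2 * contrast_bound v) ^+ 2.
Proof.
near=> m; have m0 : (0 < m)%N by near: m; exact: nbhs_infty_gt.
under eq_Rintegral do rewrite dot_score_row exprMn.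
rewrite (ExZ (PT m) _ (bdmX 2 (bdm_score _ _ _))) exprVn sqr_sqrtr//.
apply: (@le_trans _ _ (m%:R^-1 * ((ell m)%:R * (2 * contrast_bound v) ^+ 2))).
  rewrite ler_wpM2l ?invr_ge0//; apply: expectation_score_sq => //; first exact: hX.
  exact: contrast_le.
rewrite mulrA [m%:R^-1 * _]mulrC ler_wpM2r ?sqr_ge0//.
by near: m; exact: near_ell.
Unshelve. all: end_near. Qed.

(** The exponent of the compensator at t = m^(-1/2). *)
Let A v m (w : Omega m) := m%:R^-1 / 2 * \sum_(k < ell m) cond_var r m b (X m) (contrast v) k w.

Let bdm_A v m : bdm (@A v m).
Proof.
apply: bdmM (bdm_cst _) _; apply: bdm_sum => k _.
exact: (adapted_bdm (adapted_cond_var r m (X m) b0 _ _)).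
Qed.

Let cvg_A v : \int[P m]_w `|A v w - bilin S v v / 2| @[m --> \oo] --> 0.
Proof.
pose F m i j (w : Omega m) :=
  `|m%:R^-1 * \sum_(k < ell m) fisher b (Grow k w) i j - S i j|.
have bF m i j : bdm (F m i j).
  apply: bdm_norm; apply: bdmB (bdm_cst _); apply: bdmM (bdm_cst _) _.
  by apply: bdm_sum => k _; exact: bdm_fisher.
have cv : \sum_i \sum_j `|v ord0 i * v ord0 j| / 2 * \int[P m]_w F m i j w @[m --> \oo] --> 0.
  rewrite [X in _ --> X](_ : _ = \sum_(i < N) \sum_(j < N) `|v ord0 i * v ord0 j| / 2 * 0).
    apply: cvg_big => [|i _]; first exact: add_continuous.
    apply: cvg_big => [|j _]; first exact: add_continuous.
    by apply: cvgMr; exact: info_lln.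
  by rewrite big1// => i _; rewrite big1// => j _; rewrite mulr0.
apply: (squeeze_cvgr _ (cvg_cst 0) cv); apply: nearW => m.
rewrite Rintegral_ge0//=.
have bFF i : bdm (fun w => \sum_j `|v ord0 i * v ord0 j| / 2 * F m i j w).
  by apply: bdm_sum => j _; exact: bdmM (bdm_cst _) (bF _ _ _).
apply: (@le_trans _ _ (\int[P m]_w (\sum_i \sum_j `|v ord0 i * v ord0 j| / 2 * F m i j w))).
  apply: (le_Ex (PT m)).
  - by apply: bdm_norm; apply: bdmB (bdm_A _ _) (bdm_cst _).
  - by apply: bdm_sum => i _.
  - move=> w; rewrite (_ : A v w - _ = \sum_i \sum_j (v ord0 i * v ord0 j) / 2 *
      (m%:R^-1 * \sum_(k < ell m) fisher b (Grow k w) i j - S i j)); last first.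
      rewrite /A; under eq_bigr do rewrite cond_var_fisher bilin_sum.
      rewrite exchange_big bilin_sum mulr_sumr mulr_suml -sumrB/=; apply: eq_bigr => i _.
      rewrite exchange_big mulr_sumr mulr_suml -sumrB/=; apply: eq_bigr => j _.
      rewrite (_ : \sum_(k < ell m) v ord0 i * _ * _ =
        v ord0 i * v ord0 j * \sum_(k < ell m) fisher b (Grow k w) i j); first by ring.
      by rewrite mulr_sumr; apply: eq_bigr => k _; ring.
    rewrite (le_trans (ler_norm_sum _ _ _))//; apply: ler_sum => i _.
    rewrite (le_trans (ler_norm_sum _ _ _))//; apply: ler_sum => j _.
    by rewrite normrM [`|_ / 2|]normrM normfV (ger0_norm (ler0n _ 2)).
rewrite (Ex_sum (PT m))//; apply: ler_sum => i _.
rewrite (Ex_sum (PT m)) => [|j _]; last exact: bdmM (bdm_cst _) (bF _ _ _).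
by apply: ler_sum => j _; rewrite (ExZ (PT m)).
Qed.

Let expR_lip (x y M : R) : x <= M -> y <= M -> `|expR x - expR y| <= expR M * `|x - y|.
Proof.
have one (u v : R) : u <= v -> v <= M -> `|expR v - expR u| <= expR M * `|v - u|.
  move=> uv vM; rewrite ger0_norm ?subr_ge0 ?ler_expR// (ger0_norm (_ : 0 <= v - u)) ?subr_ge0//.
  apply: (@le_trans _ _ (expR v * (v - u))); last first.
    by rewrite ler_wpM2r ?subr_ge0// ler_expR.
  have -> : expR u = expR v * expR (u - v) by rewrite -expRD addrC subrK.
  rewrite -{1}[expR v]mulr1 -mulrBr ler_wpM2l ?expR_ge0//.
  by have := expR_ge1Dx (u - v); lra.
move=> xM yM; have [xy|/ltW yx] := leP x y; last exact: one.
by rewrite distrC [`|x - y|]distrC; exact: one.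
Qed.

(** The random exponent [A] is replaced by its limit s: both are at most [M], below which the
    exponential is Lipschitz, so convergence in mean of [A] suffices. Dividing by exp s gives the
    claim. *)
Lemma cvg_char_score v (a : R) :
  \int[P m]_w cos (dot v (score_row (ell m) w) + a) @[m --> \oo] -->
  expR (- bilin S v v / 2) * cos a.
Proof.
pose s := bilin S v v / 2; pose C := contrast_bound v; pose t m : R := (Num.sqrt m%:R)^-1.
have C0 : 0 <= C := contrast_bound_ge0 v.
pose M := (mu + 1) / 2 * (2 * C) ^+ 2 + `|s|.
have t_cvg : t m @[m --> \oo] --> 0.
  apply/cvgrPdist_le => e e0; near=> m.
  have sm : e^-1 <= Num.sqrt (m%:R : R) by near: m; exact: near_le_sqrt.
  rewrite sub0r normrN ger0_norm ?invr_ge0 ?sqrtr_ge0// -[leRHS]invrK lef_pV2 ?posrE ?invr_gt0//.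
  by rewrite (lt_le_trans _ sm)// invr_gt0.
(* The bound of [characteristic_score] at t = m^(-1/2) and n = [ell m]. *)
pose err m := (ell m)%:R / m%:R * (5 * (2 * C) ^+ 3 * t m) *
  expR ((ell m)%:R / m%:R * ((2 * C) ^+ 2 / 2)).
have err_cvg : err m @[m --> \oo] --> 0.
  rewrite [X in _ --> X](_ : _ = mu * (5 * (2 * C) ^+ 3 * 0) * expR (mu * ((2 * C) ^+ 2 / 2))).
    apply: cvgM; first by apply: cvgM => //; exact: cvgMr.
    apply: continuous_cvg; first exact: continuous_expR.
    by apply: cvgM => //; exact: cvg_cst.
  by rewrite !(mulr0, mul0r).
suff cv : expR s * \int[P m]_w cos (dot v (score_row (ell m) w) + a) @[m --> \oo] --> cos a.
  rewrite (_ : (fun m => _) = (fun m => expR (- s) * (expR s *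
      \int[P m]_w cos (dot v (score_row (ell m) w) + a)))); last first.
    by apply/funext => m; rewrite mulrA -expRD addNr expR0 mul1r.
  by rewrite mulNr; exact: cvgMr.
apply/subr_cvg0; apply: norm_cvg0.
have cv0 : err m + expR M * \int[P m]_w `|A v w - s| @[m --> \oo] --> 0.
  rewrite [X in _ --> X](_ : _ = 0 + expR M * 0); last by rewrite mulr0 addr0.
  by apply: cvgD => //; apply: cvgMr; exact: cvg_A.
apply: (squeeze_cvgr _ (cvg_cst 0) cv0); near=> m; rewrite normr_ge0/=.
have m0 : (0 < m)%N by near: m; exact: nbhs_infty_gt.
have mr0 : 0 < m%:R :> R by rewrite ltr0n.
have tm0 : 0 <= t m by rewrite invr_ge0 sqrtr_ge0.
have t2 : t m ^+ 2 = m%:R^-1 by rewrite exprVn sqr_sqrtr.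
have tsmall : 2 * `|t m| * C <= 1.
  have : 2 * C <= Num.sqrt (m%:R : R) by near: m; exact: near_le_sqrt.
  by rewrite ger0_norm// mulrAC /t ler_pdivrMr ?sqrtr_gt0// mul1r.
have elm : (ell m)%:R / m%:R <= mu + 1 by near: m; exact: near_ell.
have AM w : @A v m w <= M.
  apply: (@le_trans _ _ (m%:R^-1 / 2 * \sum_(k < ell m) (2 * C) ^+ 2)).
    rewrite ler_wpM2l ?divr_ge0 ?invr_ge0//; apply: ler_sum => k _.
    by apply: cond_var_le => //; exact: contrast_le.
  rewrite sumr_const card_ord -[(2 * C) ^+ 2 *+ _]mulr_natl mulrA.
  rewrite (_ : _ * (ell m)%:R = (ell m)%:R / m%:R / 2); last by ring.
  rewrite (@le_trans _ _ ((mu + 1) / 2 * (2 * C) ^+ 2))//; last by rewrite lerDl.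
  by rewrite ler_wpM2r ?sqr_ge0// ler_wpM2r.
have sM : s <= M.
  rewrite (le_trans (ler_norm s))// lerDr mulr_ge0 ?sqr_ge0// divr_ge0//.
  by rewrite addr_ge0// ltW.
pose f (w : Omega m) := cos (dot v (score_row (ell m) w) + a).
have fE w : f w = cos (t m * score r m b (X m) (contrast v) (ell m) w + a).
  by rewrite /f dot_score_row.
have bf : bdm f.
  rewrite (_ : f = fun w => cos (t m * score r m b (X m) (contrast v) (ell m) w + a)); last first.
    by apply/funext => w; rewrite fE.
  exact: (bdm_cos (bdmD (bdmM (bdm_cst (t m)) (bdm_score m (ell m) (contrast v))) (bdm_cst a)).1).
have f1 w : `|f w| <= 1 by rewrite ler_norml cos_le1 cos_geN1.
have bA := bdm_A v m.
have beA : bdm (fun w => expR (@A v m w)) by exact: bdm_expR.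
have h1 : `|\int[P m]_w (f w * expR (A v w)) - cos a| <= err m.
  have := characteristic_score b0 (hX m0) (contrast_le v) (ell m) a tsmall.
  rewrite t2 (_ : \int[P m]_w (cos _ * _) = \int[P m]_w (f w * expR (A v w))); last first.
    by apply: eq_Rintegral => w _; rewrite fE.
  move=> /le_trans; apply; rewrite (ger0_norm tm0) /err le_eqVlt; apply/orP; left; apply/eqP.
  have -> : (2 * t m * C) ^+ 3 = m%:R^-1 * t m * (2 * C) ^+ 3 by rewrite -t2; ring.
  have -> : (2 * t m * C) ^+ 2 = m%:R^-1 * (2 * C) ^+ 2 by rewrite -t2; ring.
  rewrite (_ : (ell m)%:R * (_ / 2) = (ell m)%:R / m%:R * ((2 * C) ^+ 2 / 2)); last by ring.
  by ring.
have h2 : `|\int[P m]_w (f w * expR s) - \int[P m]_w (f w * expR (A v w))| <=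
    expR M * \int[P m]_w `|A v w - s|.
  have bd : bdm (fun w => `|@A v m w - s|) by apply: bdm_norm; apply: bdmB bA (bdm_cst _).
  rewrite -(ExB (PT m) (bdmM bf (bdm_cst _)) (bdmM bf beA)) -(ExZ (PT m) _ bd).
  apply: (normr_Ex_le (PT m)).
  - exact: bdmB (bdmM bf (bdm_cst _)) (bdmM bf beA).
  - exact: bdmM (bdm_cst _) bd.
  - move=> w; rewrite -mulrBr normrM (le_trans (ler_piMl _ (f1 w)))// distrC.
    exact: expR_lip.
rewrite -(ExZ (PT m) _ bf) (eq_Rintegral _ (g := fun w => f w * expR s)); last first.
  by move=> w _; rewrite mulrC.
rewrite -[X in `|X|](subrKA (\int[P m]_w (f w * expR (A v w)))).
by rewrite (le_trans (ler_normD _ _))// addrC lerD.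
Unshelve. all: end_near. Qed.

End score_limit.

(** * Events of vanishing probability *)

Section vanishing_events.
Context {R : realType} {disp : nat -> measure_display}
  {Omega : forall m, measurableType (disp m)} (P : forall m, probability (Omega m) R).

Let PT m := probability_setT (P m).

(** Measurability goes with the bound because [levy_slutsky] asks for measurable exceptional
    events. *)
Definition vanishing (A : forall m, set (Omega m)) := forall e : R, 0 < e ->
  \forall m \near \oo, measurable (A m) /\ fine (P m (A m)) <= e.

Lemma measurable_exists (I : finType) m (A : I -> set (Omega m)) :
  (forall i, measurable (A i)) -> measurable [set w | exists i, A i w].
Proof.
move=> mA; rewrite (_ : [set w | _] = \bigcup_(i in [set: I]) A i).
  by apply: fin_bigcup_measurable => //; exact: finite_finset.
by apply/seteqP; split => w /= [i]; [exists i|move=> _ Ai; exists i].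
Qed.

Lemma prob_exists_le (I : finType) m (A : I -> set (Omega m)) :
  (forall i, measurable (A i)) ->
  fine (P m [set w | exists i, A i w]) <= \sum_i fine (P m (A i)).
Proof.
move=> mA; have mE := measurable_exists mA.
have bI i : bdm (\1_(A i) : Omega m -> R) by exact: bdm_indic.
rewrite -(Ex_indic _ mE).
have -> : \sum_i fine (P m (A i)) = \int[P m]_w \sum_i \1_(A i) w.
  rewrite (Ex_sum (PT m)) => [|i _]; last exact: bI.
  by apply: eq_bigr => i _; rewrite (Ex_indic _ (mA i)).
apply: (le_Ex (PT m)); [exact: bdm_indic|by apply: bdm_sum => i _; exact: bI|].
move=> w; rewrite indicE; have [/set_mem/= [i Ai]|_] := boolP (w \in _); last exact: sumr_ge0.
by rewrite (bigD1 i)//= indicE mem_set// lerDl sumr_ge0.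
Qed.

Lemma vanishing_exists (I : finType) (A : I -> forall m, set (Omega m)) :
  (forall i, vanishing (A i)) -> vanishing (fun m => [set w | exists i, A i m w]).
Proof.
move=> vA e e0; pose e' := e / (#|I|%:R + 1).
have I0 : 0 < #|I|%:R + 1 :> R by rewrite ltr_wpDl.
have e'0 : 0 < e' by rewrite divr_gt0.
have : \forall m \near \oo, forall i, measurable (A i m) /\ fine (P m (A i m)) <= e'.
  by apply: filter_forall => i; exact: vA.
apply: filterS => m h; have mA i := (h i).1.
split; first exact: measurable_exists.
rewrite (le_trans (prob_exists_le mA))// (@le_trans _ _ (\sum_(i : I) e'))//.
  by apply: ler_sum => i _; exact: (h i).2.
rewrite sumr_const -[leLHS]mulr_natl /e' mulrCA ler_piMr ?(ltW e0)//.
by rewrite ler_pdivrMr// mul1r lerDl.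
Qed.

Lemma vanishingU (A B : forall m, set (Omega m)) :
  vanishing A -> vanishing B -> vanishing (fun m => A m `|` B m).
Proof.
move=> vA vB e e0; have vAB c : vanishing (if c then A else B) by case: c.
have := vanishing_exists vAB e0; apply: filterS => m.
suff -> : A m `|` B m = [set w | exists c : bool, (if c then A else B) m w] by [].
apply/seteqP; split => w /=; last by case=> -[]; [left|right].
by case; [exists true|exists false].
Qed.

Lemma vanishing_markov (F : forall m, Omega m -> R) (eta : R) : 0 < eta ->
  (forall m, bdm (F m)) -> (forall m w, 0 <= F m w) ->
  \int[P m]_w F m w @[m --> \oo] --> 0 ->
  vanishing (fun m => [set w | eta < F m w]).
Proof.
move=> eta0 bF F0 cF e e0.
have ee : 0 < e * eta by rewrite mulr_gt0.
have := cF => /cvgrPdist_le/(_ _ ee); apply: filterS => m.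
rewrite sub0r normrN => /(le_trans (ler_norm _)) EF.
have mA : measurable [set w | eta < F m w].
  have := (bF m).1 measurableT _ (measurable_itv `]eta, +oo[); rewrite setTI.
  by congr measurable; apply/seteqP; split => w /=; rewrite in_itv/= andbT.
split => //; apply: (le_trans (markov_bdm (PT m) mA (bF m) eta0 _ _)).
- by [].
- by move=> w /= /ltW.
- by rewrite ler_pdivrMr.
Qed.

End vanishing_events.

(** * Jamming time and observed prefixes *)

Section jamming.
Context {R : realType} (d N : nat) (r : R) (m : nat) (b : 'rV[R]_N).
Context {disp : measure_display} {Omega : measurableType disp}.
Variables (P : probability Omega R) (X : nat -> {RV P >-> 'rV[R]_d}).

Lemma measurable_jamming_time : measurable_fun setT (jamming_time r m b X).
Proof.
(* The jamming time becomes an infimum of countably many measurable functions. *)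
pose g k (w : Omega) : \bar R :=
  if total_rate r m b (first_points X k w) == 0 then k%:R%:E else +oo%E.
rewrite (_ : jamming_time r m b X = fun w => einfs (g^~ w) 0).
  apply: measurable_fun_einfs => k.
  have mt : measurable_fun setT (fun w => total_rate r m b (first_points X k w)).
    apply: (measurableT_comp (f := fun y : k.-tuple _ => total_rate r m b y)).
      exact: measurable_total_rate.
    exact: measurable_first_points.
  apply: measurable_fun_ifT => //.
  by apply: measurable_fun_eqr => //; exact: measurable_cst.
apply/funext => w; rewrite /jamming_time /einfs /sdrop; apply/eqP; rewrite eq_le; apply/andP; split.
  apply/ereal_infP => _ [k _ <-]; rewrite /g; case: ifPn => [/eqP t0|_]; last exact: leey.
  by apply: ereal_inf_lbound; exists k.
apply/ereal_infP => _ [k /= t0 <-]; apply: ereal_inf_lbound; exists k => //.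
by rewrite /g t0 eqxx.
Qed.

Lemma total_rate_gt0_jamming n w : positive b ->
  (n%:R%:E <= jamming_time r m b X w)%E ->
  forall k, (k < n)%N -> 0 < total_rate r m b (first_points X k w).
Proof.
move=> b0 nj k kn; rewrite lt_neqAle total_rate_ge0// andbT; apply/negP => /eqP t0.
have : (jamming_time r m b X w <= k%:R%:E)%E by apply: ereal_inf_lbound; exists k.
by move/(le_trans nj); rewrite lee_fin ler_nat leqNgt kn.
Qed.

Lemma take_first_points n k w : (k <= n)%N ->
  take k (first_points X n w) = first_points X k w :> seq _.
Proof.
have fE l : first_points X l w = [seq X i w | i <- iota 0 l] :> seq _.
  by rewrite -val_enum_ord -map_comp.
by move=> kn; rewrite !fE -map_take take_iota (minn_idPl kn).
Qed.

Lemma nth_first_points n k w : (k < n)%N -> nth 0 (first_points X n w) k = X k w.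
Proof.
by move=> kn; rewrite -[k]/(val (Ordinal kn)) -tnth_nth tnth_mktuple.
Qed.

End jamming.

(** * The likelihood along a trajectory *)

Section csa_likelihood.
Context {R : realType} (d N : nat) (r : R).
Context {disp : nat -> measure_display} {Omega : forall m, measurableType (disp m)}
  (P : forall m, probability (Omega m) R).
Variable X : forall m, nat -> {RV (P m) >-> 'rV[R]_d}.
Variable b : 'rV[R]_N.
Hypothesis b0 : positive b.
Variables (m n : nat) (w : Omega m).
Hypothesis active : forall k, (k < n)%N -> 0 < total_rate r m b (first_points (X m) k w).

Let y := first_points (X m) n w.

(** Written with [take], as in [loglik], so that [log_likelihood] with these data is convertible to
    [loglik]. *)
Definition step_Gamma k j := Gamma r m j (take k y).

Definition type_count j : R := (t_stat r j y)%:R.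

Let step_GammaE k j : (k < n)%N -> step_Gamma k j = Gamma r m j (first_points (X m) k w).
Proof. by move=> kn; rewrite /step_Gamma take_first_points// ltnW. Qed.

Lemma normalizer_total_rate k : (k < n)%N ->
  normalizer step_Gamma k b = total_rate r m b (first_points (X m) k w).
Proof.
move=> kn; rewrite total_rateE big_ord_recl mul1r /normalizer step_GammaE//; congr (_ + _).
by apply: eq_bigr => i _; rewrite step_GammaE// rate_lift.
Qed.

(** Only type i + 1 has a nonzero coefficient, 1 / b_i, and [t_stat] sums its indicators because no
    step before n has jammed. *)
Lemma gradient_score i : gradient (size y) step_Gamma type_count b ord0 i =
  score r m b (X m) (contrast b (delta_mx ord0 i)) n w.
Proof.
have sum1 k : increment r m b (X m) (contrast b (delta_mx ord0 i)) k w =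
    (type_indic r m b (X m) k i.+1 w - type_prob r m b i.+1 (first_points (X m) k w)) / b ord0 i.
  rewrite /increment big_ord_recl mul0r add0r (bigD1 i)// big1 => [|j ji].
    by rewrite [LHS]addr0 contrast_lift mxE !eqxx mul1r mulrC lift0.
  by rewrite contrast_lift mxE eqxx (negPf ji) !mul0r.
rewrite /score; under eq_bigr do rewrite sum1.
rewrite -mulr_suml sumrB mulrBl mxE /type_count /t_stat natr_sum size_tuple mulr_suml.
congr (_ - _).
  rewrite mulr_suml; apply: eq_bigr => k _; rewrite /type_indic active//.
  by rewrite nth_first_points// take_first_points// ltnW.
rewrite mulr_suml; apply: eq_bigr => k _.
rewrite normalizer_total_rate// step_GammaE// /type_prob active// -lift0 rate_lift.
by field; rewrite !gt_eqF ?active.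
Qed.

Lemma information_fisher i j : information (size y) step_Gamma b i j =
  \sum_(k < n) fisher b (Gamma_row N r X k w) i j.
Proof.
rewrite mxE size_tuple; apply: eq_bigr => k _.
have act := active (ltn_ord k).
rewrite normalizer_total_rate// !step_GammaE// mxE !share_type_prob// /type_prob act.
rewrite !rate_lift !lift0.
by case: eqVneq => [<-|_]; rewrite ?mulr1 ?mulr0; field; rewrite !gt_eqF ?b0.
Qed.

End csa_likelihood.

(** * Exceptional events of the estimator *)

Section estimator_events.
Context {R : realType} (d N : nat) (r : R).
Context {disp : nat -> measure_display} {Omega : forall m, measurableType (disp m)}
  (P : forall m, probability (Omega m) R).
Variable X : forall m, nat -> {RV (P m) >-> 'rV[R]_d}.
Variable b : 'rV[R]_N.
Hypothesis b0 : positive b.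

Let PT m := probability_setT (P m).

Lemma bdm_dot_score_row v m n : bdm (fun w : Omega m => dot v (score_row r X b n w)).
Proof.
under eq_fun do rewrite dot_score_row.
exact: bdmM (bdm_cst _) (adapted_bdm (adapted_score r m (X m) b0 _ n)).
Qed.

Variables (ell : nat -> nat) (theta mu : R).
Hypothesis hmu : 0 < mu < theta.
Hypothesis hell : (ell m)%:R / m%:R @[m --> \oo] --> mu.

(** Off the event, K_m / m exceeds theta - e = mu + e, the midpoint of mu and theta, while [ell m] /
    m is eventually at most that. *)
Lemma vanishing_jam :
  cvg_in_probability P (fun m w => (jamming_time r m b (X m) w * (m%:R^-1)%:E)%E) theta ->
  exists2 A, vanishing P A & \forall m \near \oo, forall w, ~ A m w ->
    ((ell m)%:R%:E <= jamming_time r m b (X m) w)%E.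
Proof.
move=> hjam; pose e := (theta - mu) / 2.
have e0 : 0 < e by rewrite divr_gt0// subr_gt0; case/andP: hmu.
exists (fun m => [set w | (e%:E <= `|jamming_time r m b (X m) w * (m%:R^-1)%:E - theta%:E|)%E]).
  move=> del del0; have := hjam e e0 => /fine_cvg/cvgrPdist_le/(_ _ del0).
  apply: filterS => m; rewrite sub0r normrN => /(le_trans (ler_norm _)) h; split => //.
  have mj : measurable_fun setT (fun w : Omega m =>
      `|jamming_time r m b (X m) w * (m%:R^-1)%:E - theta%:E|%E).
    apply: (measurableT_comp (@abse_measurable R setT)).
    apply: emeasurable_funB => //; apply: emeasurable_funM => //.
    exact: measurable_jamming_time.
  have := mj measurableT _ (emeasurable_itv `[e%:E, +oo[); rewrite setTI.
  by congr measurable; apply/seteqP; split => w /=; rewrite in_itv/= andbT.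
have : \forall m \near \oo, (ell m)%:R / m%:R <= mu + e.
  by have := hell => /cvgrPdist_le/(_ _ e0); apply: filterS => m; rewrite distrC ler_norml => /andP[_]; lra.
move=> elm; near=> m => w /= /negP; rewrite -ltNge.
have m0 : 0 < m%:R :> R by rewrite ltr0n; near: m; exact: nbhs_infty_gt.
have le : (ell m)%:R / m%:R <= mu + e by near: m.
have mV : (0 < (m%:R^-1)%:E :> \bar R)%E by rewrite lte_fin invr_gt0.
case: (jamming_time r m b (X m) w) => [x||].
- rewrite -EFinM -EFinB abse_EFin lte_fin ltr_norml => /andP[h _].
  rewrite lee_fin; apply: ltW; rewrite -(ltr_pM2r (_ : 0 < m%:R^-1)) ?invr_gt0//.
  by rewrite (le_lt_trans le)//; move: h; rewrite /e; lra.
- by rewrite leey.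
- by rewrite gt0_mulNye.
Unshelve. all: end_near. Qed.

Variable gamma : nat -> R -> R.
Hypothesis gamma0 : forall (j : nat) l, (j <= N)%N -> 0 < l < mu -> 0 < gamma j l.
Hypothesis hgamma : forall j (l : R) (k : nat -> nat), (j <= N)%N ->
    0 < l < mu -> (k m)%:R / m%:R @[m --> \oo] --> l ->
    cvg_in_probability P
      (fun m w => (Gamma r m j (first_points (X m) (k m) w) / m%:R)%:E) (gamma j l).

(** Supplies the step with all areas positive that [gradient_unique] requires. Step floor (mu m / 2)
    is well inside the observation window, and an empty area there would deviate from its limit
    density by the whole of that density. *)
Lemma vanishing_Gamma0 :
  exists2 A, vanishing P A & \forall m \near \oo, forall w, ~ A m w ->
    exists2 k, (k < ell m)%N & forall j, (j <= N)%N -> 0 < Gamma r m j (first_points (X m) k w).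
Proof.
have mu0 : 0 < mu by case/andP: hmu.
pose l := mu / 2; pose k m := Num.truncn (l * m%:R).
have lD : 0 < l < mu by rewrite divr_gt0//= ltr_pdivrMr// ltr_pMr// ltr1n.
have l0 : 0 <= l by case/andP: lD => /ltW.
have ck := cvg_truncn_ratio l0.
pose A m := [set w : Omega m | exists j : 'I_N.+1, gamma j l <=
  `|Gamma r m j (first_points (X m) (k m) w) / m%:R - gamma j l|].
exists A.
  apply: vanishing_exists => j del del0.
  have jN : (j <= N)%N by rewrite -ltnS.
  have := near_prob_le (hgamma jN lD ck) (gamma0 jN lD) del0.
  by apply: filterS => m h; split => //; exact: measurable_Gamma_dist.
near=> m => w nA; have m0 : 0 < m%:R :> R by rewrite ltr0n; near: m; exact: nbhs_infty_gt.
exists (k m).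
  rewrite -(ltr_nat R) -(ltr_pM2r (_ : 0 < m%:R^-1)) ?invr_gt0//.
  (* Any value strictly between mu / 2 and mu separates the two ratios. *)
  apply: (@lt_trans _ _ (3 / 4 * mu)).
    near: m; apply: (cvgr_lt l ck); rewrite /l; move: mu0; lra.
  by near: m; apply: (cvgr_gt mu hell); move: mu0; lra.
move=> j jN; rewrite -(pmulr_lgt0 _ (_ : 0 < m%:R^-1)) ?invr_gt0// ltNge; apply/negP => h.
apply: nA; exists (Ordinal (jN : (j < N.+1)%N)) => /=.
have g0 := gamma0 jN lD.
by rewrite ler0_norm; [rewrite opprB lerBrDr -lerBrDl subrr|rewrite subr_le0 (le_trans h)// ltW].
Unshelve. all: end_near. Qed.

End estimator_events.

(** * Asymptotic normality of the maximum likelihood estimator *)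

Theorem theorem4p2 (R : realType) (d N : nat) (r : R)
  (hd : (0 < d)%N) (hN : (0 < N)%N) (hr : 0 < r)
  (B : set 'rV[R]_N) (hBopen : open B)
  (hBpos : forall b, B b -> positive b)
  (beta0 : 'rV[R]_N) (hbeta0 : B beta0)
  (disp : nat -> measure_display)
  (Omega : forall m, measurableType (disp m))
  (P : forall m, probability (Omega m) R)
  (X : forall m, nat -> {RV (P m) >-> 'rV[R]_d})
  (hX : forall m, (0 < m)%N -> is_csa r m beta0 (X m))
  (ell : nat -> nat)
  (hellpos : forall m, (0 < m)%N -> (0 < ell m)%N)
  (hellmono : forall m n, (0 < m)%N -> (m <= n)%N -> (ell m <= ell n)%N)
  (theta : R) (htheta : 0 < theta)
  (hjam : cvg_in_probability P
    (fun m w => (jamming_time r m beta0 (X m) w * (m%:R^-1)%:E)%E) theta)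
  (gamma : nat -> R -> R)
  (hgamma : forall j (lambda : R) (k : nat -> nat), (j <= N)%N ->
    0 < lambda < theta -> (k m)%:R / m%:R @[m --> \oo] --> lambda ->
    cvg_in_probability P
      (fun m w => (Gamma r m j (first_points (X m) (k m) w) / m%:R)%:E)
      (gamma j lambda))
  (hgammapos : forall j (lambda : R), (j <= N)%N -> 0 < lambda < theta ->
    0 < gamma j lambda)
  (hgammacont : forall j (lambda : R), (j <= N)%N -> 0 < lambda < theta ->
    {for lambda, continuous (gamma j)})
  (beta_hat : forall m, {mfun (ell m).-tuple 'rV[R]_d >-> 'rV[R]_N})
  (hbeta_hat : forall m (w : Omega m), (0 < m)%N ->
    let y := first_points (X m) (ell m) w in
    ((ell m)%:R%:E <= jamming_time r m beta0 (X m) w)%E ->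
    (exists! b : 'rV[R]_N, positive b /\ score_zero r m y b) ->
    is_mle r m y (beta_hat m y))
  (mu : R) (hmu : 0 < mu < theta)
  (hell : (ell m)%:R / m%:R @[m --> \oo] --> mu) :
  cvg_in_distribution P
    (fun m w => Num.sqrt m%:R *:
       (beta_hat m (first_points (X m) (ell m) w) - beta0))
    (gaussian (invmx (J gamma beta0 mu))).
Proof.
have b0 := hBpos _ hbeta0; have [mu0 muth] := andP hmu.
have lth (l : R) : 0 < l < mu -> 0 < l < theta.
  by move=> /andP[-> lm]; exact: lt_trans muth.
have g0 (j : nat) (l : R) (jN : (j <= N)%N) (lD : 0 < l < mu) := hgammapos j l jN (lth l lD).
have gc (j : nat) (l : R) (jN : (j <= N)%N) (lD : 0 < l < mu) := hgammacont j l jN (lth l lD).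
have hg j (l : R) k (jN : (j <= N)%N) (lD : 0 < l < mu) := hgamma j l k jN (lth l lD).
have pS : posdef (J gamma beta0 mu) := posdef_J b0 mu0 g0 gc.
have PT m := probability_setT (P m).
set S := J gamma beta0 mu in pS *; pose T := invmx S.
have lln i j := information_lln b0 mu0 g0 hg i j hell.
pose W m w := score_row r X beta0 (ell m) (w : Omega m).
have TS : T^T = T by rewrite /T trmx_inv pS.1.
have dotWT m (w : Omega m) u : dot u (W m w *m T) = dot (u *m T) (W m w).
  by rewrite !dotE trmx_mul TS mulmxA.
have coordE (x : 'rV[R]_N) i : x ord0 i = dot (delta_mx ord0 i) x.
  by rewrite -[delta_mx _ _]scale1r dot_delta mul1r.
pose c v : R := (mu + 1) * (2 * contrast_bound beta0 v) ^+ 2.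
have c0 v : 0 <= c v by rewrite mulr_ge0 ?sqr_ge0// addr_ge0// ltW.
(* [Y] is the linearised estimator W J^-1, whose limit law has covariance J^-1 J J^-1 = J^-1; [V] is
   the rescaled error of the estimator itself. *)
apply: (@levy_slutsky _ _ _ _ P _ (gaussianT pS) (fun m w => W m w *m T) _ _ _ _
  (\sum_i c (delta_mx ord0 i *m T))).
- move=> m i; under eq_fun do rewrite coordE dotWT.
  exact: bdm_dot_score_row.
- move=> m; apply/measurable_fun_rVP => i.
  rewrite (_ : (fun w => _) = fun w => Num.sqrt m%:R *
    (beta_hat m (first_points (X m) (ell m) w) ord0 i - beta0 ord0 i)); last first.
    by apply/funext => w; rewrite !mxE.
  apply: measurable_funM => //; apply: measurable_funB => //.
  apply: (measurableT_comp (measurable_rV_coord i)).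
  by apply: measurableT_comp => //; exact: measurable_first_points.
- move=> u a; rewrite (gaussian_cos pS).
  under eq_cvg do under eq_Rintegral do rewrite dotWT.
  have := cvg_char_score b0 mu0 hell hX lln (v := u *m T) (a := a).
  rewrite (_ : bilin (J gamma beta0 mu) (u *m T) (u *m T) = bilin T u u)//.
  rewrite /bilin trmx_mul TS -(mulmxA u T) mulVmx ?posdef_unitmx// mulmx1.
  by rewrite mulmxA.
- have : \forall m \near \oo, forall i, \int[P m]_w (dot (delta_mx ord0 i *m T) (W m w) ^+ 2) <=
      c (delta_mx ord0 i *m T).
    by apply: filter_forall => i; exact: (score_row_sq b0 hell hX).
  apply: filterS => m h.
  under eq_Rintegral do under eq_bigr do rewrite coordE dotWT.
  rewrite (Ex_sum (PT m)); first by apply: ler_sum => i _; exact: h.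
  by move=> i _; apply: bdmX; exact: bdm_dot_score_row.
move=> e del e0 del0.
pose C := \sum_i c (delta_mx ord0 i); have C0 : 0 <= C by exact: sumr_ge0.
(* By Chebyshev some coordinate of [W] exceeds K with probability at most C / K^2 <= e / 2. *)
pose K : R := 2 * C / e + 1.
have K1 : 1 <= K by rewrite /K lerDr divr_ge0 ?(ltW e0)// mulr_ge0.
have K0 : 0 < K by exact: lt_le_trans K1.
have CK : C / K ^+ 2 <= e / 2.
  rewrite ler_pdivrMr ?exprn_gt0// (@le_trans _ _ (e / 2 * K))//; last first.
    by rewrite ler_wpM2l ?divr_ge0 ?(ltW e0)// expr2 ler_peMr// ltW.
  by rewrite /K mulrDr mulr1 (_ : e / 2 * _ = C) ?lerDl ?divr_ge0 ?(ltW e0)//; field; rewrite gt_eqF.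
have mu10 : 0 <= mu + 1 by rewrite addr_ge0// ltW.
have [eta eta0 crit] := critical_point_asymptotics pS b0 mu10 (ltW K0) del0.
(* Four exceptional events: a large score, an information far from J, jamming before [ell m], and
   the failure of all areas to be positive at a common step. The first is made small through the
   choice of K only; the probabilities of the others tend to 0. *)
pose A1 m := [set w : Omega m | exists i, K < `|W m w ord0 i|].
pose F i j m (w : Omega m) :=
  `|m%:R^-1 * \sum_(k < ell m) fisher beta0 (Gamma_row N r X k w) i j - S i j|.
pose A2 m := [set w : Omega m | exists ij : 'I_N * 'I_N, eta < F ij.1 ij.2 m w].
have vA2 : vanishing P A2.
  apply: (@vanishing_exists _ _ _ P _ (fun ij m => [set w | eta < F ij.1 ij.2 m w])) => -[i j].
  apply: (@vanishing_markov _ _ _ P (F i j) eta eta0) => [m|m w|]; [|exact: normr_ge0|exact: lln].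
  apply: bdm_norm; apply: bdmB (bdm_cst _); apply: bdmM (bdm_cst _) _.
  by apply: bdm_sum => k _; exact: bdm_fisher.
have [A3 vA3 jam] := vanishing_jam hmu hell hjam.
have [A4 vA4 Gpos] := vanishing_Gamma0 hmu hell g0 hg.
have e20 : 0 < e / 2 by rewrite divr_gt0.
have near_ell : \forall m \near \oo, (ell m)%:R / m%:R <= mu + 1.
  have := hell => /cvgrPdist_le/(_ _ ltr01); apply: filterS => m.
  by rewrite distrC ler_norml => /andP[_]; lra.
have near_sq : \forall m \near \oo, forall i, \int[P m]_w (dot (delta_mx ord0 i) (W m w) ^+ 2) <=
    c (delta_mx ord0 i).
  by apply: filter_forall => i; exact: (score_row_sq b0 hell hX).
have vA := vanishingU vA2 (vanishingU vA3 vA4) e20.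
near=> m.
have m0 : (0 < m)%N by near: m; exact: nbhs_infty_gt.
have [mA PA] : measurable (A2 m `|` (A3 m `|` A4 m)) /\
    fine (P m (A2 m `|` (A3 m `|` A4 m))) <= e / 2 by near: m.
have sq : forall i, \int[P m]_w (dot (delta_mx ord0 i) (W m w) ^+ 2) <= c (delta_mx ord0 i) by near: m.
have bW i : bdm (fun w : Omega m => W m w ord0 i).
  under eq_fun do rewrite coordE; exact: bdm_dot_score_row.
have mWi i : measurable [set w : Omega m | K < `|W m w ord0 i|].
  have := (bdm_norm (bW i)).1 measurableT _ (measurable_itv `]K, +oo[); rewrite setTI.
  by congr measurable; apply/seteqP; split => w /=; rewrite in_itv/= andbT.
have mA1 : measurable (A1 m) by exact: measurable_exists.
have PA1 : fine (P m (A1 m)) <= e / 2.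
  rewrite (le_trans (prob_exists_le P mWi))// (le_trans _ CK)// mulr_suml.
  apply: ler_sum => i _.
  have K20 : 0 < K ^+ 2 by rewrite exprn_gt0.
  apply: (le_trans (markov_bdm (PT m) (mWi i) (bdmX 2 (bW i)) K20 _ _)).
  - by move=> w; exact: sqr_ge0.
  - move=> w /= /ltW Kw; rewrite -[leRHS]real_normK ?num_real// lerXn2r ?nnegrE// ltW//.
  - rewrite ler_wpM2r ?invr_ge0 ?(ltW K20)//; apply: le_trans (sq i).
    by under eq_Rintegral do rewrite coordE.
exists (A1 m `|` (A2 m `|` (A3 m `|` A4 m))); split; first exact: measurableU.
  have mU : measurable (A1 m `|` (A2 m `|` (A3 m `|` A4 m))) by exact: measurableU.
  rewrite -(Ex_indic _ mU) (@le_trans _ _ (\int[P m]_w (\1_(A1 m) w + \1_(A2 m `|` (A3 m `|` A4 m)) w)))//.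
    apply: (le_Ex (PT m)); [exact: bdm_indic|by apply: bdmD; exact: bdm_indic|].
    by move=> w; rewrite !indicE in_setU; case: (w \in A1 m); case: (w \in _ `|` _);
      rewrite /= ?mulr1n ?addr0 ?add0r ?lerDl.
  rewrite (ExD (PT m)); [|exact: bdm_indic|exact: bdm_indic].
  rewrite (Ex_indic _ mA1) (Ex_indic _ mA); move: PA PA1; lra.
(* From here on one trajectory is fixed and the argument is deterministic. *)
move=> w nA i.
have nA1 : ~ A1 m w by move=> h; apply: nA; left.
have nA2 : ~ A2 m w by move=> h; apply: nA; right; left.
have nA3 : ~ A3 m w by move=> h; apply: nA; right; right; left.
have nA4 : ~ A4 m w by move=> h; apply: nA; right; right; right.
have jm : ((ell m)%:R%:E <= jamming_time r m beta0 (X m) w)%E by apply: (near jam m).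
have act k (kl : (k < ell m)%N) := total_rate_gt0_jamming b0 jm kl.
pose y := first_points (X m) (ell m) w.
pose G := step_Gamma r X (ell m) w; pose t := type_count r X (ell m) w.
have G0 k j : 0 <= G k j by exact: Gamma_ge0.
have szy : size y = ell m by rewrite size_tuple.
have D0 k : (k < size y)%N -> 0 < normalizer G k beta0.
  by rewrite szy => kl; rewrite normalizer_total_rate// act.
have Gk : exists2 k, (k < size y)%N & forall j, (j <= N)%N -> 0 < G k j.
  have [k kl kpos] : exists2 k, (k < ell m)%N & forall j, (j <= N)%N ->
    0 < Gamma r m j (first_points (X m) k w) by apply: (near Gpos m).
  exists k; first by rewrite szy.
  by move=> j jN; rewrite /G /step_Gamma take_first_points ?kpos// ltnW.
have Lm : (size y)%:R <= (mu + 1) * m%:R.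
  by rewrite szy -ler_pdivrMr ?ltr0n//; apply: (near near_ell m).
have WE : (Num.sqrt m%:R)^-1 *: gradient (size y) G t beta0 = W m w.
  by apply/rowP => k; rewrite mxE gradient_score// /W /score_row !mxE.
have WK : `|(Num.sqrt m%:R)^-1 *: gradient (size y) G t beta0| <= K.
  rewrite WE; apply: norm_le_coord; first exact: ltW.
  by move=> k; rewrite leNgt; apply/negP => h; apply: nA1; exists k.
have infoS k l : `|m%:R^-1 * information (size y) G beta0 k l - S k l| <= eta.
  by rewrite information_fisher// leNgt; apply/negP => h; apply: nA2; exists (k, l).
have [//|bh [bhp gbh uniq close]] := near crit m _ _ _ t G0 D0 Gk Lm WK infoS.
have zero_grad (b : 'rV[R]_N) : positive b -> score_zero r m y b <-> gradient (size y) G t b = 0.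
  by move=> bp; exact: (gradient_eq0 t G0 D0 bp).
(* Existence and uniqueness of the positive critical point activate the defining property of the
   estimator, which therefore equals [bh]. *)
have [bp sc _] : is_mle r m y (beta_hat m y).
  apply: hbeta_hat => //; exists bh; split; first by split => //; apply/zero_grad.
  by move=> b' [b'p /zero_grad-/(_ b'p)]; exact: uniq.
have <- : bh = beta_hat m y by apply: uniq => //; apply/zero_grad.
by move: (close i); rewrite WE !mxE.
Unshelve. all: end_near. Qed.
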